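(* Let $(a,b)\subset\mathbb{R}$ be a bounded open interval, let $p\in(1,+\infty)$, and let $\psi\colon\mathbb{R}\to(0,+\infty)$ be a bounded Borel function such that $\int_{-\infty}^{+\infty}(\psi(t))^{1/p}\,dt<+\infty$ and $\inf_{t\in K}\psi(t)>0$ for every compact set $K\subset\mathbb{R}$. Define $\mathcal{F}_p\colon L^1((a,b))\to[0,+\infty]$ by $$\mathcal{F}_p(u):=\int_a^b|u'|\,dx+\int_a^b\psi(u')|u''|^p\,dx\ \text{ if }u\in W^{2,p}((a,b)),\qquad \mathcal{F}_p(u):=+\infty\ \text{ otherwise,}$$ and define $\overline{\mathcal{F}}_p\colon L^1((a,b))\to[0,+\infty]$ by $$\overline{\mathcal{F}}_p(u):=\inf\Big\{\liminf_{k\to\infty}\mathcal{F}_p(u_k):\ u_k\to u\text{ in }L^1((a,b))\Big\}.$$ Then for every $u\in L^1((a,b))$ $$\overline{\mathcal{F}}_p(u)=\begin{cases}\displaystyle |u'|((a,b))+\int_a^b|v'|^p\,dx&\text{if }u\in X^p_\psi((a,b)),\\ +\infty&\text{otherwise,}\end{cases}$$ where $v:=\Psi_p\circ(u')^a$.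
   Context: For $u\in BV((a,b))$ the distributional derivative $u'$ is a bounded Radon measure with total variation measure $|u'|$; its Lebesgue decomposition is $u'=(u')^a\mathcal{L}^1+(u')^s$, where $(u')^a\in L^1((a,b))$ is the density of the absolutely continuous part and $(u')^s$ the singular part. $M:=\int_{\mathbb{R}}\psi^{1/p}\,dt$, and $\Psi_p\colon[-\infty,+\infty]\to[0,M]$, $\Psi_p(t):=\int_{-\infty}^t(\psi(s))^{1/p}\,ds$. $Z^{\pm}[(u')^a]:=\{x\in(a,b):\lim_{\varepsilon\to0+}\frac1{2\varepsilon}\int_{x-\varepsilon}^{x+\varepsilon}(u')^a\,dx=\pm\infty\}$. $X^p_\psi((a,b))$ is the set of all $u\in BV((a,b))$ such that $v:=\Psi_p\circ(u')^a\in W^{1,p}((a,b))$ and the positive and negative parts $((u')^s)^+$ and $((u')^s)^-$ of the measure $(u')^s$ are concentrated on $Z^+[(u')^a]$ and $Z^-[(u')^a]$, respectively (a measure is concentrated on a set if the complement of the set has measure zero). *)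

(* Defs.v *)
From mathcomp Require Import all_boot all_order all_algebra.
From mathcomp Require Import all_classical all_reals all_analysis.

Set Implicit Arguments.
Unset Strict Implicit.
Unset Printing Implicit Defensive.

Import Order.TTheory GRing.Theory Num.Theory.
Import numFieldNormedType.Exports.

Local Open Scope classical_set_scope.
Local Open Scope ring_scope.

Section signed_measures.
Context {d : measure_display} {T : measurableType d} {R : realType}.
Implicit Types nu s : {charge set T -> \bar R}.

(* The Jordan decomposition of the library takes a Hahn decomposition as an
   argument; on measurable sets the result does not depend on the one chosen. *)
Definition hahn_proof nu :=
  projT2 (cid (projT2 (cid (Hahn_decomposition nu)))).

Definition charge_pos nu : {finite_measure set T -> \bar R} :=
  jordan_pos (hahn_proof nu).

Definition charge_neg nu : {finite_measure set T -> \bar R} :=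
  jordan_neg (hahn_proof nu).

Definition tot_var nu : set T -> \bar R := charge_variation (hahn_proof nu).

Definition charge_integral nu (D : set T) (f : T -> R) : R :=
  \int[charge_pos nu]_(x in D) f x - \int[charge_neg nu]_(x in D) f x.

Definition mutually_singular nu (mu : {measure set T -> \bar R}) : Prop :=
  exists S : set T,
    [/\ measurable S, mu S = 0%E & tot_var nu (~` S) = 0%E].

Definition lebesgue_decomp (mu : {measure set T -> \bar R}) nu
    (w : T -> R) s : Prop :=
  [/\ mu.-integrable setT (EFin \o w), mutually_singular s mu &
      forall A, measurable A ->
        nu A = (\int[mu]_(x in A) (w x)%:E + s A)%E].

(* Densities are unique up to null sets and the singular part is unique on
   measurable sets, so these two choices agree with one another. *)
Definition ac_density (mu : {measure set T -> \bar R}) nu : T -> R :=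
  get [set w | exists s, lebesgue_decomp mu nu w s].

Definition sing_part (mu : {measure set T -> \bar R}) nu
    : {charge set T -> \bar R} :=
  xget (czero : {classic {charge set T -> \bar R}})
    [set s | exists w, lebesgue_decomp mu nu w s].

End signed_measures.

(* Functions on (a, b) are represented by functions R -> R whose values outside
   (a, b) are irrelevant; L^p classes are represented by their elements. *)
Section one_dimensional_spaces.
Context {R : realType}.
Implicit Types (a b p : R) (u g w phi : R -> R).
Implicit Types nu : {charge set (measurableTypeR R) -> \bar R}.

Local Notation mu := (@lebesgue_measure R).

Definition Lp_space a b p : set (R -> R) :=
  [set u | u \_ `]a, b[ \in Lfun mu p%:E].

Definition test_function a b : set (R -> R) :=
  [set phi | (forall (n : nat) (x : R), derivable (derive1n n phi) x 1) /\
    (compact (closure [set x | phi x != 0]) /\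
     closure [set x | phi x != 0] `<=` `]a, b[)].

Definition is_weak_derivative a b u g : Prop :=
  [/\ locally_integrable `]a, b[ u, locally_integrable `]a, b[ g &
      forall phi, test_function a b phi ->
        \int[mu]_(x in `]a, b[) (u x * derive1 phi x) =
        - \int[mu]_(x in `]a, b[) (g x * phi x)].

(* Unique up to null sets when it exists. *)
Definition weak_derivative a b u : R -> R :=
  get [set g | is_weak_derivative a b u g].

Definition W1p_space a b p : set (R -> R) :=
  [set u | Lp_space a b p u /\
    exists2 g, Lp_space a b p g & is_weak_derivative a b u g].

Definition W2p_space a b p : set (R -> R) :=
  [set u | W1p_space a b p u /\ W1p_space a b p (weak_derivative a b u)].

(* Measures on (a, b) are seen as measures on R that vanish outside (a, b). *)
Definition is_distr_derivative a b u nu : Prop :=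
  (forall A, measurable A -> nu A = nu (A `&` `]a, b[)) /\
  forall phi, test_function a b phi ->
    \int[mu]_(x in `]a, b[) (u x * derive1 phi x) =
    - charge_integral nu `]a, b[ phi.

Definition BV_space a b : set (R -> R) :=
  [set u | Lp_space a b 1 u /\ exists nu, is_distr_derivative a b u nu].

(* Unique on measurable sets when it exists. *)
Definition distr_derivative a b u : {charge set (measurableTypeR R) -> \bar R} :=
  xget (czero : {classic {charge set (measurableTypeR R) -> \bar R}})
    [set nu | is_distr_derivative a b u nu].

Definition deriv_ac a b u : R -> R := ac_density mu (distr_derivative a b u).

Definition deriv_sing a b u : {charge set (measurableTypeR R) -> \bar R} :=
  sing_part mu (distr_derivative a b u).

Definition average w (x e : R) : R :=
  (2 * e)^-1 * \int[mu]_(y in `]x - e, x + e[) w y.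

Definition Zpos a b w : set R :=
  `]a, b[ `&` [set x | average w x e @[e --> 0^'+] --> +oo].

Definition Zneg a b w : set R :=
  `]a, b[ `&` [set x | average w x e @[e --> 0^'+] --> -oo].

Definition Psi p (psi : R -> R) (t : \bar R) : R :=
  \int[mu]_(s in [set s : R | (s%:E <= t)%E]) (psi s `^ p^-1).

Definition Psi_deriv_ac a b p (psi : R -> R) u : R -> R :=
  fun x => Psi p psi (deriv_ac a b u x)%:E.

Definition X_space a b p (psi : R -> R) : set (R -> R) :=
  [set u | [/\ BV_space a b u,
    W1p_space a b p (Psi_deriv_ac a b p psi u),
    (charge_pos (deriv_sing a b u)).-negligible
      (`]a, b[ `\` Zpos a b (deriv_ac a b u)) &
    (charge_neg (deriv_sing a b u)).-negligible
      (`]a, b[ `\` Zneg a b (deriv_ac a b u))]].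

Definition F_functional a b p (psi : R -> R) u : \bar R :=
  let u' := weak_derivative a b u in
  let u'' := weak_derivative a b u' in
  if u \in W2p_space a b p then
    (\int[mu]_(x in `]a, b[) `|u' x|%:E +
     \int[mu]_(x in `]a, b[) (psi (u' x) * `|u'' x| `^ p)%:E)%E
  else +oo%E.

Definition cvg_L1 a b (u_ : nat -> R -> R) u : Prop :=
  (\int[mu]_(x in `]a, b[) `|u_ k x - u x|%:E)%E @[k --> \oo] --> 0%E.

Definition relaxation a b (F : (R -> R) -> \bar R) u : \bar R :=
  ereal_inf [set limn_einf (fun k => F (u_ k)) | u_ in
    [set u_ : nat -> R -> R |
      (forall k, Lp_space a b 1 (u_ k)) /\ cvg_L1 a b u_ u]].

End one_dimensional_spaces.

(* Main.v *)
(** Lower bound.  If [F (u_ k) <= C], Young's inequality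
    [p e^((p-1)s) t <= t^p + (p-1) e^(ps)], applied with
    [t = psi(u_k')^(1/p) |u_k''| = |(Psi_p o u_k')'|] and integrated, makes the
    functions [v_k = Psi_p o u_k'] equicontinuous.  Along an ultrafilter they
    converge uniformly to some [v], and the energy densities and the measures
    [(u_k')^+ dx], [(u_k')^- dx] converge to measures.  Optimizing Young's
    inequality over rational [s] gives [|v'|^p <=] the density of the limit
    energy.  Where [v < M] the functions [(u_k')^+] are eventually bounded and
    converge uniformly, so the limit of [(u_k')^+ dx] is absolutely continuous
    there with density [(Psi_p^-1 o v)^+]; its singular part sits on [v = M],
    where the averages of [Psi_p^-1 o v] tend to [+oo].

    Upper bound.  Let [s+], [s-] be the singular parts of [u'].  For large [h]
    replace [x] by [th_h], the generalized inverse of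
    [x + (s+ + s-)(]-oo, x]) / h].  The candidate derivative is
    [Psi_p^-1 o v o th_h], truncated to [[-h, h]].  It equals [+h] or [-h] on the
    set, of measure [s+/h] or [s-/h], inserted by the time change, which restores
    the singular mass, and since [th_h] is 1-Lipschitz the energy does not
    increase. *)
Require Import Defs.
From mathcomp Require Import all_boot all_order all_algebra.
From mathcomp Require Import all_classical all_reals all_analysis.
From mathcomp Require Import measurable_realfun ring lra.
From HB Require Import structures.

Set Implicit Arguments.
Unset Strict Implicit.
Unset Printing Implicit Defensive.

Import Order.TTheory GRing.Theory Num.Theory.
Import numFieldNormedType.Exports.

Local Open Scope classical_set_scope.
Local Open Scope ring_scope.

(** * Measures and primitives on the line *)

(** Weak limits are taken at the level of cumulative functions: their values are bounded, so an
    ultrafilter makes all of them converge at once, and a monotone limit defines a measure once it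
    is made right-continuous. Relations between measures are therefore checked on intervals []x, y]]
    and extended by uniqueness. The obstacle in the lower bound is that the inverse of [Psi_p] is
    Lipschitz only away from the extreme values 0 and M, so uniform convergence of [v_k] says
    nothing about [u_k'] near them; truncation at height n restores a Lipschitz inverse because psi
    is bounded below on [[-n, n]]. The parameter s of Young's inequality serves twice: for large s
    the bounded energy is divided by [p e^((p-1)s)], which gives equicontinuity and absolute
    continuity of the limit, while s = ln t gives back [t^p]. As psi is only Borel, the chain rule
    is proved by pushing measures forward. In the upper bound, the set inserted by the time change
    costs no energy: [th_h] maps it into a Lebesgue null set, on which v' may be set to 0. *)

Section measures_on_the_line.
Context {R : realType}.
Local Notation TR := (measurableTypeR R).
Local Notation mu := (@lebesgue_measure R).

Lemma eq_measure_oc (m1 m2 : {measure set TR -> \bar R}) :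
  (forall x y, x < y -> m1 `]x, y]%classic = m2 `]x, y]%classic) ->
  (forall x y, (m1 `]x, y]%classic < +oo)%E) ->
  forall A : set R, measurable A -> m1 A = m2 A.
Proof.
move=> m12 m1oo A mA.
apply: (@measure_unique _ R TR (@ocitv R) (fun k => `](- k%:R), k%:R]%classic)) => //.
- exact: ocitvI.
- by move=> k; exact: is_ocitv.
- exact: (bigcup_itvT false false).
- move=> B /ocitvP[->|[x x12 ->]]; first by rewrite !measure0.
  exact: m12.
Qed.

(** The measure with density [h] is absolutely continuous, and its Radon-Nikodym derivative has the
    same integrals as [h] on measurable sets; the two agree almost everywhere, which yields the
    integration formula. *)
Lemma density_measure (h : R -> R) :
  mu.-integrable setT (EFin \o h) -> (forall x, 0 <= h x) ->
  exists m : {finite_measure set TR -> \bar R},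
    (forall A : set R, measurable A -> m A = (\int[mu]_(x in A) (h x)%:E)%E) /\
    (forall (A : set R) (f : R -> \bar R), measurable A -> measurable_fun A f ->
       (forall x, 0 <= f x)%E ->
       (\int[m]_(x in A) f x = \int[mu]_(x in A) (f x * (h x)%:E))%E).
Proof.
move=> ih h0.
pose c := induced_charge ih.
have c0 E : (0 <= c E)%E by apply: integral_ge0 => x _; rewrite lee_fin.
pose m := measure_of_charge c c0.
have mfin : fin_num_fun m by move=> A mA; exact: (fin_num_measure c).
pose mf := Measure_isFinite.Build _ _ _ m mfin.
pose m' : {finite_measure set TR -> \bar R} := HB.pack m mf.
have m'E A : m' A = (\int[mu]_(x in A) (h x)%:E)%E by [].
exists m'; split => // A f mA mf0 f0.
have m'mu : m' `<< mu.
  apply/null_content_dominatesP => B mB B0.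
  rewrite m'E; apply: null_set_integral => //.
  by apply/measurable_funTS; exact: (measurable_int mu).
rewrite -(Radon_Nikodym_SigmaFinite.change_of_variables m'mu)//.
have irn := Radon_Nikodym_SigmaFinite.f_integrable m'mu.
have mrn : measurable_fun A (Radon_Nikodym_SigmaFinite.f m' mu).
  by apply: measurable_funTS; exact: (measurable_int mu).
have mh : measurable_fun A (EFin \o h).
  by apply: measurable_funTS; exact: (measurable_int mu).
apply: ae_eq_integral => //.
- exact: emeasurable_funM.
- exact: emeasurable_funM.
- apply: ae_eqe_mul2l; apply: integral_ae_eq => //.
  + exact: (integrableS measurableT).
  + by move=> E EA mE; rewrite -Radon_Nikodym_SigmaFinite.f_integral.
Qed.

Lemma lebesgue_stieltjes_measure_oc (f : cumulative R R) (x y : R) : x < y ->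
  lebesgue_stieltjes_measure f `]x, y]%classic = (f y - f x)%:E.
Proof.
move=> xy; rewrite /lebesgue_stieltjes_measure /measure_extension.
rewrite measurable_mu_extE/=; last exact: is_ocitv.
by rewrite wlength_itv_bnd// ltW.
Qed.

(** Pointwise limits of cumulative functions are monotone but may fail to be right-continuous, hence
    the regularization [Pr] by infima from the right. The sandwich [P x <= Pr x <= P y] lets
    estimates on [P] pass to the measure. The exceptional points are jumps, countable because the
    gaps []P x, Pr x[] are disjoint open intervals. *)
Lemma stieltjes_measure (P : R -> R) (lo hi : R) :
  {homo P : x y / x <= y} -> (forall x, lo <= P x <= hi) ->
  exists m : {finite_measure set TR -> \bar R}, exists Pr : R -> R,
    [/\ forall x y, x < y -> m `]x, y]%classic = (Pr y - Pr x)%:E,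
        forall x y, x < y -> P x <= Pr x <= P y,
        countable [set x | Pr x != P x] &
        (m setT <= (hi - lo)%:E)%E].
Proof.
move=> ndP bP.
pose Pr x := inf [set P y | y in [set y | x < y]].
have hinf x : has_inf [set P y | y in [set y | x < y]].
  split; first by exists (P (x + 1)) => /=; exists (x + 1) => //=; rewrite ltrDl.
  by exists lo => _ [y _ <-]; have /andP[] := bP y.
have Pr_le x y : x < y -> Pr x <= P y.
  by move=> xy; apply: ge_inf; [case: (hinf x)|exists y].
have le_Pr x : P x <= Pr x.
  apply: lb_le_inf; first by case: (hinf x).
  by move=> _ [y /= xy <-]; apply: ndP; exact: ltW.
have ndPr : {homo Pr : x y / x <= y}.
  move=> x y; rewrite le_eqVlt => /predU1P[->//|xy].
  exact: le_trans (Pr_le _ _ xy) (le_Pr y).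
have rcPr : right_continuous Pr.
  move=> x; apply/cvgrPdist_le => e e0.
  have [_ [y /= xy <-]] := inf_adherent e0 (hinf x).
  rewrite -/(Pr x) => Pye; near=> z.
  have xz : x < z by near: z; exact: nbhs_right_gt.
  have zy : z < y by near: z; exact: nbhs_right_lt.
  rewrite ler0_norm; last by rewrite subr_le0 ndPr// ltW.
  have := Pr_le _ _ zy; lra.
have bPr x : lo <= Pr x <= hi.
  have := bP x; have := bP (x + 1); have := le_Pr x.
  have : Pr x <= P (x + 1) by apply: Pr_le; lra.
  lra.
pose cu : cumulative R R := HB.pack Pr (isCumulative.Build R _ R Pr ndPr rcPr).
pose m0 := lebesgue_stieltjes_measure cu.
pose m : {measure set TR -> \bar R} := lebesgue_stieltjes_measure cu.
have moc x y : x < y -> m `]x, y]%classic = (Pr y - Pr x)%:E.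
  exact: (lebesgue_stieltjes_measure_oc cu).
have mT : (m setT <= (hi - lo)%:E)%E.
  rewrite -(bigcup_itvT false false).
  have : (m \o (fun n : nat => `]- (n%:R), n%:R]%classic)) n @[n --> \oo] -->
      m (\bigcup_n `]- (n%:R), n%:R]%classic).
    apply: nondecreasing_cvg_mu; first by [].
      exact: bigcup_measurable.
    by move=> *; apply/subsetPset/subset_itv; rewrite leBSide/= ?lerN2 ler_nat.
  apply: cvge_le; apply: nearW => n /=.
  have [->|n0] := posnP n; first by rewrite oppr0 set_itvoc0 measure0 lee_fin; have := bP 0; lra.
  rewrite moc; last by rewrite gtrN// ltr0n.
  by rewrite lee_fin; have := bPr (n%:R); have := bPr (- n%:R); lra.
have mfin : fin_num_fun m0.
  move=> A mA; rewrite -[m0]/(Measure.sort m) ge0_fin_numE//.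
  by apply: le_lt_trans (le_measure _ _ _ (@subsetT _ A)) _; rewrite ?inE//;
     apply: le_lt_trans mT _; rewrite ltry.
pose m' : {finite_measure set TR -> \bar R} :=
  HB.pack m0 (Measure_isFinite.Build _ _ _ m0 mfin).
exists m', Pr; split => //.
  by move=> x y xy; rewrite le_Pr Pr_le.
(* The value [setT] only supplies a nonempty open set where [P] has no jump; disjointness is
   required at the jumps alone. *)
pose B x := if P x < Pr x then `]P x, Pr x[%classic else setT.
apply: (@separated_open_countable _ _ B).
- move=> x; rewrite /B; case: ifP => _; first exact: itv_open.
  exact: openT.
- move=> x; rewrite /B; case: ifP => Px; last by exists 0.
  by exists ((P x + Pr x) / 2); rewrite /= in_itv/= midf_lt// (midf_lt _).2.
- have key x : Pr x != P x -> P x < Pr x by rewrite lt_neqAle le_Pr eq_sym => ->.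
  move=> x y /= /key Px /key Py; rewrite /B Px Py => -[z [/=]].
  rewrite !in_itv/= => zx zy.
  have [xy|yx|//] := ltgtP x y.
    by have := Pr_le _ _ xy; lra.
  by have := Pr_le _ _ yx; lra.
Unshelve. all: end_near. Qed.

End measures_on_the_line.

(** * Signed measures determined by their increments *)

Section charges_on_the_line.
Context {R : realType}.
Local Notation TR := (measurableTypeR R).
Local Notation mu := (@lebesgue_measure R).

Lemma finite_measure_lty (k : {finite_measure set TR -> \bar R}) (A : set TR) :
  measurable A -> (k A < +oo)%E.
Proof. by move=> mA; rewrite ltey_eq fin_num_measure. Qed.

Lemma cadd_sub (m1 m2 : {finite_measure set TR -> \bar R}) :
  exists nu : {charge set TR -> \bar R},
    forall A, measurable A -> nu A = (m1 A - m2 A)%E.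
Proof.
exists (cadd (charge_of_finite_measure m1) (copp (charge_of_finite_measure m2))).
by [].
Qed.

(** Right-continuity of the cumulative function of [k]: intervals shrinking to [x] from the right
    decrease to the empty set. *)
Lemma finite_measure_oc_small (k : {finite_measure set TR -> \bar R}) (x e : R) :
  0 < e -> exists2 y, x < y & (k `]x, y]%classic < e%:E)%E.
Proof.
move=> e0.
pose F (n : nat) : set TR := `]x, x + n.+1%:R^-1]%classic.
have mF i : measurable (F i) by exact: measurable_itv.
have : (k \o F) n @[n --> \oo] --> k (\bigcap_n F n).
  apply: nonincreasing_cvg_mu => //.
  - exact: finite_measure_lty.
  - exact: bigcapT_measurable.
  - move=> i j ij; apply/subsetPset => z; rewrite /F/= !in_itv/= => /andP[-> zj].
    by rewrite (le_trans zj)// lerD2l lef_pV2 ?posrE// ler_nat.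
have -> : \bigcap_n F n = set0.
  apply/seteqP; split => // z zF.
  have xz : x < z by have := zF 0%N I; rewrite /F/= in_itv/= => /andP[].
  have [n nz] : exists n : nat, n.+1%:R^-1 < z - x.
    have zx0 : 0 < z - x by lra.
    exists (Num.truncn (z - x)^-1).
    by rewrite invf_plt ?posrE// truncnS_gt.
  by have := zF n I; rewrite /F/= in_itv/= -lerBlDl xz/= leNgt nz.
rewrite measure0 => /fine_cvgP[_ /cvgrPdist_lt/(_ _ e0)].
case=> n _ /(_ n (leqnn _))/= h.
exists (x + n.+1%:R^-1); first by rewrite ltrDl.
rewrite -[X in (X < _)%E](@fineK _ (k (F n)))//; last exact: fin_num_measure.
rewrite lte_fin; move: h; rewrite sub0r normrN; exact: le_lt_trans (ler_norm _).
Qed.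

Lemma finite_measure_oc (k : {finite_measure set TR -> \bar R}) (x y : R) :
  x <= y -> fine (k `]x, y]%classic) =
    fine (k `]-oo, y]%classic) - fine (k `]-oo, x]%classic).
Proof.
move=> xy; apply/eqP; rewrite eq_sym subr_eq; apply/eqP.
rewrite -fineD ?fin_num_measure// -measureU//.
  by rewrite setUC -itv_bndbnd_setU.
apply/seteqP; split => // z [/=]; rewrite !in_itv/=; lra.
Qed.

(** Domination by [k] makes [v] plus the cumulative function of [k] nondecreasing. It is also
    right-continuous, since [k] gives little mass to short intervals on the right of a point, so the
    regularization [Vr] changes nothing. *)
Lemma stieltjes_sum (v : R -> R) (k : {finite_measure set TR -> \bar R}) :
  (forall x y, x < y -> `|v y - v x| <= fine (k `]x, y]%classic)) ->
  exists m : {finite_measure set TR -> \bar R},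
    forall x y, x < y -> m `]x, y]%classic = ((v y - v x)%:E + k `]x, y]%classic)%E.
Proof.
move=> vk.
pose K x := fine (k `]-oo, x]%classic).
have KE x y : x <= y -> fine (k `]x, y]%classic) = K y - K x.
  exact: finite_measure_oc.
have finS A : measurable A -> fine (k A) <= fine (k setT).
  move=> mA; rewrite fine_le ?fin_num_measure//.
  by apply: le_measure; rewrite ?inE.
have K01 x : 0 <= K x <= fine (k setT) by rewrite fine_ge0//= finS.
have vb x : `|v x - v 0| <= fine (k setT).
  have [x0|x0|->] := ltgtP x 0; last by rewrite subrr normr0 fine_ge0.
    by rewrite distrC (le_trans (vk _ _ x0))// finS.
  by rewrite (le_trans (vk _ _ x0))// finS.
pose V x := v x + K x.
have ndV : {homo V : x y / x <= y}.
  move=> x y; rewrite le_eqVlt => /predU1P[->//|xy].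
  have := vk _ _ xy; rewrite (KE _ _ (ltW xy)) /V ler_norml; lra.
(* [v] stays within [k setT] of [v 0], and [K] lies between 0 and [k setT]; adding the two gives the
   bounds. *)
have [|m [Vr [mE VrE _ _]]] :=
    @stieltjes_measure _ V (v 0 - fine (k setT)) (v 0 + fine (k setT) *+ 2) ndV.
  move=> x; have := vb x; have := K01 x; rewrite ler_norml /V mulr2n; lra.
exists m => x y xy; rewrite mE//.
suff Vrr z : Vr z = V z.
  rewrite -[k `]x, y]%classic]fineK ?fin_num_measure// KE; last exact: ltW.
  by rewrite !Vrr -EFinD; congr EFin; rewrite /V; lra.
have /andP[Vz _] := VrE z (z + 1) ltac:(by rewrite ltrDl).
apply/eqP; rewrite eq_le Vz andbT; apply/ler_addgt0Pr => e e0.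
have e20 : 0 < e / 2 by lra.
have [w zw kw] := finite_measure_oc_small k z e20.
have /andP[_ Vw] := VrE _ _ zw.
have := vk _ _ zw.
have : fine (k `]z, w]%classic) < e / 2.
  by rewrite -lte_fin fineK// fin_num_measure.
by rewrite (KE _ _ (ltW zw)) ler_norml /V in Vw *; lra.
Qed.

Lemma stieltjes_charge (v : R -> R) (k : {finite_measure set TR -> \bar R}) :
  (forall x y, x < y -> `|v y - v x| <= fine (k `]x, y]%classic)) ->
  exists nu : {charge set TR -> \bar R},
    forall x y, x < y -> nu `]x, y]%classic = (v y - v x)%:E.
Proof.
move=> /stieltjes_sum[m mE]; have [nu nuE] := cadd_sub m k.
by exists nu => x y xy; rewrite nuE// mE// addeK// fin_num_measure.
Qed.

(** Identities between signed measures are rearranged into equalities of sums, to which uniqueness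
    of finite measures applies. *)
Lemma eq_add_measure_oc (m1 m2 m3 m4 : {finite_measure set TR -> \bar R}) :
  (forall x y, x < y -> (m1 `]x, y]%classic + m2 `]x, y]%classic =
    m3 `]x, y]%classic + m4 `]x, y]%classic)%E) ->
  forall A : set R, measurable A -> (m1 A + m2 A = m3 A + m4 A)%E.
Proof.
move=> mE A mA.
have aE (m n : {finite_measure set TR -> \bar R}) B :
  (measure_add m n : {measure set TR -> \bar R}) B = (m B + n B)%E.
  exact: measure_addE.
rewrite -!aE; apply: eq_measure_oc => // [x y xy|x y]; first by rewrite !aE mE.
by rewrite aE ltey_eq fin_numD !fin_num_measure.
Qed.

Lemma charge_split (nu : {charge set TR -> \bar R}) (A : set TR) : measurable A ->
  nu A = (charge_pos nu A - charge_neg nu A)%E.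
Proof.
by move=> mA; rewrite (jordan_decomp (hahn_proof nu))// /cadd/= cscaleN1.
Qed.

(** There is a positive measure [m] with the increments of [nu + k]. Moving the negative part of
    [nu] to the side of [m], the identity [m = nu + k] extends from intervals to Borel sets, where
    it says [nu + k >= 0]. *)
Lemma charge_ge_oc (nu : {charge set TR -> \bar R})
    (k : {finite_measure set TR -> \bar R}) :
  (forall x y, x < y -> (`|nu `]x, y]%classic| <= k `]x, y]%classic)%E) ->
  forall A, measurable A -> (- k A <= nu A)%E.
Proof.
move=> nuk A mA.
pose p := charge_pos nu; pose n := charge_neg nu.
pose v x := fine (p `]-oo, x]%classic) - fine (n `]-oo, x]%classic).
have vE x y : x < y -> v y - v x = fine (nu `]x, y]%classic).
  move=> xy; rewrite charge_split// fineB ?fin_num_measure//.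
  rewrite !(finite_measure_oc _ (ltW xy)) /v; lra.
have [|m mE] := @stieltjes_sum v k.
  move=> x y xy; rewrite vE// -fine_abse ?fin_num_measure//.
  by rewrite fine_le ?fin_num_measure// ?abse_fin_num ?fin_num_measure// nuk.
have : (m A + n A = p A + k A)%E.
  apply: eq_add_measure_oc => // x y xy.
  rewrite mE// vE// fineK ?fin_num_measure// charge_split// -/p -/n.
  have : p `]x, y]%classic \is a fin_num by exact: fin_num_measure.
  have : n `]x, y]%classic \is a fin_num by exact: fin_num_measure.
  have : k `]x, y]%classic \is a fin_num by exact: fin_num_measure.
  move=> /fineK <- /fineK <- /fineK <-; rewrite -!EFinD; congr EFin; lra.
rewrite charge_split// -/p -/n.
have : p A \is a fin_num by exact: fin_num_measure.
have : n A \is a fin_num by exact: fin_num_measure.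
have : k A \is a fin_num by exact: fin_num_measure.
have m0 : 0 <= fine (m A) by rewrite fine_ge0.
have : m A \is a fin_num by exact: fin_num_measure.
move=> /fineK <- /fineK <- /fineK <- /fineK <-.
rewrite -!EFinN -!EFinD lee_fin => h; have := EFin_inj h; lra.
Qed.

Lemma charge_le_oc (nu : {charge set TR -> \bar R})
    (k : {finite_measure set TR -> \bar R}) :
  (forall x y, x < y -> (`|nu `]x, y]%classic| <= k `]x, y]%classic)%E) ->
  forall A, measurable A -> (`|nu A| <= k A)%E.
Proof.
move=> nuk A mA; have [nu0|nu0] := leP 0%E (nu A); last first.
  by rewrite lte0_abs// leeNl; exact: charge_ge_oc.
rewrite gee0_abs// -[leLHS]oppeK leeNl; apply: (@charge_ge_oc (copp nu)) => // x y xy.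
by rewrite /copp/= abseN nuk.
Qed.

(** The charge with the increments of [v] is bounded by every measure that dominates these
    increments, so it vanishes on null sets and Radon-Nikodym applies. The dominating measure may
    depend on [N] and [e]: in the limit of Young's inequality each single one can have a singular
    part. *)
Lemma absolutely_continuous_density (v : R -> R)
    (k : {finite_measure set TR -> \bar R}) :
  (forall x y, x < y -> `|v y - v x| <= fine (k `]x, y]%classic)) ->
  (forall N e, measurable N -> mu N = 0%E -> 0 < e ->
    exists k' : {finite_measure set TR -> \bar R},
      (forall x y, x < y -> `|v y - v x| <= fine (k' `]x, y]%classic)) /\
      (k' N <= e%:E)%E) ->
  exists2 g : R -> R, mu.-integrable setT (EFin \o g) &
    forall x y, x < y -> (\int[mu]_(t in `]x, y]) (g t)%:E)%E = (v y - v x)%:E.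
Proof.
move=> vk vN.
have [nu nuE] := stieltjes_charge vk.
have numu : nu `<< mu.
  apply/null_content_dominatesP => N mN N0.
  apply/eqP; rewrite -abse_eq0 eq_le abse_ge0 andbT.
  apply/lee_addgt0Pr => e e0; rewrite add0e.
  have [k' [vk' k'N]] := vN _ _ mN N0 e0.
  apply: le_trans k'N; apply: charge_le_oc => // x y xy.
  by have := vk' _ _ xy; rewrite -lee_fin fineK ?fin_num_measure// nuE.
pose G := Radon_Nikodym nu mu.
have Gf x : G x = (fine (G x))%:E by rewrite fineK//; exact: Radon_Nikodym_fin_num.
exists (fine \o G).
  rewrite (_ : _ \o _ = G); last by apply/funext => x /=; rewrite -Gf.
  exact: Radon_Nikodym_integrable.
move=> x y xy; under eq_integral do rewrite /= -Gf.
by rewrite -Radon_Nikodym_integral// nuE.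
Qed.

End charges_on_the_line.

(** * Absolutely continuous functions as primitives on the whole line *)

Section primitives.
Context {R : realType}.
Local Notation TR := (measurableTypeR R).
Local Notation mu := (@lebesgue_measure R).
Implicit Types (v g h f : R -> R).

(** Stands for absolute continuity with derivative [g]. It is stated on the whole line; a function
    given on []a, b[] is extended by letting [g] vanish outside. *)
Definition is_primitive v g : Prop :=
  mu.-integrable setT (EFin \o g) /\
  forall x y, x < y -> \int[mu]_(t in `]x, y]) g t = v y - v x.

Lemma integrableT (m : {measure set TR -> \bar R}) g (A : set R) : measurable A ->
  m.-integrable setT (EFin \o g) -> m.-integrable A (EFin \o g).
Proof. by move=> mA; apply: integrableS. Qed.

Lemma integrableT_measurable (m : {measure set TR -> \bar R}) g (A : set R) :
  m.-integrable setT (EFin \o g) -> measurable_fun A g.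
Proof.
move=> ig; apply: (@measurable_funTS).
by apply/measurable_EFinP; exact: measurable_int ig.
Qed.

Lemma integrable_normT (m : {measure set TR -> \bar R}) g :
  m.-integrable setT (EFin \o g) -> m.-integrable setT (EFin \o (fun x => `|g x|)).
Proof. by move=> ig; apply: integrable_norm. Qed.

Lemma ae_imply (P Q : R -> Prop) : (forall x, P x -> Q x) ->
  {ae mu, forall x, P x} -> {ae mu, forall x, Q x}.
Proof. by move=> PQ; apply: (@filterS _ _ (ae_filter_ringOfSetsType mu)). Qed.

Lemma ae_imply2 (P Q S : R -> Prop) : (forall x, P x -> Q x -> S x) ->
  {ae mu, forall x, P x} -> {ae mu, forall x, Q x} -> {ae mu, forall x, S x}.
Proof. by move=> PQ; apply: (@filterS2 _ _ (ae_filter_ringOfSetsType mu)). Qed.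

Lemma measurable_le_set f g : measurable_fun setT f -> measurable_fun setT g ->
  measurable [set x | f x <= g x].
Proof.
by move=> mf mg; rewrite -[X in measurable X]setTI; exact: measurable_fun_le.
Qed.

Lemma measurable_lt_set f g : measurable_fun setT f -> measurable_fun setT g ->
  measurable [set x | f x < g x].
Proof.
move=> mf mg; rewrite (_ : mkset _ = ~` [set x | g x <= f x]).
  by apply: measurableC; exact: measurable_le_set.
by apply/seteqP; split => x /=; rewrite ltNge => /negP.
Qed.

Lemma lebesgue_measure_oc (x y : R) : x <= y ->
  (mu : {measure set TR -> \bar R}) `]x, y]%classic = (y - x)%:E.
Proof.
rewrite le_eqVlt => /predU1P[->|xy]; first by rewrite set_itvoc0 measure0 subrr.
by rewrite /= lebesgue_measure_itv/= lte_fin xy EFinD.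
Qed.

Lemma integrableDT (m : {measure set TR -> \bar R}) f g :
  m.-integrable setT (EFin \o f) -> m.-integrable setT (EFin \o g) ->
  m.-integrable setT (EFin \o (fun x => f x + g x)).
Proof. exact: integrableD. Qed.

Lemma integrableBT (m : {measure set TR -> \bar R}) f g :
  m.-integrable setT (EFin \o f) -> m.-integrable setT (EFin \o g) ->
  m.-integrable setT (EFin \o (fun x => f x - g x)).
Proof. exact: integrableB. Qed.

Lemma integrableNT (m : {measure set TR -> \bar R}) f :
  m.-integrable setT (EFin \o f) -> m.-integrable setT (EFin \o (fun x => - f x)).
Proof. exact: integrableN. Qed.

Lemma integrableZT (m : {measure set TR -> \bar R}) (c : R) f :
  m.-integrable setT (EFin \o f) ->
  m.-integrable setT (EFin \o (fun x => c * f x)).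
Proof. by move=> h; exact: (integrableZl measurableT c h). Qed.

Lemma integrableMT (m : {measure set TR -> \bar R}) (c : R) f g :
  measurable_fun setT f -> (forall x, `|f x| <= c) ->
  m.-integrable setT (EFin \o g) ->
  m.-integrable setT (EFin \o (fun x => f x * g x)).
Proof.
move=> mf fc ig; apply: (@integrableMr _ _ _ m _ _ f (EFin \o g)) => //.
exists `|c|; split => // r cr x _ /=; rewrite (le_trans (fc _))// (le_trans (ler_norm _))// ltW//.
Qed.

Lemma integrable_leT (m : {measure set TR -> \bar R}) f g :
  measurable_fun setT f -> (forall x, `|f x| <= g x) ->
  m.-integrable setT (EFin \o g) -> m.-integrable setT (EFin \o f).
Proof.
move=> mf fg ig; apply: le_integrable ig => //; first exact/measurable_EFinP.
by move=> x _ /=; rewrite lee_fin (le_trans (fg x))// ler_norm.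
Qed.

Lemma EFin_Rintegral (m : {measure set TR -> \bar R}) (A : set R) g : measurable A ->
  m.-integrable setT (EFin \o g) ->
  (\int[m]_(x in A) g x)%:E = (\int[m]_(x in A) (g x)%:E)%E.
Proof.
move=> mA ig; rewrite /Rintegral fineK//.
exact/integrable_fin_num/integrableT.
Qed.

Lemma cvg_Rintegral (m : {measure set TR -> \bar R}) (A : set R)
    (f_ : nat -> R -> R) f g : measurable A ->
  (forall n, measurable_fun A (f_ n)) -> measurable_fun A f ->
  (forall x, A x -> f_ n x @[n --> \oo] --> f x) ->
  m.-integrable A (EFin \o g) -> (forall n x, A x -> `|f_ n x| <= g x) ->
  m.-integrable A (EFin \o f) /\
  \int[m]_(x in A) f_ n x @[n --> \oo] --> \int[m]_(x in A) f x.
Proof.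
move=> mA mf_ mf ff ig fg.
have [|||||fi _ cvgI] := @dominated_convergence _ _ _ m A mA
   (fun n => EFin \o f_ n) (EFin \o f) (EFin \o g).
- by move=> n; apply/measurable_EFinP; exact: mf_.
- by apply/measurable_EFinP; exact: mf.
- apply: aeW => x Ax; apply: cvg_EFin; first by apply: nearW.
  exact: ff.
- exact: ig.
- by apply: aeW => x n Ax; rewrite /= lee_fin fg.
split => //; apply: fine_cvg; rewrite fineK//.
exact: integrable_fin_num.
Qed.

Lemma density_measureR h : mu.-integrable setT (EFin \o h) -> (forall x, 0 <= h x) ->
  exists k : {finite_measure set TR -> \bar R},
    forall A : set R, measurable A -> k A = (\int[mu]_(x in A) h x)%:E.
Proof.
move=> ih h0; have [k [kE _]] := density_measure ih h0.
by exists k => A mA; rewrite kE// EFin_Rintegral.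
Qed.

Lemma ae_le_Rintegral g h :
  mu.-integrable setT (EFin \o g) -> mu.-integrable setT (EFin \o h) ->
  (forall A : set R, measurable A ->
     \int[mu]_(x in A) g x <= \int[mu]_(x in A) h x) ->
  {ae mu, forall x, g x <= h x}.
Proof.
move=> ig ih gh.
have mg : measurable_fun setT g := integrableT_measurable ig.
have mh : measurable_fun setT h := integrableT_measurable ih.
pose q x := Num.max (g x - h x) 0.
(* On [E] the difference [g - h] is positive while its integral is at most 0, so [E] is null. *)
pose E := [set x | h x < g x].
have mE : measurable E.
  exact: measurable_lt_set.
have : (\int[mu]_(x in E) `|(g x - h x)%:E|)%E = 0%E.
  apply/eqP; rewrite eq_le integral_ge0 ?andbT//.
  have -> : (\int[mu]_(x in E) `|(g x - h x)%:E| =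
      \int[mu]_(x in E) ((g \- h)%R x)%:E)%E.
    by apply: eq_integral => x /[!inE] /= hg; rewrite gtr0_norm ?subr_gt0.
  have igh : mu.-integrable setT (EFin \o (g \- h)).
    rewrite (_ : _ \o _ = (EFin \o g) \- (EFin \o h))%E//.
    exact: integrableB.
  rewrite -(EFin_Rintegral mE igh) lee_fin.
  rewrite RintegralB//; [|exact: integrableT..].
  by rewrite subr_le0 gh.
move/(ae_eq_integral_abs mu mE (f := fun x => (g x - h x)%:E)).
have mgh : measurable_fun E (fun x => (g x - h x)%:E).
  by apply/measurable_EFinP; apply: measurable_funTS; exact: measurable_funB.
move=> /(_ mgh); apply: filterS => x /= xE; rewrite leNgt; apply/negP => hg.
by have [] := xE hg; move/eqP; rewrite subr_eq0 => /eqP gE; rewrite gE ltxx in hg.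
Qed.

Lemma is_primitive_continuous v g : is_primitive v g -> continuous v.
Proof.
move=> [ig gv] x; apply/cvgrPdist_lt => e e0.
have [d [d0 dP]] := integral_normr_continuous ig e0.
near=> y.
have key s t : s < t -> t - s < d -> `|v t - v s| < e.
  move=> st tsd; rewrite -gv//; apply: le_lt_trans (dP `]s, t]%classic _ _) => //.
    by apply: le_normr_Rintegral => //; exact: integrableT.
  by rewrite [X in (X < _)%E](lebesgue_measure_oc (ltW st)) lte_fin.
have : `|x - y| < d by near: y; apply: cvgr_dist_lt => //; exact: cvg_id.
have [xy|yx|->] := ltgtP x y; last by rewrite !subrr !normr0.
  by move=> h; rewrite distrC; apply: key => //; move: h; rewrite ltr_norml; lra.
by move=> h; apply: key => //; move: h; rewrite ltr_norml; lra.
Unshelve. all: end_near. Qed.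

Lemma is_primitive_measurable v g : is_primitive v g -> measurable_fun setT v.
Proof. by move=> /is_primitive_continuous; exact: continuous_measurable_fun. Qed.

Lemma integrable_primitive g : mu.-integrable setT (EFin \o g) ->
  is_primitive (fun x => \int[mu]_(t in `]-oo, x]) g t) g.
Proof.
move=> ig; split => // x y xy; rewrite Rintegral_itvB ?bnd_simp//.
- exact: integrableT.
- exact: ltW.
Qed.

Lemma is_primitive_dominated v g (k : {finite_measure set TR -> \bar R}) :
  is_primitive v g ->
  (forall x y, x < y -> `|v y - v x| <= fine (k `]x, y]%classic)) ->
  forall A : set R, measurable A -> `|\int[mu]_(x in A) g x| <= fine (k A).
Proof.
move=> [ig gv] vk A mA; rewrite -lee_fin fineK ?fin_num_measure//.
rewrite EFin_normr_Rintegral//; last exact: integrableT.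
apply: (@charge_le_oc _ (induced_charge ig)) => // x y xy.
rewrite [X in `|X|%E](_ : _ = (v y - v x)%:E).
  by have := vk _ _ xy; rewrite -lee_fin fineK ?fin_num_measure.
by rewrite -gv// EFin_Rintegral.
Qed.

Lemma is_primitive_ae_le v g h : is_primitive v g ->
  mu.-integrable setT (EFin \o h) -> (forall x, 0 <= h x) ->
  (forall x y, x < y -> `|v y - v x| <= \int[mu]_(t in `]x, y]) h t) ->
  {ae mu, forall x, `|g x| <= h x}.
Proof.
move=> vg ih h0 vh; have [k kE] := density_measureR ih h0.
have gk A : measurable A -> `|\int[mu]_(x in A) g x| <= \int[mu]_(x in A) h x.
  move=> mA; have := is_primitive_dominated (k := k) vg _ mA.
  by rewrite kE//=; apply => x y xy; rewrite kE//= vh.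
have [ig _] := vg.
have h1 : {ae mu, forall x, g x <= h x}.
  apply: ae_le_Rintegral => // A mA.
  by apply: le_trans (ler_norm _) _; exact: gk.
have ign : mu.-integrable setT (EFin \o (fun x => - g x)).
  rewrite (_ : _ \o _ = (-%E \o (EFin \o g)))%E//.
  exact: integrableN.
have h2 : {ae mu, forall x, - g x <= h x}.
  apply: ae_le_Rintegral => // A mA.
  apply: le_trans (gk _ mA); rewrite -normrN.
  apply: le_trans (ler_norm _); rewrite -mulN1r -RintegralZl//.
    by rewrite (_ : (fun x => -1 * g x) = (fun x => - g x))//; apply/funext => x; rewrite mulN1r.
  exact: integrableT.
by apply: ae_imply2 h1 h2 => x gx ngx; rewrite ler_norml gx andbT lerNl.
Qed.

Lemma is_primitive_exists v h :
  mu.-integrable setT (EFin \o h) -> (forall x, 0 <= h x) ->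
  (forall x y, x < y -> `|v y - v x| <= \int[mu]_(t in `]x, y]) h t) ->
  exists2 g, is_primitive v g & {ae mu, forall x, `|g x| <= h x}.
Proof.
move=> ih h0 vh; have [k kE] := density_measureR ih h0.
have vk x y : x < y -> `|v y - v x| <= fine (k `]x, y]%classic).
  by move=> xy; rewrite kE//= vh.
have [|g ig gv] := absolutely_continuous_density vk.
  move=> N e mN N0 e0; exists k; split => //.
  rewrite kE// EFin_Rintegral// null_set_integral ?lee_fin ?(ltW e0)//.
  by apply/measurable_EFinP; exact: integrableT_measurable ih.
have vg : is_primitive v g.
  by split => // x y xy; apply: EFin_inj; rewrite EFin_Rintegral// gv.
by exists g => //; exact: is_primitive_ae_le vg ih h0 vh.
Qed.

End primitives.

Section lipschitz_chain_rule.
Context {R : realType}.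
Local Notation TR := (measurableTypeR R).
Local Notation mu := (@lebesgue_measure R).
Implicit Types (v g h f : R -> R).

(** Cutting an interval where [K] takes its mean value halves a quadratic bound, since each of the
    two pieces contributes a quarter. After [n] bisections the increment of [D] is at most [2 ^ -n]
    times the first bound. This avoids differentiating almost everywhere in the chain rule. *)
Lemma quadratic_increment_const (K D : R -> R) (C : R) :
  continuous K -> {homo K : x y / x <= y} ->
  (forall x y, x <= y -> `|D y - D x| <= C * (K y - K x) ^+ 2) ->
  forall x y, x <= y -> D y = D x.
Proof.
move=> cK ndK DK.
have step n : forall x y, x <= y -> `|D y - D x| <= C * (K y - K x) ^+ 2 / 2 ^+ n.
  elim: n => [x y xy|n IH x y xy]; first by rewrite expr0 divr1 DK.
  have [||z /[!in_itv]/= /andP[xz zy] Kz] := @IVT R K x y ((K x + K y) / 2) xy.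
  - exact: continuous_subspaceT.
  - have Kxy := ndK _ _ xy.
    rewrite min_l// max_r//; lra.
  have Dxz := IH _ _ xz; have Dzy := IH _ _ zy.
  rewrite (_ : D y - D x = (D y - D z) + (D z - D x)); last by ring.
  rewrite (le_trans (ler_normD _ _))//.
  apply: le_trans (lerD Dzy Dxz) _.
  rewrite Kz [2 ^+ n.+1]exprS le_eqVlt; apply/orP; left; apply/eqP.
  by field; rewrite expf_eq0/= pnatr_eq0 andbF.
move=> x y xy; apply/eqP; rewrite -subr_eq0 -normr_le0.
apply/ler_addgt0Pr => e e0; rewrite add0r.
set B := C * (K y - K x) ^+ 2.
have [n nB] : exists n : nat, B / e < n%:R.
  by exists (Num.truncn (B / e)).+1; exact: truncnS_gt.
apply: le_trans (step n _ _ xy) _; rewrite -/B.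
rewrite ler_pdivrMr ?exprn_gt0// -ler_pdivrMl//.
rewrite mulrC (le_trans (ltW nB))// -natrX ler_nat.
exact: ltnW (ltn_expl _ _).
Qed.

(** With [J] a primitive of the expected derivative and [K] a primitive of [|g|], the increments of
    [G (v z) - J z] are at most [2 C] times the squares of those of [K], so this difference is
    constant. *)
Lemma is_primitive_lipschitz_deriv (G g1 : R -> R) (C L : R) v g : is_primitive v g ->
  measurable_fun setT g1 -> (forall s, `|g1 s| <= L) ->
  (forall s t, `|G t - G s - g1 s * (t - s)| <= C * (t - s) ^+ 2) ->
  (forall s t, `|g1 t - g1 s| <= C * `|t - s|) -> 0 <= C ->
  is_primitive (G \o v) (fun x => g1 (v x) * g x).
Proof.
move=> vg mg1 g1L GC g1C C0; have [ig gv] := vg.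
have mv : measurable_fun setT v := is_primitive_measurable vg.
have cig : mu.-integrable setT (EFin \o (fun x => g1 (v x) * g x)).
  by apply: integrableMT ig => //; exact: measurableT_comp.
split => // x y xy.
have inorm : mu.-integrable setT (EFin \o (fun x => `|g x|)) by exact: integrable_normT.
pose K z := \int[mu]_(t in `]-oo, z]) `|g t|.
have [_ KE] := integrable_primitive inorm.
have cK : continuous K := is_primitive_continuous (integrable_primitive inorm).
pose J z := \int[mu]_(t in `]-oo, z]) (g1 (v t) * g t).
have [_ JE] := integrable_primitive cig.
have KE' s t : s <= t -> K t - K s = \int[mu]_(w in `]s, t]) `|g w|.
  rewrite le_eqVlt => /predU1P[->|st]; last by rewrite KE.
  by rewrite set_itvoc0 Rintegral_set0 subrr.
have JE' s t : s <= t -> J t - J s = \int[mu]_(w in `]s, t]) (g1 (v w) * g w).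
  rewrite le_eqVlt => /predU1P[->|st]; last by rewrite JE.
  by rewrite set_itvoc0 Rintegral_set0 subrr.
have ndK : {homo K : s t / s <= t}.
  by move=> s t st; rewrite -subr_ge0 KE'// Rintegral_ge0.
have vK s t : s <= t -> `|v t - v s| <= K t - K s.
  rewrite le_eqVlt => /predU1P[->|st]; first by rewrite !subrr normr0.
  rewrite KE' ?(ltW st)// -gv//; apply: le_normr_Rintegral => //; exact: integrableT.
pose W z := G (v z) - J z.
have WK s t : s <= t -> `|W t - W s| <= (2 * C) * (K t - K s) ^+ 2.
  move=> st.
  have igs : mu.-integrable setT (EFin \o (fun w => g1 (v s) * g w)).
    exact: integrableZT.
  have igd : mu.-integrable setT (EFin \o (fun w => g1 (v w) * g w - g1 (v s) * g w)).
    exact: integrableBT.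
  have gvs : v t - v s = \int[mu]_(w in `]s, t]) g w.
    move: st; rewrite le_eqVlt => /predU1P[->|st]; last by rewrite gv.
    by rewrite set_itvoc0 Rintegral_set0 subrr.
  (* Second-order remainder of [G] at [v s], minus the effect of the oscillation of [g1 (v w)] over
     []s, t]]; each is bounded by [C] times the square of [K t - K s]. *)
  have -> : W t - W s = (G (v t) - G (v s) - g1 (v s) * (v t - v s)) -
      \int[mu]_(w in `]s, t]) (g1 (v w) * g w - g1 (v s) * g w).
    rewrite RintegralB//; [|exact: integrableT..].
    rewrite RintegralZl//; last exact: integrableT.
    by rewrite -gvs -JE'// /W; ring.
  rewrite (le_trans (ler_normB _ _))//.
  have -> : 2 * C * (K t - K s) ^+ 2 = C * (K t - K s) ^+ 2 + C * (K t - K s) ^+ 2 by ring.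
  have vKs := vK _ _ st.
  apply: lerD.
    apply: le_trans (GC _ _) _; rewrite ler_wpM2l//.
    by move: vKs; rewrite ler_norml => /andP[h1 h2]; nra.
  apply: le_trans (le_normr_Rintegral _ (integrableT _ igd)) _ => //.
  rewrite [X in _ <= C * X]expr2 mulrA [X in _ * X]KE'// -RintegralZl//; last exact: integrableT.
  apply: le_Rintegral => //.
  - by apply: integrableT => //; exact: integrable_normT.
  - by apply: integrableT => //; exact: integrableZT.
  - move=> w; rewrite /= in_itv/= => /andP[sw wt].
    rewrite -mulrBl normrM ler_wpM2r// (le_trans (g1C _ _))// ler_wpM2l//.
    by rewrite (le_trans (vK _ _ (ltW sw)))// lerB// ndK.
have WE := quadratic_increment_const cK ndK WK (ltW xy).
rewrite -JE' ?(ltW xy)//; move: WE; rewrite /W /=; lra.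
Qed.

End lipschitz_chain_rule.

Section huber_function.
Context {R : realType}.
Implicit Types (n e c s t : R).

(* A C^{1,1} regularisation of [s |-> max s 0], and its derivative. *)
Definition huber s := if s <= 0 then 0 else if s <= 1 then s ^+ 2 / 2 else s - 2^-1.
Definition huber' s := if s <= 0 then 0 else if s <= 1 then s else 1.

Lemma huber'_bound s : `|huber' s| <= 1.
Proof.
rewrite /huber' ler_norml.
by case: ifPn; rewrite -?ltNge => s0; [lra|case: ifPn; rewrite -?ltNge => s1; lra].
Qed.

Lemma huber'_lipschitz s t : `|huber' t - huber' s| <= `|t - s|.
Proof.
rewrite /huber'.
have : t - s <= `|t - s| by exact: ler_norm.
have : s - t <= `|t - s| by rewrite distrC ler_norm.
move: (`|t - s|) => d d1 d2.
rewrite ler_norml.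
by case: (leP s 0) => s0; case: (leP t 0) => t0; case: (leP s 1) => s1;
  case: (leP t 1) => t1; apply/andP; split; lra.
Qed.

Lemma huber_quadratic s t : `|huber t - huber s - huber' s * (t - s)| <= (t - s) ^+ 2.
Proof.
rewrite /huber /huber' ler_norml.
have h0 : 0 <= (t - s) ^+ 2 by exact: sqr_ge0.
by case: (leP s 0) => s0; case: (leP t 0) => t0; case: (leP s 1) => s1;
  case: (leP t 1) => t1; apply/andP; split; nra.
Qed.

Lemma huber_near s : `|huber s - Num.max s 0| <= 1.
Proof.
rewrite /huber ler_norml; case: (leP s 0) => s0; first by rewrite subrr; lra.
by case: (leP s 1) => s1; apply/andP; split; nra.
Qed.

End huber_function.

Section positive_part.
Context {R : realType}.
Local Notation TR := (measurableTypeR R).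
Local Notation mu := (@lebesgue_measure R).
Implicit Types (v g h f : R -> R).

Lemma measurable_huber' : measurable_fun setT (@huber' R).
Proof.
rewrite (_ : huber' = fun s : R => Num.min 1 (Num.max s 0)).
  apply: measurable_minr => //; exact: measurable_maxr.
apply/funext => s; rewrite /huber'.
rewrite /Order.min /Order.max; case: (ltP s 0) => s0; case: (leP s 0) => s1;
  case: (leP s 1) => s2; case: (ltP (1 : R) 0) => s3; case: (ltP 1 s) => s4; lra.
Qed.

(** The scaling by [n] brings the function within [1/n] of the positive part of [v - c]; the price
    is a derivative with Lipschitz constant [n]. *)
Lemma is_primitive_huber v g c n : is_primitive v g -> 0 < n ->
  is_primitive (fun x => n^-1 * huber (n * (v x - c)))
    (fun x => huber' (n * (v x - c)) * g x).
Proof.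
move=> vg n0; have n0' : n != 0 by rewrite gt_eqF.
apply: (@is_primitive_lipschitz_deriv _ (fun s => n^-1 * huber (n * (s - c)))
  (fun s => huber' (n * (s - c))) n 1 v g) => //.
- apply: (measurableT_comp measurable_huber').
  by apply: measurable_funM => //; exact: measurable_funB.
- by move=> s; exact: huber'_bound.
- move=> s t.
  rewrite (_ : _ - _ = n^-1 * (huber (n * (t - c)) - huber (n * (s - c)) -
    huber' (n * (s - c)) * (n * (t - c) - n * (s - c)))); last by field.
  rewrite normrM gtr0_norm ?invr_gt0// ler_pdivrMl//.
  apply: le_trans (huber_quadratic _ _) _.
  by rewrite (_ : n * (n * (t - s) ^+ 2) = (n * (t - c) - n * (s - c)) ^+ 2)//; ring.
- move=> s t; apply: le_trans (huber'_lipschitz _ _) _.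
  rewrite (_ : n * (t - c) - n * (s - c) = n * (t - s)); last by ring.
  by rewrite normrM gtr0_norm.
- exact: ltW.
Qed.

Lemma huber_scaled_cvg (s : R) :
  (n.+1%:R)^-1 * huber (n.+1%:R * s) @[n --> \oo] --> Num.max s 0.
Proof.
apply/cvgrPdist_le => e e0; near=> n.
have N0 : 0 < n.+1%:R :> R by rewrite ltr0n.
have -> : Num.max s 0 = n.+1%:R^-1 * Num.max (n.+1%:R * s) 0.
  by rewrite maxr_pMr ?invr_ge0 ?(ltW N0)// mulr0 mulKf ?gt_eqF.
rewrite -mulrBr normrM gtr0_norm ?invr_gt0// distrC ler_pdivrMl//.
apply: le_trans (huber_near _) _; rewrite mulrC -ler_pdivrMl// mulr1.
near: n.
exists (Num.truncn e^-1) => // n /= en.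
by apply/ltW/(lt_le_trans (truncnS_gt _)); rewrite ler_nat.
Unshelve. all: end_near. Qed.

Lemma huber'_scaled_cvg (s : R) :
  huber' (n.+1%:R * s) @[n --> \oo] --> ((0 < s)%R%:R : R).
Proof.
case: (ltP 0 s) => s0; last first.
  rewrite (_ : (fun _ => _) = fun=> 0); first exact: cvg_cst.
  apply/funext => n; rewrite /huber' ifT//.
  by rewrite mulr_ge0_le0.
apply: cvg_near_cst; near=> n.
have N0 : 0 < n.+1%:R :> R by rewrite ltr0n.
rewrite /huber' ifF; last by apply/negbTE; rewrite -ltNge mulr_gt0.
rewrite ifF//; apply/negbTE; rewrite -ltNge -ltr_pdivrMr// mul1r.
near: n.
exists (Num.truncn s^-1) => // n /= en.
by apply: (lt_le_trans (truncnS_gt _)); rewrite ler_nat.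
Unshelve. all: end_near. Qed.

(** Limit of the Huber approximations by dominated convergence: their derivatives are bounded by
    [|g|] and tend to [g] on the set [c < v x], to 0 elsewhere. The inequality is strict because
    [huber'] vanishes at 0. *)
Lemma is_primitive_pos_part v g c : is_primitive v g ->
  is_primitive (fun x => Num.max (v x - c) 0) (fun x => (c < v x)%R%:R * g x).
Proof.
move=> vg; have [ig gv] := vg.
have mv : measurable_fun setT v := is_primitive_measurable vg.
have mb : measurable_fun setT (fun x => (c < v x)%R%:R : R).
  rewrite (_ : (fun _ => _) = \1_[set x | c < v x]).
    by apply: measurable_indic; exact: measurable_lt_set.
  apply/funext => x; rewrite indicE; case: (boolP (c < v x)) => h; first by rewrite mem_set.
    by rewrite memNset//; exact/negP.
have ib : mu.-integrable setT (EFin \o (fun x => (c < v x)%R%:R * g x)).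
  apply: (@integrableMT _ _ 1 _ _ mb _ ig) => x.
  by case: (c < v x); rewrite ?normr1 ?normr0.
split => // x y xy.
pose N n : R := n.+1%:R.
have N0 n : 0 < N n by rewrite ltr0n.
pose f n t := huber' (N n * (v t - c)) * g t.
have fv n : is_primitive (fun x => (N n)^-1 * huber (N n * (v x - c))) (f n).
  exact: is_primitive_huber.
have [||||||_ cvgI] := @cvg_Rintegral _ mu `]x, y]%classic f
   (fun x => (c < v x)%R%:R * g x) (fun x => `|g x|).
- by [].
- by move=> n; have [fi _] := fv n; exact: integrableT_measurable fi.
- exact: integrableT_measurable ib.
- move=> t _; apply: cvgM; last exact: cvg_cst.
  by rewrite -subr_gt0; exact: huber'_scaled_cvg.
- by apply: integrableT => //; exact: integrable_normT.
- by move=> n t _; rewrite normrM -[leRHS]mul1r ler_wpM2r// huber'_bound.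
apply: (cvg_unique _ cvgI) => //.
have eI n : \int[mu]_(t in `]x, y]) f n t =
    (N n)^-1 * huber (N n * (v y - c)) - (N n)^-1 * huber (N n * (v x - c)).
  by have [_ ->] := fv n.
rewrite (_ : (fun n => _) = fun n =>
  (N n)^-1 * huber (N n * (v y - c)) - (N n)^-1 * huber (N n * (v x - c))); last first.
  by apply/funext => n; exact: eI.
by apply: cvgB; exact: huber_scaled_cvg.
Qed.

End positive_part.

Section pushforward_measures.
Context {R : realType}.
Local Notation TR := (measurableTypeR R).
Local Notation mu := (@lebesgue_measure R).
Implicit Types (v g h f : R -> R).

Lemma pushforward_finite (k : {finite_measure set TR -> \bar R}) v :
  measurable_fun setT v ->
  exists k' : {finite_measure set TR -> \bar R},
    (forall A : set R, measurable A -> k' A = k (v @^-1` A)) /\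
    (forall (A : set R) (f : R -> \bar R), measurable A -> measurable_fun A f ->
       (forall x, (0 <= f x)%E) ->
       (\int[k']_(x in A) f x = \int[k]_(x in v @^-1` A) f (v x))%E).
Proof.
move=> mv0; have mv : @measurable_fun _ _ TR TR setT v by exact: mv0.
pose p := @pushforward _ _ TR TR R k v.
pose m : {measure set TR -> \bar R} :=
  measure_function_pushforward__canonical__measure_function_Measure k mv.
have pfin : fin_num_fun p.
  move=> A mA; rewrite /p /pushforward fin_num_measure// -[X in measurable X]setTI.
  exact (mv measurableT _ mA).
pose k' : {finite_measure set TR -> \bar R} :=
  HB.pack (Measure.sort m) (Measure_isFinite.Build _ _ _ (Measure.sort m) pfin).
exists k'; split => // A f mA mf f0.
by rewrite -(ge0_integral_pushforward mv).
Qed.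

Lemma ge0_integral_eq_add (m1 m2 m3 m4 : {finite_measure set TR -> \bar R}) :
  (forall A : set R, measurable A -> (m1 A + m2 A = m3 A + m4 A)%E) ->
  forall (A : set R) (f : R -> \bar R), measurable A -> measurable_fun A f ->
    (forall x, (0 <= f x)%E) ->
    (\int[m1]_(x in A) f x + \int[m2]_(x in A) f x =
     \int[m3]_(x in A) f x + \int[m4]_(x in A) f x)%E.
Proof.
move=> mE A f mA mf f0.
rewrite -!ge0_integral_measure_add//; apply: eq_measure_integral => B mB _.
transitivity (m1 B + m2 B)%E; first exact: measure_addE.
by rewrite mE//; exact/esym/measure_addE.
Qed.

Lemma Rintegral_indic_mul (m : {measure set TR -> \bar R}) (A B : set R) f :
  \int[m]_(x in A) (f x * \1_B x) = \int[m]_(x in A `&` B) f x.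
Proof.
rewrite -[LHS]/(\int[m]_(x in A) ((f \* \1_B) x)) -patch_indic.
by rewrite -Rintegral_mkcondr.
Qed.

Lemma integrable_indic_mul (m : {measure set TR -> \bar R}) (B : set R) f :
  measurable B -> m.-integrable setT (EFin \o f) ->
  m.-integrable setT (EFin \o (fun x => f x * \1_B x)).
Proof.
move=> mB fi; rewrite (_ : (fun x => _) = (fun x => \1_B x * f x)); last first.
  by apply/funext => x; rewrite mulrC.
apply: (@integrableMT _ _ 1) => //.
by move=> x; rewrite indicE; case: (_ \in _); rewrite ?normr1 ?normr0.
Qed.

Lemma itv_oc_indic (c d z : R) : c < d ->
  \1_(`]c, d]%classic) z = (c < z)%R%:R - (d < z)%R%:R :> R.
Proof.
move=> cd; rewrite indicE; case: (boolP (z \in _)) => [|/negP]; rewrite inE/= in_itv/=.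
  by move=> /andP[cz zd]; rewrite cz ltNge zd/= subr0.
case: (ltP c z) => cz; case: (ltP d z) => dz //= _; rewrite ?subrr//.
by have := lt_le_trans cd (ltW dz); rewrite ltNge cz.
Qed.

Lemma Rintegral_oc_indic f (c d : R) :
  \int[mu]_(z in `]c, d]) f z = \int[mu]_z (f z * \1_(`]c, d]%classic) z).
Proof. by rewrite Rintegral_indic_mul setTI. Qed.

(** Both sides are the signed length of the overlap of []c, d]] with the interval oriented from [s]
    to [t]. The right side is the form in which truncations at [c] and [d] produce it. *)
Lemma fine_sub_oc_lebesgue (s t c d : R) : c < d ->
  \int[mu]_(z in `]c, d]) (\1_(`]s, t]%classic) z) -
  \int[mu]_(z in `]c, d]) (\1_(`]t, s]%classic) z) =
  (Num.max (t - c) 0 - Num.max (s - c) 0) - (Num.max (t - d) 0 - Num.max (s - d) 0).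
Proof.
move=> cd.
have E (x y : R) : \int[mu]_(z in `]c, d]) (\1_(`]x, y]%classic) z) =
    Num.max (Num.min d y - Num.max c x) 0.
  under eq_Rintegral do rewrite -[\1_ _ _]mul1r.
  rewrite Rintegral_indic_mul Rintegral_cst ?mul1r; last exact: measurableI.
  have -> : `]c, d]%classic `&` `]x, y]%classic = `]Num.max c x, Num.min d y]%classic.
    by apply/seteqP; split => z /=; rewrite !in_itv/= gt_max le_min;
      [move=> [/andP[-> ->] /andP[-> ->]]|move=> /andP[/andP[-> ->] /andP[-> ->]]].
  have [cx|xd] := leP (Num.max c x) (Num.min d y).
    by rewrite lebesgue_measure_oc// [RHS]max_l ?subr_ge0.
  by rewrite set_itv_ge ?bnd_simp -?leNgt ?(ltW xd)// measure0 [RHS]max_r ?subr_le0 ?(ltW xd).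
rewrite !E.
have key (x y : R) : x <= y -> Num.max (Num.min d y - Num.max c x) 0 -
    Num.max (Num.min d x - Num.max c y) 0 =
  (Num.max (y - c) 0 - Num.max (x - c) 0) - (Num.max (y - d) 0 - Num.max (x - d) 0).
  move=> xy.
  have -> : Num.max (Num.min d x - Num.max c y) 0 = 0.
    apply: max_r; rewrite subr_le0 (@le_trans _ _ x)// ?ge_min ?le_max ?lexx ?xy ?orbT//.
  case: (leP (y - c) 0) => h1; case: (leP (x - c) 0) => h2; try (exfalso; lra);
  case: (leP (y - d) 0) => h3; try (exfalso; lra);
  case: (leP (x - d) 0) => h4; try (exfalso; lra);
  case: (leP d y) => h5; try (exfalso; lra);
  case: (leP c x) => h6; try (exfalso; lra);
  by case: leP => h7; lra.
by have [/key//|/ltW/key h] := leP s t; lra.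
Qed.

End pushforward_measures.

(** * Chain rule for primitives of bounded Borel functions *)

Section chain_rule.
Context {R : realType}.
Local Notation TR := (measurableTypeR R).
Local Notation mu := (@lebesgue_measure R).
Implicit Types (v g h f : R -> R).

Lemma density_measure_fine h : mu.-integrable setT (EFin \o h) ->
  (forall x, 0 <= h x) ->
  exists k : {finite_measure set TR -> \bar R},
    (forall A : set R, measurable A -> k A = (\int[mu]_(x in A) h x)%:E) /\
    (forall (A : set R) f (B : R), measurable A -> measurable_fun setT f ->
       (forall x, 0 <= f x <= B) ->
       (\int[k]_(x in A) (f x)%:E)%E = (\int[mu]_(x in A) (f x * h x))%:E).
Proof.
move=> ih h0; have [k [kE kI]] := density_measure ih h0.
exists k; split => [A mA|A f B mA mf fB]; first by rewrite kE// EFin_Rintegral.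
rewrite kI//; last by move=> x; rewrite lee_fin; have /andP[] := fB x.
  rewrite EFin_Rintegral//.
  apply: (@integrableMT _ _ B _ _ mf _ ih).
  by move=> x; have /andP[f0 fb] := fB x; rewrite ger0_norm.
by apply/measurable_EFinP; exact: measurable_funTS.
Qed.

(** The pushforward by [v] of the signed measure [g dx] on []x, y]] is Lebesgue measure on the
    interval oriented from [v x] to [v y]. This is checked on intervals []c, d]], where it is the
    difference of two rules for positive parts; integrating the Borel function [r] against both
    sides gives the chain rule without any continuity of [r]. *)
Lemma is_primitive_comp v g (S r : R -> R) (B : R) : is_primitive v g ->
  measurable_fun setT r -> (forall s, 0 <= r s <= B) ->
  (forall s t, s < t -> \int[mu]_(z in `]s, t]) r z = S t - S s) ->
  is_primitive (S \o v) (fun x => r (v x) * g x).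
Proof.
move=> vg mr rB rS; have [ig gv] := vg.
have mv : measurable_fun setT v := is_primitive_measurable vg.
have mrv : measurable_fun setT (r \o v) by exact: measurableT_comp.
have irg : mu.-integrable setT (EFin \o (fun x => r (v x) * g x)).
  apply: (@integrableMT _ _ B _ _ mrv _ ig) => x /=.
  by have /andP[r0 rb] := rB (v x); rewrite ger0_norm.
split => // x y xy; rewrite /comp.
pose E : set R := `]x, y]%classic.
have mE : measurable E by exact: measurable_itv.
have mg : measurable_fun setT g := integrableT_measurable ig.
pose gp t := Num.max (g t) 0 * \1_E t.
pose gn t := Num.max (- g t) 0 * \1_E t.
have igp : mu.-integrable setT (EFin \o gp).
  apply: integrable_indic_mul => //.
  apply: (@integrable_leT _ _ _ (fun t => `|g t|)); last exact: integrable_normT.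
    exact: measurable_maxr.
  by move=> t; rewrite /Order.max; case: ifP => _; rewrite ?normr0.
have ign : mu.-integrable setT (EFin \o gn).
  apply: integrable_indic_mul => //.
  apply: (@integrable_leT _ _ _ (fun t => `|g t|)); last exact: integrable_normT.
    by apply: measurable_maxr => //; exact: measurable_funN.
  by move=> t; rewrite /Order.max; case: ifP => _; rewrite ?normr0 ?normrN.
have gp0 t : 0 <= gp t by rewrite mulr_ge0// ?le_max ?lexx ?orbT// indicE.
have gn0 t : 0 <= gn t by rewrite mulr_ge0// ?le_max ?lexx ?orbT// indicE.
have gpn t : gp t - gn t = g t * \1_E t.
  rewrite /gp /gn -mulrBl; congr (_ * _).
  by rewrite /Order.max; case: ltP => h1; case: ltP => h2; lra.
have [kp [kpE kpI]] := density_measure_fine igp gp0.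
have [kn [knE knI]] := density_measure_fine ign gn0.
have [P [PE PI]] := pushforward_finite kp mv.
have [N [NE NI]] := pushforward_finite kn mv.
have indic0 (A : set R) (z : R) : 0 <= \1_A z :> R by rewrite indicE.
have [l1 [l1E l1I]] := density_measure_fine (integrable_indic_itv (v x) (v y) false false)
  (indic0 _).
have [l2 [l2E l2I]] := density_measure_fine (integrable_indic_itv (v y) (v x) false false)
  (indic0 _).
have mpre c d : measurable (v @^-1` `]c, d]).
  by rewrite -[X in measurable X]setTI; exact: mv.
(* The truncation rules at [c] and at [d] subtract to the chain rule for the indicator of []c,
   d]]. *)
have PN c d : c < d -> (\int[mu]_(t in v @^-1` `]c, d]) gp t -
      \int[mu]_(t in v @^-1` `]c, d]) gn t) =
    (Num.max (v y - c) 0 - Num.max (v x - c) 0) -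
    (Num.max (v y - d) 0 - Num.max (v x - d) 0).
  move=> cd; have mp := mpre c d.
  rewrite -RintegralB//; [|exact: integrableT..].
  under eq_Rintegral do rewrite gpn.
  have [ic <-//] := is_primitive_pos_part c vg.
  have [id <-//] := is_primitive_pos_part d vg.
  rewrite -RintegralB//; [|exact: integrableT..].
  rewrite Rintegral_indic_mul setIC.
  rewrite -(Rintegral_indic_mul mu E (v @^-1` `]c, d])).
  apply: eq_Rintegral => t _.
  by rewrite -mulrBl -itv_oc_indic// mulrC.
(* [P - N] is the pushforward and [l1 - l2] is Lebesgue measure on the oriented interval; only one
   of [l1] and [l2] can be nonzero. *)
have key : forall A : set R, measurable A -> (P A + l2 A = N A + l1 A)%E.
  apply: eq_add_measure_oc => c d cd.
  rewrite PE// NE// kpE// knE// l1E// l2E// -!EFinD; congr EFin.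
  by have := PN _ _ cd; have := fine_sub_oc_lebesgue (v x) (v y) cd; lra.
have r0 z : (0 <= (r z)%:E)%E by rewrite lee_fin; have /andP[] := rB z.
have mrE : measurable_fun setT (EFin \o r) by exact/measurable_EFinP.
have := ge0_integral_eq_add key measurableT mrE r0.
rewrite PI// NI// preimage_setT /=.
have e1 := kpI setT (r \o v) B measurableT mrv (fun z => rB (v z)).
have e2 := knI setT (r \o v) B measurableT mrv (fun z => rB (v z)).
have e3 := l1I setT r B measurableT mr rB.
have e4 := l2I setT r B measurableT mr rB.
rewrite /= in e1 e2; rewrite e1 e2 e3 e4 -!EFinD => h; have {h} := EFin_inj h.
rewrite -!Rintegral_oc_indic /=.
have irvg (h : R -> R) : mu.-integrable setT (EFin \o h) ->
    mu.-integrable setT (EFin \o (fun x => r (v x) * h x)).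
  move=> ih; apply: (@integrableMT _ _ B _ _ mrv _ ih) => z /=.
  by have /andP[rz0 rb] := rB (v z); rewrite ger0_norm.
have -> : \int[mu]_(t in `]x, y]) (r (v t) * g t) =
    \int[mu]_t (r (v t) * gp t) - \int[mu]_t (r (v t) * gn t).
  rewrite -RintegralB//; [|exact: irvg..].
  rewrite Rintegral_oc_indic; apply: eq_Rintegral => t _.
  by rewrite -mulrBr gpn mulrA.
have [vxy|vyx|->] := ltgtP (v x) (v y).
- by rewrite [in X in _ + X = _]set_itv_ge ?bnd_simp -?leNgt ?ltW// Rintegral_set0 rS//; lra.
- by rewrite [in X in _ = _ + X]set_itv_ge ?bnd_simp -?leNgt ?ltW// Rintegral_set0 rS//; lra.
- by rewrite !set_itvoc0 !Rintegral_set0; lra.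
Qed.

End chain_rule.

(** * Test functions *)

Section bump_functions.
Context {R : realType}.
Implicit Types (s x c d : R) (k n : nat) (f g : R -> R).

(** The exponent [k] records the negative powers produced by differentiation: the derivative of
    [flat s k] is a combination of [flat s k.+2] and [flat s k.+1], so the family is stable. *)
Definition flat s k x : R := if 0 < x then x ^- k * expR (- (s / x)) else 0.

(** Comparing the exponential with its Taylor term of order k+2 at [s / x] beats the power [x ^- k]
    with two powers of [x] to spare, which gives a zero derivative at 0. *)
Lemma flat_le s k x : 0 < s ->
  `|flat s k x| <= (k.+2)`!%:R / s ^+ k.+2 * x ^+ 2.
Proof.
move=> s0; rewrite /flat; case: ifPn => [x0|_]; last first.
  by rewrite normr0 mulr_ge0 ?sqr_ge0// divr_ge0// exprn_ge0// ltW.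
have sx0 : 0 < s / x by rewrite divr_gt0.
rewrite ger0_norm ?mulr_ge0 ?expR_ge0 ?invr_ge0 ?exprn_ge0 ?(ltW x0)//.
rewrite expRN ler_pdivrMl ?exprn_gt0//.
rewrite invf_ple ?posrE ?expR_gt0//; last first.
  by rewrite !mulr_gt0 ?invr_gt0 ?exprn_gt0// ltr0n fact_gt0.
apply: le_trans (expR_ge1Dxn k.+1 (ltW sx0)).
rewrite -[leLHS]add0r lerD// le_eqVlt; apply/orP; left; apply/eqP.
have f0 : (k.+2)`!%:R != 0 :> R by rewrite pnatr_eq0 -lt0n fact_gt0.
rewrite expr_div_n; move: f0; move: ((k.+2)`!%:R : R) => F f0.
have x0' : x != 0 by rewrite gt_eqF.
have s0' : s != 0 by rewrite gt_eqF.
rewrite !(exprS _ k.+1) !(exprS _ k); field.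
by rewrite f0 x0' s0' !expf_neq0.
Qed.

Lemma is_derive_quadratic0 f (C : R) : (forall x, `|f x| <= C * x ^+ 2) ->
  is_derive (0 : R) (1 : R) f 0.
Proof.
move=> fC.
have f0 : f 0 = 0 by apply/eqP; rewrite -normr_le0 (le_trans (fC 0))// expr0n mulr0.
have lim0 : h^-1 *: (f (h *: 1 + 0) - f 0) @[h --> 0^'] --> (0 : R).
  apply/cvgrPdist_le => e e0; near=> h.
  have h0 : h != 0 by near: h; exact: nbhs_dnbhs_neq.
  rewrite sub0r normrN f0 subr0 addr0 normrZ normfV.
  rewrite ler_pdivrMl ?normr_gt0// (le_trans (fC _))//.
  rewrite [h *: 1]mulr1 -real_normK ?num_real// expr2 mulrA mulrC ler_wpM2l//.
  have : `|h| <= e / (`|C| + 1).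
    near: h; apply: dnbhs0_le; rewrite divr_gt0//.
  rewrite ler_pdivlMr ?(ltr_wpDl _ ltr01)// => he.
  apply: le_trans he; rewrite mulrC ler_wpM2l//.
  by rewrite (le_trans (ler_norm _))// lerDl.
apply: DeriveDef.
  by rewrite /derivable; apply/cvg_ex; exists 0; exact: lim0.
by rewrite /derive; apply: cvg_lim.
Unshelve. all: end_near. Qed.

Lemma is_derive_flat s k x : 0 < s ->
  is_derive x 1 (flat s k) (s * flat s k.+2 x - k%:R * flat s k.+1 x).
Proof.
move=> s0; have [x0|x0|x0] := ltgtP x 0.
- have -> : s * flat s k.+2 x - k%:R * flat s k.+1 x = 0.
    by rewrite /flat ifF ?(lt_gtF x0)// !mulr0 subrr.
  have nE : {near x, cst 0 =1 flat s k}.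
    near=> y; rewrite /flat ifF//; apply/negbTE; rewrite -leNgt ltW//.
    by near: y; exact: lt_nbhsl.
  apply: DeriveDef; first by apply: (near_eq_derivable nE); exact: derivable_cst.
  by rewrite -(near_eq_derive _ nE) derive_cst.
- have x0' : x != 0 by rewrite gt_eqF.
  have nE : {near x, (fun y => (y ^+ k)^-1 * expR (- (s / y))) =1 flat s k}.
    near=> y; rewrite /flat ifT//.
    by near: y; exact: lt_nbhsr.
  have D : is_derive x 1 (fun y => (y ^+ k)^-1 * expR (- (s / y)))
     (s * flat s k.+2 x - k%:R * flat s k.+1 x).
    have Dk : is_derive x 1 (fun y => (y ^+ k)^-1) (- k%:R * (x ^+ k.+1)^-1).
      case: (k) => [|m].
        rewrite (_ : (fun y => _) = cst 1); last by apply/funext => y; rewrite expr0 invr1.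
        by rewrite oppr0 mul0r; exact: is_derive_cst.
      have xm0 : (fun y : R => y ^+ m.+1) x != 0 by rewrite expf_neq0.
      have Dp : is_derive x 1 (fun y : R => y ^+ m.+1) ((m.+1%:R * x ^+ m)).
        have H := is_deriveX m.+1 (is_derive_id x 1); rewrite exprfctE in H.
        by apply: (is_derive_eq H); rewrite /GRing.scale /= mulr1.
      apply: (is_derive_eq (is_deriveV (f := fun y : R => y ^+ m.+1) xm0 Dp)); rewrite /= /GRing.scale /= !exprS -[in LHS]/(m.+1%:R).
      by field; rewrite x0' expf_neq0.
    have Di : is_derive x 1 (fun y => - (s * y^-1)) (s / x ^+ 2).
      apply: (is_derive_eq (is_deriveN (is_deriveZ s (is_deriveV (x0' : id x != 0) (is_derive_id x 1))))); rewrite /= /GRing.scale /=.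
      by field.
    have De := is_derive1_comp (f := expR) (g := fun y => - (s / y)) (is_derive_expR (- (s / x))) Di.
    apply: (is_derive_eq (is_deriveM Dk De)).
    rewrite /flat x0 /comp /= /GRing.scale /= !exprS.
    move: (expR _) => E; field.
    by rewrite x0' expf_neq0.
  case: D => D1 D2; apply: DeriveDef; first exact: (near_eq_derivable nE).
  by rewrite -(near_eq_derive _ nE).
- rewrite x0; have -> : s * flat s k.+2 0 - k%:R * flat s k.+1 0 = 0.
    by rewrite /flat ltxx !mulr0 subrr.
  by apply: is_derive_quadratic0 => y; exact: flat_le.
Unshelve. all: end_near. Qed.

(** A family that contains the bumps and their linear combinations and is stable under derivatives:
    a single differentiation lemma then gives derivatives of all orders. *)
Inductive smooth_class : (R -> R) -> Prop :=
| SmoothFlat s k c : 0 < s -> smooth_class (fun x => flat s k (x - c))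
| SmoothFlatN s k c : 0 < s -> smooth_class (fun x => flat s k (c - x))
| SmoothScale r f : smooth_class f -> smooth_class (fun x => r * f x)
| SmoothAdd f g : smooth_class f -> smooth_class g -> smooth_class (fun x => f x + g x)
| SmoothMul f g : smooth_class f -> smooth_class g -> smooth_class (fun x => f x * g x).

Lemma smooth_class_derive f : smooth_class f ->
  exists2 g, smooth_class g & forall x, is_derive x 1 f (g x).
Proof.
elim => {f} [s k c s0|s k c s0|r f _ [g sg fg]|f1 f2 _ [g1 sg1 fg1] _ [g2 sg2 fg2]
  |f1 f2 sf1 [g1 sg1 fg1] sf2 [g2 sg2 fg2]].
- exists (fun x => s * flat s k.+2 (x - c) + (- k%:R) * flat s k.+1 (x - c)).
    by apply: SmoothAdd; apply: SmoothScale; exact: SmoothFlat.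
  move=> x; have D : is_derive x 1 (fun y : R => y - c) 1.
    by have := is_deriveB (is_derive_id x 1) (is_derive_cst c x 1); rewrite subr0.
  have := is_derive1_comp (f := flat s k) (g := fun y => y - c) (is_derive_flat k (x - c) s0) D.
  by rewrite mulr1 mulNr.
- exists (fun x => - 1 * (s * flat s k.+2 (c - x) + (- k%:R) * flat s k.+1 (c - x))).
    by apply: SmoothScale; apply: SmoothAdd; apply: SmoothScale; exact: SmoothFlatN.
  move=> x; have D : is_derive x 1 (fun y : R => c - y) (- 1).
    by have := is_deriveB (is_derive_cst c x 1) (is_derive_id x 1); rewrite sub0r.
  have := is_derive1_comp (f := flat s k) (g := fun y => c - y) (is_derive_flat k (c - x) s0) D.
  by rewrite mulrN1 mulN1r mulNr.
- exists (fun x => r * g x); first exact: SmoothScale.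
  by move=> x; have := is_deriveZ r (fg x).
- exists (fun x => g1 x + g2 x); first exact: SmoothAdd.
  by move=> x; have := is_deriveD (fg1 x) (fg2 x).
- exists (fun x => f1 x * g2 x + f2 x * g1 x).
    by apply: SmoothAdd; exact: SmoothMul.
  by move=> x; have := is_deriveM (fg1 x) (fg2 x).
Qed.

Lemma smooth_class_derivable f : smooth_class f ->
  forall n x, derivable (derive1n n f) x 1.
Proof.
move=> sf n.
suff : smooth_class (derive1n n f).
  by move=> /smooth_class_derive[g _ fg] x; have [] := fg x.
elim: n => // n IH; rewrite derive1nS.
have [g sg fg] := smooth_class_derive IH.
rewrite (_ : derive1 _ = g)//; apply/funext => x.
by rewrite derive1E; have [_ ->] := fg x.
Qed.

Definition bump s c d x : R := flat s 0 (x - c) * flat s 0 (d - x).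

Lemma flat0E s x : flat s 0 x = if 0 < x then expR (- (s / x)) else 0.
Proof. by rewrite /flat expr0 invr1 mul1r. Qed.

Lemma flat0_bound s x : 0 < s -> 0 <= flat s 0 x <= 1.
Proof.
move=> s0; rewrite flat0E; case: ifPn => x0; last by rewrite lexx ler01.
by rewrite expR_ge0 -expR0 ler_expR oppr_le0 divr_ge0// ltW.
Qed.

Lemma bump_bound s c d x : 0 < s -> 0 <= bump s c d x <= 1.
Proof.
move=> s0; have /andP[a1 a2] := flat0_bound (x - c) s0.
have /andP[b1 b2] := flat0_bound (d - x) s0.
by rewrite mulr_ge0//= mulr_ile1.
Qed.

Lemma bump_out s c d x : ~~ (c <= x <= d) -> bump s c d x = 0.
Proof.
rewrite /bump !flat0E negb_and -!ltNge => /orP[xc|dx].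
  by rewrite ifF ?mul0r// subr_gt0; apply/negbTE; rewrite -leNgt ltW.
by rewrite [X in _ * X]ifF ?mulr0// subr_gt0; apply/negbTE; rewrite -leNgt ltW.
Qed.

Lemma test_function_support (a b c d : R) f :
  (forall n x, derivable (derive1n n f) x 1) -> a < c -> d < b ->
  (forall x, ~~ (c <= x <= d) -> f x = 0) -> test_function a b f.
Proof.
move=> sf ac db f0; split => //.
have sub : closure [set x | f x != 0] `<=` `[c, d].
  apply: (subset_trans (closure_subset (B := `[c, d]%classic) _)).
    by move=> x /=; apply: contra_neqT => /f0.
  by rewrite -(closure_id _).1//; exact: itv_closed.
split.
  by apply: subclosed_compact sub; [exact: closed_closure|exact: segment_compact].
by apply: (subset_trans sub) => x /=; rewrite !in_itv/=; lra.
Qed.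

Lemma test_function_bump (a b s c d : R) : 0 < s -> a < c -> d < b ->
  test_function a b (bump s c d).
Proof.
move=> s0 ac db; apply: (@test_function_support _ _ c d) => //; last first.
  by move=> x; exact: bump_out.
apply: smooth_class_derivable; apply: SmoothMul.
  exact: SmoothFlat.
exact: SmoothFlatN.
Qed.

Lemma test_functionP (a b : R) f : a < b -> test_function a b f ->
  exists c d, [/\ a < c, c <= d, d < b & forall x, ~~ (c <= x <= d) -> f x = 0].
Proof.
move=> ab [_ [cK Kab]]; set K := closure _ in cK Kab.
have f0 x : ~ K x -> f x = 0.
  by move=> nK; apply/eqP; apply: contrapT => /negP fx; apply: nK; exact: subset_closure.
have [K0|/set0P Kne] := eqVneq K set0.
  exists ((a + b) / 2), ((a + b) / 2); split; [lra|lra|lra|].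
  by move=> x _; apply: f0; rewrite K0.
have cid : {within K, continuous (@id R)} by apply: continuous_subspaceT => x; exact: cvg_id.
have [d dK dmax] := compact_EVT_max Kne cK cid.
have [c cK' cmin] := compact_EVT_min Kne cK cid.
rewrite !inE in dK cK'.
have := Kab _ dK; have := Kab _ cK'; rewrite /= !in_itv/= => /andP[ac _] /andP[_ db].
exists c, d; split => //; first by apply: cmin; rewrite inE.
move=> x; apply: contraNeq => fx.
have xK : x \in K by rewrite inE; exact: subset_closure.
by rewrite (cmin _ xK) (dmax _ xK).
Qed.

End bump_functions.

Section test_functions.
Context {R : realType}.
Local Notation TR := (measurableTypeR R).
Local Notation mu := (@lebesgue_measure R).
Implicit Types (a b s x c d : R) (k n : nat) (f g phi : R -> R).

(** The steepness [n.+1 ^- 2] is negligible against the margin [1/n.+1], so a factor at distance at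
    least [1/n.+1] inside its edge tends to 1. The left edge lies to the right of [x] and the right
    edge beyond [y], so that the limit is the indicator of the half-open []x, y]]; cutting at [a]
    and [b] keeps the support inside []a, b[]. *)
Definition bump_oc a b x y n : R -> R :=
  bump (n.+1%:R ^- 2) (Num.max x a + n.+1%:R^-1) (Num.min (y + n.+1%:R^-1) (b - n.+1%:R^-1)).

Lemma test_function_bump_oc a b x y n : test_function a b (bump_oc a b x y n).
Proof.
have n0 : 0 < (n.+1%:R : R)^-1 by rewrite invr_gt0 ltr0n.
apply: test_function_bump; first by rewrite invr_gt0 exprn_gt0// ltr0n.
  by rewrite (@le_lt_trans _ _ (Num.max x a)) ?le_max ?lexx ?orbT// ltrDl.
by rewrite (@le_lt_trans _ _ (b - n.+1%:R^-1)) ?ge_min ?lexx ?orbT// gtrBl.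
Qed.

Lemma near_invn (e : R) : 0 < e -> \forall n \near \oo, (n.+1%:R : R)^-1 < e.
Proof.
move=> e0; exists (Num.truncn e^-1) => // n /= en.
rewrite invf_plt ?posrE ?ltr0n//; apply: (lt_le_trans (truncnS_gt _)).
by rewrite ler_nat.
Qed.

Lemma flat_cvg1 (z : nat -> R) : (\forall n \near \oo, n.+1%:R^-1 <= z n) ->
  flat (n.+1%:R ^- 2) 0 (z n) @[n --> \oo] --> (1 : R).
Proof.
move=> zn; apply/cvgrPdist_le => e e0; near=> n.
have N0 : 0 < (n.+1%:R : R) by rewrite ltr0n.
have nz : (n.+1%:R : R)^-1 <= z n by near: n.
have z0 : 0 < z n by apply: lt_le_trans nz; rewrite invr_gt0.
have s0 : 0 < (n.+1%:R : R) ^- 2 by rewrite invr_gt0 exprn_gt0.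
have /andP[_ f1] := flat0_bound (z n) s0.
rewrite ger0_norm ?subr_ge0// flat0E z0.
have := expR_ge1Dx (- ((n.+1%:R : R) ^- 2 / z n)).
have : (n.+1%:R : R) ^- 2 / z n <= n.+1%:R^-1.
  rewrite ler_pdivrMr// -exprVn expr2 ler_wpM2l// invr_ge0 ltW//.
have : (n.+1%:R : R)^-1 < e by near: n; exact: near_invn.
move: (_ / z n) (_ ^-1) => w i; lra.
Unshelve. all: end_near. Qed.

Lemma flat_cvg0 (z : nat -> R) : (\forall n \near \oo, z n <= 0) ->
  flat (n.+1%:R ^- 2) 0 (z n) @[n --> \oo] --> (0 : R).
Proof.
move=> zn; apply: cvg_near_cst; near=> n.
by rewrite /flat ifF//; apply/negbTE; rewrite -leNgt; near: n.
Unshelve. all: end_near. Qed.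

Lemma bump_oc_cvg a b x y t : bump_oc a b x y n t @[n --> \oo] -->
  (\1_(`]x, y] `&` `]a, b[) t : R).
Proof.
have [tin|tout] := pselect ((`]x, y] `&` `]a, b[)%classic t).
  rewrite indicE mem_set//= -[1%:R]mulr1; move: tin => [] /=.
  rewrite !in_itv/= => /andP[xt ty] /andP[at_ tb]; apply: cvgM.
    have h : 0 < (t - Num.max x a) / 2.
      by rewrite divr_gt0// subr_gt0 gt_max xt.
    apply: flat_cvg1; near=> n.
    have : (n.+1%:R : R)^-1 < (t - Num.max x a) / 2 by near: n; exact: near_invn.
    move: (n.+1%:R^-1 : R) (Num.max x a) => i w; lra.
  have h : 0 < (b - t) / 2 by lra.
  apply: flat_cvg1; near=> n.
  have : (n.+1%:R : R)^-1 < (b - t) / 2 by near: n; exact: near_invn.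
  rewrite lerBrDr le_min; move: (n.+1%:R^-1 : R) => i hi; apply/andP; split; lra.
rewrite indicE memNset//=.
have [xat|] := leP t (Num.max x a).
  rewrite -[0%:R](mul0r (0 : R)).
  have H : flat (n.+1%:R ^- 2) 0 (t - (Num.max x a + n.+1%:R^-1)) @[n --> \oo] --> (0 : R).
    by apply: flat_cvg0; near=> n; have : 0 <= (n.+1%:R : R)^-1 by []; move: (xat); move: (n.+1%:R^-1 : R) (Num.max x a) => i w; lra.
  apply/cvgrPdist_le => e e0; near=> n.
  rewrite mul0r sub0r normrN /bump_oc /bump normrM.
  have s0 : 0 < (n.+1%:R : R) ^- 2 by rewrite invr_gt0 exprn_gt0// ltr0n.
  have /andP[u1 u2] := (flat0_bound (Num.min (y + n.+1%:R^-1) (b - n.+1%:R^-1) - t) s0).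
  rewrite (@le_trans _ _ (`|flat (n.+1%:R ^- 2) 0 (t - (Num.max x a + n.+1%:R^-1))| * 1))//.
    by rewrite ler_wpM2l// ger0_norm.
  rewrite mulr1; near: n; move/cvgr0_norm_le: H; exact.
rewrite gt_max => /andP[xt at_].
have H : flat (n.+1%:R ^- 2) 0 (Num.min (y + n.+1%:R^-1) (b - n.+1%:R^-1) - t) @[n --> \oo] --> (0 : R).
  apply: flat_cvg0; have [tb|bt] := ltP t b.
    have yt : y < t.
      rewrite ltNge; apply/negP => ty; apply: tout; split; rewrite /= in_itv/=.
        by rewrite xt.
      by rewrite at_.
    near=> n; rewrite subr_le0 ge_min; apply/orP; left.
    have : (n.+1%:R : R)^-1 < t - y by near: n; apply: near_invn; lra.
    move: (n.+1%:R^-1 : R) => i; lra.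
  near=> n; rewrite subr_le0 ge_min; apply/orP; right.
  by have : 0 <= (n.+1%:R : R)^-1 by []; move: (n.+1%:R^-1 : R) (Num.max x a) => i w; lra.
apply/cvgrPdist_le => e e0; near=> n.
rewrite sub0r normrN /bump_oc /bump normrM.
have s0 : 0 < (n.+1%:R : R) ^- 2 by rewrite invr_gt0 exprn_gt0// ltr0n.
have /andP[u1 u2] := (flat0_bound (t - (Num.max x a + n.+1%:R^-1)) s0).
rewrite (@le_trans _ _ (1 * `|flat (n.+1%:R ^- 2) 0 (Num.min (y + n.+1%:R^-1) (b - n.+1%:R^-1) - t)|))//.
  by rewrite ler_wpM2r// ger0_norm.
rewrite mul1r; near: n; move/cvgr0_norm_le: H; exact.
Unshelve. all: end_near. Qed.

Lemma bump_oc_bound a b x y n t : 0 <= bump_oc a b x y n t <= 1.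
Proof. by apply: bump_bound; rewrite invr_gt0 exprn_gt0// ltr0n. Qed.

Lemma test_function_continuous a b phi : test_function a b phi -> continuous phi.
Proof.
by move=> [sm _] x; have /derivable1_diffP/differentiable_continuous := sm 0%N x.
Qed.

Lemma test_function_derive_continuous a b phi : test_function a b phi -> continuous (derive1 phi).
Proof.
by move=> [sm _] x; have := sm 1%N x; rewrite derive1n1 => /derivable1_diffP/differentiable_continuous.
Qed.

Lemma restr_finite (m : {finite_measure set TR -> \bar R}) (E : set R) : measurable E ->
  exists m' : {finite_measure set TR -> \bar R},
    forall A : set R, measurable A -> m' A = m (A `&` E).
Proof. by move=> mE; exists [the {finite_measure set TR -> \bar R} of mrestr m mE]. Qed.

Lemma finite_integrable_bounded (m : {finite_measure set TR -> \bar R}) (E : set R) f (B : R) :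
  measurable E -> measurable_fun setT f -> (forall x, `|f x| <= B) ->
  m.-integrable E (EFin \o f).
Proof.
move=> mE mf fB; apply: measurable_bounded_integrable => //.
- exact: finite_measure_lty.
- exact: measurable_funTS.
- by exists `|B|; split => // r Br x _ /=; rewrite (le_trans (fB x))// (le_trans (ler_norm _))// ltW.
Qed.

Lemma eq_finite_measure_oc (m1 m2 : {finite_measure set TR -> \bar R}) :
  (forall x y, x < y -> m1 `]x, y]%classic = m2 `]x, y]%classic) ->
  forall A : set R, measurable A -> m1 A = m2 A.
Proof.
move=> m12; apply: (eq_measure_oc m12) => x y; exact: finite_measure_lty.
Qed.

(** By dominated convergence the bumps recover the masses of []x, y]] inside []a, b[], and these
    determine a finite measure there. *)
Lemma eq_finite_measure_bump a b (m1 m2 : {finite_measure set TR -> \bar R}) :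
  (forall x y n, \int[m1]_(t in `]a, b[) bump_oc a b x y n t =
               \int[m2]_(t in `]a, b[) bump_oc a b x y n t) ->
  forall A : set R, measurable A -> m1 (A `&` `]a, b[) = m2 (A `&` `]a, b[).
Proof.
move=> m12.
pose E : set R := `]a, b[%classic.
have mE : measurable E by exact: measurable_itv.
have [n1 n1E] := restr_finite m1 mE.
have [n2 n2E] := restr_finite m2 mE.
suff n12 : forall A : set R, measurable A -> n1 A = n2 A.
  by move=> A mA; rewrite -n1E// -n2E// n12.
apply: eq_finite_measure_oc => x y xy.
rewrite n1E// n2E//.
have mxy : measurable (`]x, y]%classic `&` E) by exact: measurableI.
have mb n : measurable_fun setT (bump_oc a b x y n).
  by apply: continuous_measurable_fun; apply: test_function_continuous; exact: test_function_bump_oc.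
have cv (m : {finite_measure set TR -> \bar R}) :
    \int[m]_(t in E) bump_oc a b x y n t @[n --> \oo] --> fine (m (`]x, y]%classic `&` E)).
  have [|||||_ cvgI] := @cvg_Rintegral _ m E (bump_oc a b x y) (\1_(`]x, y] `&` E)) (fun=> 1) mE.
  - by move=> n; exact: measurable_funTS.
  - by apply: measurable_funTS; exact: measurable_indic.
  - by move=> t _; exact: bump_oc_cvg.
  - by apply: (@finite_integrable_bounded _ _ _ 1) => // t; rewrite normr1.
  - move=> n t _; have /andP[h0 h1] := bump_oc_bound a b x y n t.
    by rewrite ger0_norm.
  rewrite [X in _ --> X](_ : _ = \int[m]_(x0 in E) \1_(`]x, y] `&` E) x0)//.
  under eq_Rintegral do rewrite -[\1_ _ _]mul1r.
  rewrite Rintegral_indic_mul Rintegral_cst ?mul1r; last exact: measurableI.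
  by rewrite setICA setIid.
have := cv m2; under eq_fun do rewrite -m12.
move=> /(cvg_unique _ (cv m1)) h.
rewrite -[LHS]fineK ?fin_num_measure// -[RHS]fineK ?fin_num_measure//.
by congr EFin; apply: h.
Qed.

Lemma integrable_continuous_support (c d : R) f : continuous f ->
  (forall x, ~~ (c <= x <= d) -> f x = 0) -> mu.-integrable setT (EFin \o f).
Proof.
move=> cf f0.
have fE : f = f \_ `[c, d]%classic.
  apply/funext => x; rewrite patchE; case: ifPn => // /negP xcd.
  by apply: f0; apply/negP => h; apply: xcd; rewrite inE/= in_itv.
have : mu.-integrable `[c, d]%classic (EFin \o f).
  apply: (@continuous_compact_integrable _ f); first exact: segment_compact.
  exact: continuous_subspaceT.
move=> h; rewrite fE -restrict_EFin.
exact: (@integrable_mkcond _ TR R mu `[c, d]%classic (EFin \o f) (measurable_itv _)).1 h.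
Qed.

Lemma test_function_is_primitive a b phi : a < b -> test_function a b phi ->
  is_primitive phi (derive1 phi).
Proof.
move=> ab tphi.
have [c [d [ac cd db phi0]]] := test_functionP ab tphi.
have cphi := test_function_continuous tphi.
have cphi' := test_function_derive_continuous tphi.
have dphi0 x : ~~ (c <= x <= d) -> derive1 phi x = 0.
  move=> xcd; have nE : {near x, cst 0 =1 phi}.
    move: xcd; rewrite negb_and -!ltNge => /orP[xc|dx]; near=> y.
      rewrite phi0// negb_and -!ltNge; apply/orP; left.
      by near: y; exact: lt_nbhsl.
    rewrite phi0// negb_and -!ltNge; apply/orP; right.
    by near: y; exact: lt_nbhsr.
  by rewrite derive1E -(near_eq_derive _ nE) derive_cst.
have iphi' : mu.-integrable setT (EFin \o derive1 phi).
  exact: integrable_continuous_support cphi' dphi0.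
split => // x y xy; apply: EFin_inj.
rewrite Rintegral_itv_obnd_cbnd ?EFin_Rintegral//; last exact: integrableT.
rewrite (continuous_FTC2 (F := phi) xy) ?EFinB//.
  exact: continuous_subspaceT.
have [sm _] := tphi; split => [z _||].
- exact: sm 0%N z.
- by apply: cvg_at_right_filter; exact: cphi.
- by apply: cvg_at_left_filter; exact: cphi.
Unshelve. all: end_near. Qed.

Lemma bounded_continuous_support (c d : R) f : continuous f ->
  (forall x, ~~ (c <= x <= d) -> f x = 0) -> exists B, forall x, `|f x| <= B.
Proof.
move=> cf f0; have [cd|dc] := leP c d; last first.
  by exists 0 => x; rewrite f0 ?normr0//; apply/negP => /andP[]; lra.
have cnf : {within `[c, d], continuous (fun x => `|f x|)}.
  by apply: continuous_subspaceT => x; apply: continuous_comp (cf x) _; exact: norm_continuous.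
have [e _ eM] := EVT_max cd cnf.
exists `|f e| => x; case: (boolP (c <= x <= d)) => xcd; last by rewrite f0// normr0.
by apply: eM; rewrite in_itv.
Qed.

Lemma test_function_bounded a b phi : a < b -> test_function a b phi ->
  exists B, forall x, `|phi x| <= B.
Proof.
move=> ab tphi; have [c [d [ac cd db phi0]]] := test_functionP ab tphi.
exact: bounded_continuous_support (test_function_continuous tphi) phi0.
Qed.

Lemma test_function_derive_support a b phi : a < b -> test_function a b phi ->
  exists c d, [/\ a < c, c <= d, d < b & forall x, ~~ (c <= x <= d) -> derive1 phi x = 0].
Proof.
move=> ab tphi; have [c [d [ac cd db phi0]]] := test_functionP ab tphi.
exists c, d; split => // x xcd; have nE : {near x, cst 0 =1 phi}.
  move: xcd; rewrite negb_and -!ltNge => /orP[xc|dx]; near=> y.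
    rewrite phi0// negb_and -!ltNge; apply/orP; left.
    by near: y; exact: lt_nbhsl.
  rewrite phi0// negb_and -!ltNge; apply/orP; right.
  by near: y; exact: lt_nbhsr.
by rewrite derive1E -(near_eq_derive _ nE) derive_cst.
Unshelve. all: end_near. Qed.

Lemma test_function_derive_bounded a b phi : a < b -> test_function a b phi ->
  exists B, forall x, `|derive1 phi x| <= B.
Proof.
move=> ab tphi; have [c [d [_ _ _ phi0]]] := test_function_derive_support ab tphi.
exact: bounded_continuous_support (test_function_derive_continuous tphi) phi0.
Qed.

(** The primitive from the left vanishes to the right of [[c, d]] as well, because it is equal there
    to the whole integral, which is 0. *)
Lemma test_function_antiderivative a b (eta : R -> R) (c d : R) : smooth_class eta ->
  a < c -> d < b -> (forall x, ~~ (c <= x <= d) -> eta x = 0) ->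
  \int[mu]_x eta x = 0 ->
  exists2 phi, test_function a b phi & derive1 phi = eta.
Proof.
move=> sm ac db eta0 inteta.
have smd := smooth_class_derivable sm.
have ceta : continuous eta.
  by move=> x; have /derivable1_diffP/differentiable_continuous := smd 0%N x.
have ieta := integrable_continuous_support ceta eta0.
pose phi x := \int[mu]_(t in `]-oo, x]) eta t.
have phiE x : derivable phi x 1 /\ derive1 phi x = eta x.
  apply: (@continuous_FTC1 _ eta -oo%O x (x + 1)) => //; first by rewrite ltrDl.
  - exact: integrableT.
  - by first [rewrite bnd_simp|rewrite ltNye|exact: ltNyr].
  - exact: ceta.
have dphi : derive1 phi = eta by apply/funext => x; have [] := phiE x.
exists phi => //; apply: (@test_function_support _ _ _ c d) => //.
  case => [x|n x]; first by have [] := phiE x.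
  by rewrite /derive1n iterSr -/(derive1n n _) dphi; exact: smd.
move=> x; rewrite negb_and -!ltNge => /orP[xc|dx].
  rewrite /phi; under eq_Rintegral.
    move=> t /[!inE]/=; rewrite in_itv/= => tx.
    rewrite eta0; last by rewrite negb_and -!ltNge (le_lt_trans tx xc).
    over.
  by rewrite Rintegral_cst// mul0r.
have -> : phi x = \int[mu]_t eta t - \int[mu]_(t in `]x, +oo[) eta t.
  have := @Rintegral_itvB R eta -oo%O +oo%O x; rewrite set_itvNyy.
  move=> /(_ ieta isT isT) <-.
  by rewrite /phi opprB addrC subrK.
rewrite inteta sub0r; apply/eqP; rewrite oppr_eq0; apply/eqP.
under eq_Rintegral.
  move=> t /[!inE]/=; rewrite in_itv/= andbT => tx.
  rewrite eta0; last by rewrite negb_and -!ltNge (lt_trans dx tx) orbT.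
  over.
by rewrite Rintegral_cst// mul0r.
Qed.

End test_functions.

Section integration_by_parts.
Context {R : realType}.
Local Notation TR := (measurableTypeR R).
Local Notation mu := (@lebesgue_measure R).
Implicit Types (a b s x c d : R) (k n : nat) (f g h phi : R -> R).

Lemma Rintegral_add_measures (m1 m2 m3 m4 : {finite_measure set TR -> \bar R})
    (E : set R) f (B : R) :
  (forall A : set R, measurable A -> (m1 A + m2 A = m3 A + m4 A)%E) ->
  measurable E -> measurable_fun setT f -> (forall x, `|f x| <= B) ->
  \int[m1]_(x in E) f x + \int[m2]_(x in E) f x =
  \int[m3]_(x in E) f x + \int[m4]_(x in E) f x.
Proof.
move=> mE mE' mf fB.
(* Adding the bound makes the integrand nonnegative; the contribution of the constant cancels, since
   the masses of [E] satisfy the same identity. *)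
have f0 x : (0 <= (f x + B)%:E)%E.
  by rewrite lee_fin; have := fB x; rewrite ler_norml; lra.
have mfB : measurable_fun E (fun x => (f x + B)%:E).
  apply/measurable_EFinP; apply: measurable_funTS.
  by apply: measurable_funD => //; exact: measurable_cst.
have := ge0_integral_eq_add mE mE' mfB f0.
have iE (m : {finite_measure set TR -> \bar R}) :
    (\int[m]_(x in E) (f x + B)%:E)%E = (\int[m]_(x in E) f x + B * fine (m E))%:E.
  have i1 := finite_integrable_bounded m mE' mf fB.
  have i2 : m.-integrable E (EFin \o (fun=> B)) by exact: finite_measure_integrable_cst.
  rewrite -Rintegral_cst// -RintegralD// /Rintegral fineK//.
  apply: integrable_fin_num => //.
  rewrite (_ : (fun x => _) = (EFin \o f) \+ (EFin \o (fun=> B)))%E//.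
  exact: integrableD.
rewrite !iE -!EFinD => h; have {h} := EFin_inj h.
have : fine (m1 E) + fine (m2 E) = fine (m3 E) + fine (m4 E).
  by rewrite -!fineD ?fin_num_measure// mE.
move: (fine _) (fine _) (fine _) (fine _) => a1 a2 a3 a4 h.
have -> : a4 = a2 + a1 - a3 by lra.
rewrite mulrBr mulrDr; lra.
Qed.

(** The Jordan parts may be replaced by any pair of finite measures with the same difference,
    because [charge_pos nu + m2] and [m1 + charge_neg nu] coincide. *)
Lemma charge_integral_sub (nu : {charge set TR -> \bar R})
    (m1 m2 : {finite_measure set TR -> \bar R}) (E : set R) f (B : R) :
  (forall A : set R, measurable A -> nu A = (m1 A - m2 A)%E) ->
  measurable E -> measurable_fun setT f -> (forall x, `|f x| <= B) ->
  charge_integral nu E f = \int[m1]_(x in E) f x - \int[m2]_(x in E) f x.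
Proof.
move=> nuE mE mf fB; rewrite /charge_integral.
suff : \int[charge_pos nu]_(x in E) f x + \int[m2]_(x in E) f x =
  \int[m1]_(x in E) f x + \int[charge_neg nu]_(x in E) f x by lra.
apply: Rintegral_add_measures fB => // A mA.
have := nuE _ mA; rewrite charge_split//.
have [] : [/\ charge_pos nu A \is a fin_num, charge_neg nu A \is a fin_num,
  m1 A \is a fin_num & m2 A \is a fin_num] by rewrite !fin_num_measure.
move=> /fineK <- /fineK <- /fineK <- /fineK <-.
rewrite -!EFinN -!EFinD => h; have := EFin_inj h => e; congr EFin; lra.
Qed.

Lemma indic_bool (A : set R) (x : R) (e : bool) : (A x <-> e) -> \1_A x = e%:R :> R.
Proof.
move=> Ae; rewrite indicE; case: e Ae => Ae; first by rewrite mem_set//; exact/Ae.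
by rewrite memNset// => /Ae.
Qed.

Lemma Rintegral_indicT (m : {measure set TR -> \bar R}) (A : set R) f :
  \int[m]_(x in A) f x = \int[m]_x (f x * \1_A x).
Proof. by rewrite Rintegral_indic_mul setTI. Qed.

Lemma subset_Rintegral (m : {measure set TR -> \bar R}) (A E : set R) h :
  measurable A -> measurable E -> A `<=` E -> (forall x, 0 <= h x) ->
  m.-integrable setT (EFin \o h) ->
  \int[m]_(x in A) h x <= \int[m]_(x in E) h x.
Proof.
move=> mA mE AE h0 ih.
rewrite -(setTI A) -(setTI E) -!Rintegral_indic_mul; apply: le_Rintegral => //.
- exact: integrable_indic_mul.
- exact: integrable_indic_mul.
move=> x _; rewrite ler_wpM2l// !indicE ler_nat.
by case: (boolP (x \in A)) => // /[!inE] /AE xE; rewrite mem_set.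
Qed.

(** Both sides integrate [h x] over the region [t <= x] for the product of Lebesgue measure and
    [m]. *)
Lemma tonelli_cumulative (m : {finite_measure set TR -> \bar R}) h :
  measurable_fun setT h -> (forall x, 0 <= h x) -> mu.-integrable setT (EFin \o h) ->
  \int[mu]_x (h x * fine (m `]-oo, x]%classic)) =
  \int[m]_t (\int[mu]_(x in `[t, +oo[) h x).
Proof.
move=> mh h0 ih.
pose F (z : TR * TR) : \bar R := ((h z.1)%:E * ((z.2 <= z.1)%R%:R : R)%:E)%E.
have fE (x t : R) : ((t <= x)%R%:R : R) = \1_(`]-oo, x]%classic) t.
  by apply/esym/indic_bool; rewrite /= in_itv.
have fE' (x t : R) : ((t <= x)%R%:R : R) = \1_(`[t, +oo[%classic) x.
  by apply/esym/indic_bool; rewrite /= in_itv/= andbT.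
have mF : measurable_fun setT F.
  rewrite (_ : F = EFin \o ((h \o fst) \* \1_[set z : TR * TR | z.2 <= z.1])%R).
    apply/measurable_EFinP; apply: measurable_funM.
      by apply: measurableT_comp => //; exact: measurable_fst.
    apply: measurable_indic; rewrite -[X in measurable X]setTI.
    by apply: measurable_fun_le.
  apply/funext => -[x t]; rewrite /F/= -EFinM; congr (_ * _)%:E.
  rewrite indicE; case: (boolP (t <= x)) => tx; first by rewrite mem_set.
  by rewrite memNset//; exact/negP.
have F0 z : (0 <= F z)%E by rewrite /F -EFinM lee_fin mulr_ge0.
have := @fubini_tonelli _ _ TR TR R mu m F mF F0.
have -> : (\int[mu]_x \int[m]_t F (x, t))%E = (\int[mu]_x (h x * fine (m `]-oo, x]%classic))%:E)%E.
  apply: eq_integral => x _; rewrite /F/=.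
  under eq_integral do rewrite fE.
  rewrite ge0_integralZl//; last first.
    by rewrite lee_fin.
    exact/measurable_EFinP/measurable_indic.
  by rewrite integral_indic// setIT EFinM fineK// fin_num_measure.
have -> : (\int[m]_t \int[mu]_x F (x, t))%E = (\int[m]_t (\int[mu]_(x in `[t, +oo[) h x)%:E)%E.
  apply: eq_integral => t _; rewrite /F/=.
  rewrite -[X in _ = (X)%:E]/(\int[mu]_(x in `[t, +oo[) h x) -[in RHS](setTI `[t, +oo[%classic).
  rewrite -Rintegral_indic_mul EFin_Rintegral//; last exact: integrable_indic_mul.
  by apply: eq_integral => x _; rewrite fE' EFinM.
by rewrite /Rintegral => ->.
Qed.

(** Exchanging the integrals leaves, for each [t], the integral of [derive1 phi] over [[t, +oo[],
    which is [- phi t]. The derivative is split by sign so that Tonelli applies. *)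
Lemma test_function_cumulative a b phi (m : {finite_measure set TR -> \bar R}) :
  a < b -> test_function a b phi ->
  \int[mu]_x (derive1 phi x * fine (m `]-oo, x]%classic)) =
  - \int[m]_(x in `]a, b[) phi x.
Proof.
move=> ab tphi; have [c [d [ac cd db phi0]]] := test_functionP ab tphi.
have [iphi' phiE] := test_function_is_primitive ab tphi.
have cphi' := test_function_derive_continuous tphi.
have mphi' : measurable_fun setT (derive1 phi) by exact: continuous_measurable_fun.
have mphi : measurable_fun setT phi.
  by apply: continuous_measurable_fun; exact: test_function_continuous tphi.
have [B phiB] := test_function_bounded ab tphi.
pose hp x := Num.max (derive1 phi x) 0.
pose hn x := Num.max (- derive1 phi x) 0.
have mhp : measurable_fun setT hp by exact: measurable_maxr.
have mhn : measurable_fun setT hn by apply: measurable_maxr => //; exact: measurable_funN.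
have hpn x : derive1 phi x = hp x - hn x.
  by rewrite /hp /hn /Order.max; case: ltP => h1; case: ltP => h2; lra.
have hp0 x : 0 <= hp x by rewrite le_max lexx orbT.
have hn0 x : 0 <= hn x by rewrite le_max lexx orbT.
have ihp : mu.-integrable setT (EFin \o hp).
  apply: (@integrable_leT _ _ _ (fun t => `|derive1 phi t|)) => //; last exact: integrable_normT.
  by move=> t; rewrite /hp /Order.max; case: ifP => _; rewrite ?normr0.
have ihn : mu.-integrable setT (EFin \o hn).
  apply: (@integrable_leT _ _ _ (fun t => `|derive1 phi t|)) => //; last exact: integrable_normT.
  by move=> t; rewrite /hn /Order.max; case: ifP => _; rewrite ?normr0 ?normrN.
pose M x := fine (m `]-oo, x]%classic).
have MT x : `|M x| <= fine (m setT).
  by rewrite ger0_norm ?fine_ge0// fine_le ?fin_num_measure// le_measure ?inE.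
have mM : measurable_fun setT M.
  apply: nondecreasing_measurable => // x y xy.
  rewrite fine_le ?fin_num_measure// le_measure ?inE//.
  by apply: subset_itvl; rewrite bnd_simp.
have iM h : mu.-integrable setT (EFin \o h) -> mu.-integrable setT (EFin \o (fun x => h x * M x)).
  move=> ih; rewrite (_ : (fun x => _) = (fun x => M x * h x)).
    exact: integrableMT mM MT ih.
  by apply/funext => x; rewrite mulrC.
transitivity (\int[mu]_x (hp x * M x) - \int[mu]_x (hn x * M x)).
  rewrite -RintegralB//; [|exact: iM..].
  by apply: eq_Rintegral => x _; rewrite -mulrBl -hpn.
rewrite (tonelli_cumulative m mhp hp0 ihp) (tonelli_cumulative m mhn hn0 ihn).
have ub (h : R -> R) : mu.-integrable setT (EFin \o h) -> (forall x, 0 <= h x) ->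
    m.-integrable setT (EFin \o (fun t => \int[mu]_(x in `[t, +oo[) h x)).
  move=> ih h0; apply: (@finite_integrable_bounded _ _ _ _ (\int[mu]_x h x)) => //.
    apply: nonincreasing_measurable => // x y xy.
    apply: subset_Rintegral => //; apply: subset_itvr; rewrite bnd_simp//.
  move=> x; rewrite ger0_norm ?Rintegral_ge0//.
  exact: subset_Rintegral.
rewrite -RintegralB//; [|exact: ub..].
have [c' [d' [_ _ _ phi'0]]] := test_function_derive_support ab tphi.
rewrite (_ : - _ = \int[m]_x (- phi x)).
  apply: eq_Rintegral => t _.
  rewrite -RintegralB//; [|exact: integrableT..].
  transitivity (\int[mu]_(x in `[t, +oo[) derive1 phi x).
    by apply: eq_Rintegral => x _; rewrite hpn.
  (* A point to the right of [t] and of both supports: [phi] is 0 there and its derivative is 0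
     beyond. *)
  pose y := `|t| + `|d| + `|d'| + 1.
  have [ty dy dy'] : [/\ t < y, d < y & d' < y].
    have := ler_norm t; have := ler_norm d; have := ler_norm d'.
    have := normr_ge0 t; have := normr_ge0 d; have := normr_ge0 d'.
    by rewrite /y => ? ? ? ? ? ?; split; lra.
  have -> : - phi t = phi y - phi t.
    by rewrite (phi0 y) ?sub0r// negb_and -!ltNge dy orbT.
  rewrite -phiE// Rintegral_itv_obnd_cbnd; last exact: integrableT.
  rewrite [LHS]Rintegral_indicT [RHS]Rintegral_indicT; apply: eq_Rintegral => x _.
  have [xy|yx] := leP x y; last first.
    by rewrite phi'0 ?mul0r// negb_and -!ltNge (lt_trans dy' yx) orbT.
  congr (_ * _); rewrite !indicE; congr (_%:R); congr nat_of_bool.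
  by apply/idP/idP => /[!inE]/=; rewrite !in_itv/= ?xy !andbT.
have iphi : m.-integrable setT (EFin \o phi) by exact: finite_integrable_bounded phiB.
transitivity (\int[m]_x (-1 * phi x)); last by apply: eq_Rintegral => x _; rewrite mulN1r.
rewrite RintegralZl// mulN1r; congr (- _).
rewrite -(setTI `]a, b[%classic) -Rintegral_indic_mul; apply: eq_Rintegral => x _.
case: (boolP (c <= x <= d)) => [/andP[cx xd]|xcd]; last by rewrite phi0// mul0r.
rewrite (indic_bool (e := true)) ?mulr1//; split => // _.
by rewrite /= in_itv/=; apply/andP; split; lra.
Qed.

End integration_by_parts.

(** * Weak and distributional derivatives *)

Section weak_derivatives.
Context {R : realType}.
Local Notation TR := (measurableTypeR R).
Local Notation mu := (@lebesgue_measure R).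
Implicit Types (a b s x c d : R) (k n : nat) (f g h phi q : R -> R).

Let arith4 (p1 n1 p2 n2 : R) : p2 - n2 = p1 - n1 -> p1 + n2 = p2 + n1.
Proof. lra. Qed.

Let arith4' (p1 n1 p2 n2 : R) : p1 + n2 = p2 + n1 -> p1 - n1 = p2 - n2.
Proof. lra. Qed.

Let frac_swap (x y z : R) : x / y * z = z / y * x.
Proof. by rewrite mulrAC (mulrC x) mulrAC. Qed.

Lemma sum_measure (m1 m2 : {finite_measure set TR -> \bar R}) :
  exists m : {finite_measure set TR -> \bar R},
    (forall A : set R, measurable A -> m A = (m1 A + m2 A)%E) /\
    (forall (E : set R) f (B : R), measurable E -> measurable_fun setT f ->
      (forall x, `|f x| <= B) ->
      \int[m]_(x in E) f x = \int[m1]_(x in E) f x + \int[m2]_(x in E) f x).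
Proof.
pose n := [the {measure set TR -> \bar R} of measure_add m1 m2].
have nE (A : set TR) : n A = (m1 A + m2 A)%E by exact: measure_addE.
have nfin : fin_num_fun n.
  by move=> A mA; rewrite nE fin_numD !fin_num_measure.
pose n' : {finite_measure set TR -> \bar R} :=
  HB.pack (Measure.sort n) (Measure_isFinite.Build _ _ _ (Measure.sort n) nfin).
exists n'; split=> [A mA|E f B mE mf fB]; first exact: nE.
have i1 := finite_integrable_bounded m1 mE mf fB.
have i2 := finite_integrable_bounded m2 mE mf fB.
rewrite /Rintegral -fineD; [|exact: integrable_fin_num..].
by congr fine; rewrite -integral_measure_add.
Qed.

Lemma density_split g : mu.-integrable setT (EFin \o g) ->
  exists m1 m2 : {finite_measure set TR -> \bar R},
  [/\ forall A : set R, measurable A -> (m1 A - m2 A)%E = (\int[mu]_(x in A) g x)%:E,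
    forall A : set R, measurable A -> (m1 A + m2 A)%E = (\int[mu]_(x in A) `|g x|)%:E &
    forall (E : set R) f (B : R), measurable E -> measurable_fun setT f ->
      (forall x, `|f x| <= B) ->
      \int[m1]_(x in E) f x - \int[m2]_(x in E) f x = \int[mu]_(x in E) (f x * g x)].
Proof.
move=> ig; have mg : measurable_fun setT g := integrableT_measurable ig.
pose gp x := Num.max (g x) 0; pose gn x := Num.max (- g x) 0.
have gpn x : g x = gp x - gn x.
  by rewrite /gp /gn /Order.max; case: ltP => h1; case: ltP => h2; lra.
have gpn' x : `|g x| = gp x + gn x.
  rewrite /gp /gn; have [g0|g0] := leP 0 (g x).
    by rewrite ger0_norm// max_r ?oppr_le0// addr0.
  by rewrite ltr0_norm// max_l ?add0r// oppr_ge0 ltW.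
have gp0 x : 0 <= gp x by rewrite le_max lexx orbT.
have gn0 x : 0 <= gn x by rewrite le_max lexx orbT.
have igp : mu.-integrable setT (EFin \o gp).
  apply: (@integrable_leT _ _ _ (fun t => `|g t|)); last exact: integrable_normT.
    exact: measurable_maxr.
  by move=> t; rewrite /gp /Order.max; case: ifP => _; rewrite ?normr0.
have ign : mu.-integrable setT (EFin \o gn).
  apply: (@integrable_leT _ _ _ (fun t => `|g t|)); last exact: integrable_normT.
    by apply: measurable_maxr => //; exact: measurable_funN.
  by move=> t; rewrite /gn /Order.max; case: ifP => _; rewrite ?normr0 ?normrN.
have [m1 [m1E m1I]] := density_measure_fine igp gp0.
have [m2 [m2E m2I]] := density_measure_fine ign gn0.
exists m1, m2; split.
- move=> A mA; rewrite m1E// m2E// -EFinB -RintegralB//; [|exact: integrableT..].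
  by congr EFin; apply: eq_Rintegral => x _; rewrite -gpn.
- move=> A mA; rewrite m1E// m2E// -EFinD -RintegralD//; [|exact: integrableT..].
  by congr EFin; apply: eq_Rintegral => x _; rewrite -gpn'.
move=> E f B mE mf fB.
have key (m : {finite_measure set TR -> \bar R}) h : mu.-integrable setT (EFin \o h) ->
    (forall A : set R, measurable A -> m A = (\int[mu]_(x in A) h x)%:E) ->
    (forall (A : set R) f (B : R), measurable A -> measurable_fun setT f ->
       (forall x, 0 <= f x <= B) ->
       (\int[m]_(x in A) (f x)%:E)%E = (\int[mu]_(x in A) (f x * h x))%:E) ->
    \int[m]_(x in E) f x = \int[mu]_(x in E) (f x * h x).
  move=> ih mE' mI.
  have if1 := finite_integrable_bounded m mE mf fB.
  have i2 : m.-integrable E (EFin \o (fun=> B)) by exact: finite_measure_integrable_cst.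
  have mfB : measurable_fun setT (fun x => f x + B).
    by apply: measurable_funD => //; exact: measurable_cst.
  have fB' x : 0 <= f x + B <= B + B by have := fB x; rewrite ler_norml; lra.
  have := mI E _ _ mE mfB fB'.
  have ifh : mu.-integrable setT (EFin \o (fun x => f x * h x)) by exact: integrableMT fB ih.
  have iBh : mu.-integrable setT (EFin \o (fun x => B * h x)) by exact: integrableZT.
  have -> : \int[mu]_(x in E) ((f x + B) * h x) =
      \int[mu]_(x in E) (f x * h x) + B * \int[mu]_(x in E) h x.
    rewrite -RintegralZl//; last exact: integrableT.
    rewrite -RintegralD//; [|exact: integrableT..].
    by apply: eq_Rintegral => x _; rewrite mulrDl.
  have -> : (\int[m]_(x in E) (f x + B)%:E)%E = (\int[m]_(x in E) f x + B * fine (m E))%:E.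
    rewrite -Rintegral_cst// -RintegralD// /Rintegral fineK//.
    apply: integrable_fin_num => //.
    rewrite (_ : (fun x => _) = (EFin \o f) \+ (EFin \o (fun=> B)))%E//.
    exact: integrableD.
  by rewrite mE'//= => e; exact: (addIr _ (EFin_inj e)).
rewrite (key m1 gp)// (key m2 gn)// -RintegralB//.
- by apply: eq_Rintegral => x _; rewrite -mulrBr -gpn.
- by apply: integrableT => //; exact: integrableMT fB igp.
- by apply: integrableT => //; exact: integrableMT fB ign.
Qed.

Lemma ae0_Rintegral g : mu.-integrable setT (EFin \o g) ->
  (forall A : set R, measurable A -> \int[mu]_(x in A) g x = 0) ->
  {ae mu, forall x, g x = 0}.
Proof.
move=> ig g0.
have i0 : mu.-integrable setT (EFin \o (fun=> 0 : R)) by exact: integrable0.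
have z (A : set R) : measurable A -> \int[mu]_(x in A) (0 : R) = 0.
  by move=> mA; rewrite Rintegral_cst// mul0r.
have h1 : {ae mu, forall x, g x <= 0}.
  by apply: ae_le_Rintegral => // A mA; rewrite g0// z.
have h2 : {ae mu, forall x, 0 <= g x}.
  by apply: ae_le_Rintegral => // A mA; rewrite g0// z.
by apply: ae_imply2 h1 h2 => x x1 x2; apply/eqP; rewrite eq_le x1 x2.
Qed.

Lemma measurable_bump_oc a b x y n : measurable_fun setT (bump_oc a b x y n).
Proof.
apply: continuous_measurable_fun; apply: test_function_continuous.
exact: test_function_bump_oc.
Qed.

(** The measures with densities the positive and the negative part of [q] integrate all bumps alike,
    so they coincide on []a, b[]. *)
Lemma ae0_bump a b q : mu.-integrable setT (EFin \o q) ->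
  (forall x y n, \int[mu]_(t in `]a, b[) (bump_oc a b x y n t * q t) = 0) ->
  {ae mu, forall x, `]a, b[%classic x -> q x = 0}.
Proof.
move=> iq q0; have [m1 [m2 [mE _ mI]]] := density_split iq.
have bb x y n t : `|bump_oc a b x y n t| <= 1.
  by have /andP[h0 h1] := bump_oc_bound a b x y n t; rewrite ger0_norm.
have m12 := @eq_finite_measure_bump _ a b m1 m2.
have {}m12 : forall A : set R, measurable A -> m1 (A `&` `]a, b[) = m2 (A `&` `]a, b[).
  apply: m12 => x y n.
  have := mI `]a, b[%classic _ _ (measurable_itv _) (measurable_bump_oc a b x y n) (bb x y n).
  by rewrite q0; lra.
have iqD : mu.-integrable setT (EFin \o (fun x => q x * \1_(`]a, b[%classic) x)).
  exact: integrable_indic_mul.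
have := @ae0_Rintegral _ iqD; move=> H.
have : {ae mu, forall x, q x * \1_(`]a, b[%classic) x = 0}.
  apply: H => A mA; apply: EFin_inj; rewrite Rintegral_indic_mul -mE; last exact: measurableI.
  by rewrite m12// subee// fin_num_measure//; exact: measurableI.
by apply: ae_imply => x + xD; rewrite (indic_bool (e := true)) ?mulr1.
Qed.

Lemma ae_exists (P : R -> Prop) c d : c < d -> {ae mu, forall x, P x} ->
  exists2 x, `]c, d[%classic x & P x.
Proof.
move=> cd [N [mN N0 PN]]; apply: contrapT => nex.
have cdN : `]c, d[%classic `<=` N.
  by move=> x xcd; apply: PN => Px; apply: nex; exists x.
have : (mu `]c, d[%classic <= 0)%E by rewrite -N0 le_measure ?inE.
by rewrite /= lebesgue_measure_itv/= lte_fin cd -EFinD lee_fin; lra.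
Qed.

(** Every bump becomes the derivative of a test function once a multiple of a fixed reference bump
    is subtracted to make its mean zero. Hence the integral of [f] against any bump is [c0] times
    the integral of that bump, and [f - c0] is orthogonal to all bumps. *)
Lemma du_bois_reymond a b f : a < b -> mu.-integrable setT (EFin \o f) ->
  (forall phi, test_function a b phi -> \int[mu]_(x in `]a, b[) (f x * derive1 phi x) = 0) ->
  exists c, {ae mu, forall x, `]a, b[%classic x -> f x = c}.
Proof.
move=> ab fi f0; pose D : set R := `]a, b[%classic.
have mD : measurable D by exact: measurable_itv.
have bb x y n t : `|bump_oc a b x y n t| <= 1.
  by have /andP[h0 h1] := bump_oc_bound a b x y n t; rewrite ger0_norm.
have bsupp x y n : exists c d, [/\ a < c, d < b & forall t, ~~ (c <= t <= d) -> bump_oc a b x y n t = 0].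
  have := test_functionP ab (test_function_bump_oc a b x y n).
  by move=> [c [d [? ? ? ?]]]; exists c, d.
have ib x y n : mu.-integrable setT (EFin \o bump_oc a b x y n).
  have [c [d [_ _]]] := bsupp x y n; apply: integrable_continuous_support.
  exact: test_function_continuous (test_function_bump_oc a b x y n).
have bD x y n h : \int[mu]_(t in D) (bump_oc a b x y n t * h t) =
    \int[mu]_t (bump_oc a b x y n t * h t).
  rewrite Rintegral_indicT; apply: eq_Rintegral => t _.
  have [c [d [ac db b0]]] := bsupp x y n.
  case: (boolP (c <= t <= d)) => [/andP[ct td]|ctd]; last by rewrite b0// !mul0r.
  by rewrite (indic_bool (e := true)) ?mulr1//; split => // _; rewrite /D/= in_itv/=; apply/andP; split; lra.
(* If every bump had integral 0, the indicator of [D] would vanish almost everywhere on [D]. *)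
have [x0 [y0 [n0 I0]]] : exists x y n, \int[mu]_t bump_oc a b x y n t != 0.
  apply: contrapT => nex.
  have : {ae mu, forall x, D x -> \1_D x = 0 :> R}.
    apply: ae0_bump; first exact: integrable_indic_itv.
    move=> x y n; rewrite Rintegral_indic_mul setIid.
    transitivity (\int[mu]_(t in D) (bump_oc a b x y n t * 1)).
      by apply: eq_Rintegral => t _; rewrite mulr1.
    rewrite bD; apply: contrapT => h; apply: nex; exists x, y, n.
    by apply/eqP => h2; apply: h; rewrite -[RHS]h2; apply: eq_Rintegral => t _; rewrite mulr1.
  move=> /(ae_exists ab)[x xD /(_ xD)].
  by rewrite (indic_bool (e := true))// => /eqP; rewrite oner_eq0.
pose c0 := \int[mu]_t (bump_oc a b x0 y0 n0 t * f t) / \int[mu]_t bump_oc a b x0 y0 n0 t.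
exists c0.
have ifc : mu.-integrable setT (EFin \o (fun x => f x * \1_D x - c0 * \1_D x)).
  apply: integrableBT; first exact: integrable_indic_mul.
  by apply: integrableZT; exact: integrable_indic_itv.
have : {ae mu, forall x, D x -> f x * \1_D x - c0 * \1_D x = 0}.
  apply: (ae0_bump ifc) => x y n; rewrite bD.
  pose k := \int[mu]_t bump_oc a b x y n t / \int[mu]_t bump_oc a b x0 y0 n0 t.
  pose eta t := bump_oc a b x y n t + (- k) * bump_oc a b x0 y0 n0 t.
  have seta : smooth_class eta.
    apply: SmoothAdd; last apply: SmoothScale.
      by apply: SmoothMul; [apply: SmoothFlat|apply: SmoothFlatN]; rewrite invr_gt0 exprn_gt0// ltr0n.
    by apply: SmoothMul; [apply: SmoothFlat|apply: SmoothFlatN]; rewrite invr_gt0 exprn_gt0// ltr0n.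
  have [c1 [d1 [ac1 db1 b1]]] := bsupp x y n.
  have [c2 [d2 [ac2 db2 b2]]] := bsupp x0 y0 n0.
  have [|||||phi tphi dphi] := @test_function_antiderivative _ a b eta (Num.min c1 c2) (Num.max d1 d2).
  - exact: seta.
  - by rewrite lt_min ac1.
  - by rewrite gt_max db1.
  - move=> t ht; rewrite /eta b1 ?b2 ?mulr0 ?addr0//; apply: contra ht => /andP[h1 h2].
      by rewrite ge_min le_max h1 h2 !orbT.
    by rewrite ge_min le_max h1 h2.
  - rewrite /eta RintegralD//; last by apply: integrableZT.
    rewrite RintegralZl// /k mulNr mulfVK// subrr//.
  have := f0 _ tphi; rewrite dphi.
  have ifb x' y' n' : mu.-integrable setT (EFin \o (fun t => bump_oc a b x' y' n' t * f t)).
    exact: integrableMT (measurable_bump_oc _ _ _ _ _) (bb x' y' n') fi.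
  have -> : \int[mu]_(t in `]a, b[) (f t * eta t) = \int[mu]_t (bump_oc a b x y n t * f t) -
      k * \int[mu]_t (bump_oc a b x0 y0 n0 t * f t).
    rewrite -!bD -RintegralZl//; last exact: integrableT.
    rewrite -RintegralB//; [|by apply: integrableT => //; exact: ifb|by apply: integrableT => //; apply: integrableZT; exact: ifb].
    by apply: eq_Rintegral => t _; rewrite /eta; ring.
  move=> e.
  have -> : \int[mu]_t (bump_oc a b x y n t * (f t * \1_D t - c0 * \1_D t)) =
     \int[mu]_t (bump_oc a b x y n t * f t) - c0 * \int[mu]_t bump_oc a b x y n t.
    rewrite -bD -[X in X - _]bD.
    have -> : \int[mu]_t bump_oc a b x y n t = \int[mu]_(t in D) bump_oc a b x y n t.
      transitivity (\int[mu]_t (bump_oc a b x y n t * 1)).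
        by apply: eq_Rintegral => t _; rewrite mulr1.
      by rewrite -bD; apply: eq_Rintegral => t _; rewrite mulr1.
    rewrite -RintegralZl//; last exact: integrableT.
    rewrite -RintegralB//; [|exact: integrableT|by apply: integrableT => //; exact: integrableZT].
    apply: eq_Rintegral => t tD; rewrite (indic_bool (e := true)) ?mulr1; first by ring.
    by split => // _; rewrite inE in tD.
  have : k * \int[mu]_t (bump_oc a b x0 y0 n0 t * f t) = c0 * \int[mu]_t bump_oc a b x y n t.
    exact: frac_swap.
  by move=> <-.
apply: ae_imply => x + xD => /(_ xD).
by rewrite (indic_bool (e := true)) ?mulr1// => /eqP; rewrite subr_eq0 => /eqP.
Qed.

Lemma test_functionS a b c d phi : a <= c -> d <= b -> test_function c d phi ->
  test_function a b phi.
Proof.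
move=> ac db [sm [cK Kcd]]; split => //; split => //.
by apply: (subset_trans Kcd) => x /=; rewrite !in_itv/=; lra.
Qed.

Lemma test_function_out a b phi x : test_function a b phi -> ~ `]a, b[%classic x -> phi x = 0.
Proof.
move=> [_ [_ Kab]] xab; apply/eqP; apply: contrapT => /negP fx; apply: xab.
by apply: Kab; exact: subset_closure.
Qed.

Lemma is_distr_derivative_charge a b u (nu1 nu2 : {charge set TR -> \bar R}) : a < b ->
  is_distr_derivative a b u nu1 -> is_distr_derivative a b u nu2 ->
  forall A : set R, measurable A -> nu1 A = nu2 A.
Proof.
move=> ab [s1 d1] [s2 d2] A mA; rewrite s1// s2//.
have mD : measurable (`]a, b[%classic : set R) by exact: measurable_itv.
have [m1 [m1E m1I]] := sum_measure (charge_pos nu1) (charge_neg nu2).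
have [m2 [m2E m2I]] := sum_measure (charge_pos nu2) (charge_neg nu1).
have bb x y n t : `|bump_oc a b x y n t| <= 1.
  by have /andP[h0 h1] := bump_oc_bound a b x y n t; rewrite ger0_norm.
have h x y n : \int[m1]_(t in `]a, b[) bump_oc a b x y n t =
               \int[m2]_(t in `]a, b[) bump_oc a b x y n t.
  have mb := measurable_bump_oc a b x y n.
  have := d1 _ (test_function_bump_oc a b x y n); rewrite d2; last exact: test_function_bump_oc.
  move=> /oppr_inj; rewrite /charge_integral (m1I _ _ _ mD mb (bb x y n)) (m2I _ _ _ mD mb (bb x y n)).
  exact: arith4.
have := eq_finite_measure_bump h mA; set E := A `&` _; have mE : measurable E by exact: measurableI.
rewrite m1E// m2E// (charge_split nu1 mE) (charge_split nu2 mE).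
have [] : [/\ charge_pos nu1 E \is a fin_num, charge_neg nu1 E \is a fin_num,
  charge_pos nu2 E \is a fin_num & charge_neg nu2 E \is a fin_num] by rewrite !fin_num_measure.
move=> /fineK <- /fineK <- /fineK <- /fineK <-.
by rewrite -!EFinN -!EFinD => e; congr EFin; exact: arith4' (EFin_inj e).
Qed.

Lemma cumulative_by_parts a b u phi (r : R)
    (m1 m2 : {finite_measure set TR -> \bar R}) : a < b ->
  measurable_fun `]a, b[ u ->
  {ae mu, forall x, `]a, b[%classic x ->
     u x = r + fine (m1 `]-oo, x]%classic) - fine (m2 `]-oo, x]%classic)} ->
  test_function a b phi ->
  \int[mu]_(x in `]a, b[) (u x * derive1 phi x) =
  - (\int[m1]_(x in `]a, b[) phi x - \int[m2]_(x in `]a, b[) phi x).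
Proof.
move=> ab mu_ uE tphi.
have mD : measurable (`]a, b[%classic : set R) by exact: measurable_itv.
have [B phiB] := test_function_bounded ab tphi.
have mphi : measurable_fun setT phi.
  by apply: continuous_measurable_fun; exact: test_function_continuous tphi.
have [iphi' phiE] := test_function_is_primitive ab tphi.
have mphi' : measurable_fun setT (derive1 phi) := integrableT_measurable iphi'.
have dphi0 x : ~ `]a, b[%classic x -> derive1 phi x = 0.
  have [c [d [ac cd db phi0]]] := test_function_derive_support ab tphi.
  move=> xab; apply: phi0; apply/negP => /andP[cx xd]; apply: xab.
  by rewrite /= in_itv/=; apply/andP; split; lra.
have iM (m : {finite_measure set TR -> \bar R}) :
    mu.-integrable setT (EFin \o (fun x => derive1 phi x * fine (m `]-oo, x]%classic))).
  rewrite (_ : (fun x => _) = (fun x => fine (m `]-oo, x]%classic) * derive1 phi x)); last first.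
    by apply/funext => x; rewrite mulrC.
  apply: (@integrableMT _ _ (fine (m setT)) _ _ _ _ iphi').
    apply: nondecreasing_measurable => // x y xy.
    rewrite fine_le ?fin_num_measure// le_measure ?inE//.
    by apply: subset_itvl; rewrite bnd_simp.
  by move=> x; rewrite ger0_norm ?fine_ge0// fine_le ?fin_num_measure// le_measure ?inE.
have -> : \int[mu]_(x in `]a, b[) (u x * derive1 phi x) =
    \int[mu]_x (r * derive1 phi x + derive1 phi x * fine (m1 `]-oo, x]%classic) -
      derive1 phi x * fine (m2 `]-oo, x]%classic)).
  transitivity (\int[mu]_(x in `]a, b[) (r * derive1 phi x + derive1 phi x * fine (m1 `]-oo, x]%classic) -
      derive1 phi x * fine (m2 `]-oo, x]%classic))).
    rewrite /Rintegral; congr fine; apply: ae_eq_integral => //.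
    - by apply/measurable_EFinP; apply: measurable_funM => //; exact: measurable_funTS.
    - apply/measurable_EFinP; apply: (@integrableT_measurable _ mu).
      by apply: integrableBT => //; apply: integrableDT => //; exact: integrableZT.
    - by apply: ae_imply uE => x + xD => /(_ xD) ->; congr EFin; ring.
  rewrite Rintegral_indicT; apply: eq_Rintegral => x _.
  have [xD|xD] := pselect (`]a, b[%classic x); last by rewrite dphi0// !(mulr0, mul0r, addr0, subrr).
  by rewrite (indic_bool (e := true)) ?mulr1.
rewrite RintegralB//; last by apply: integrableDT => //; exact: integrableZT.
rewrite RintegralD//; last exact: integrableZT.
rewrite RintegralZl// !(test_function_cumulative _ ab tphi).
have -> : \int[mu]_x derive1 phi x = 0.
  transitivity (\int[mu]_(x in `]a, b[) derive1 phi x).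
    rewrite [RHS]Rintegral_indicT; apply: eq_Rintegral => x _.
    have [xD|xD] := pselect (`]a, b[%classic x); last by rewrite dphi0// mul0r.
    by rewrite (indic_bool (e := true)) ?mulr1.
  rewrite Rintegral_itv_bndo_bndc; last exact: integrableT.
  rewrite phiE// (test_function_out tphi (x := b)) ?(test_function_out tphi (x := a)) ?subrr//.
    by rewrite /= in_itv/= ltxx.
  by rewrite /= in_itv/= ltxx andbF.
by ring.
Qed.

Lemma is_distr_derivative_cumulative a b u (r : R) (nu : {charge set TR -> \bar R})
    (m1 m2 : {finite_measure set TR -> \bar R}) : a < b ->
  measurable_fun `]a, b[ u ->
  (forall A : set R, measurable A -> nu A = (m1 (A `&` `]a, b[) - m2 (A `&` `]a, b[))%E) ->
  {ae mu, forall x, `]a, b[%classic x ->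
     u x = r + fine (m1 `]-oo, x]%classic) - fine (m2 `]-oo, x]%classic)} ->
  is_distr_derivative a b u nu.
Proof.
move=> ab mu_ nuE uE; split.
  by move=> A mA; rewrite nuE// [in RHS]nuE -?setIA ?setIid//; exact: measurableI.
move=> phi tphi.
rewrite (cumulative_by_parts ab mu_ uE tphi); congr (- _).
have mD : measurable (`]a, b[%classic : set R) by exact: measurable_itv.
have [B phiB] := test_function_bounded ab tphi.
have mphi : measurable_fun setT phi.
  by apply: continuous_measurable_fun; exact: test_function_continuous tphi.
have [n1 n1E] := restr_finite m1 mD.
have [n2 n2E] := restr_finite m2 mD.
rewrite (@charge_integral_sub _ nu n1 n2 _ _ B)//; last first.
  by move=> A mA; rewrite nuE// n1E// n2E.
have nE (n m : {finite_measure set TR -> \bar R}) : (forall A : set R, measurable A -> n A = m (A `&` `]a, b[)) ->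
    \int[n]_(x in `]a, b[) phi x = \int[m]_(x in `]a, b[) phi x.
  move=> nm; rewrite /Rintegral; congr fine; apply: eq_measure_integral => A mA Asub.
  by rewrite [LHS]nm// (setIidl Asub).
by rewrite (nE n1 m1)// (nE n2 m2).
Qed.

End weak_derivatives.

Section representations.
Context {R : realType}.
Local Notation TR := (measurableTypeR R).
Local Notation mu := (@lebesgue_measure R).
Implicit Types (a b p : R) (u f g : R -> R).

Lemma restrict_id (A : set R) f x : A x -> (f \_ A) x = f x.
Proof. by move=> Ax; rewrite /patch mem_set. Qed.

Lemma restrict_out (A : set R) f x : ~ A x -> (f \_ A) x = 0.
Proof. by move=> Ax; rewrite /patch memNset. Qed.

Lemma integrable_restrictT (A : set R) f : measurable A ->
  mu.-integrable A (EFin \o f) <-> mu.-integrable setT (EFin \o (f \_ A)).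
Proof.
move=> mA; have := @integrable_restrict _ TR R mu A mA setT measurableT (EFin \o f).
by rewrite setTI -restrict_EFin.
Qed.

Lemma integrable_sub (A : set R) f g : measurable A ->
  mu.-integrable A (EFin \o f) -> mu.-integrable A (EFin \o g) ->
  mu.-integrable A (EFin \o (fun x => f x - g x)).
Proof.
move=> mA /(integrable_restrictT _ mA) fi /(integrable_restrictT _ mA) gi.
apply/(integrable_restrictT _ mA).
rewrite (_ : _ \_ _ = (fun x => (f \_ A) x - (g \_ A) x)); first exact: integrableBT.
by apply/funext => x; rewrite /patch; case: ifP => //; rewrite (_ : point = 0 :> R)// subr0.
Qed.

Lemma Lp_spaceP a b p u : 1 <= p -> Lp_space a b p u <->
  measurable_fun setT (u \_ `]a, b[) /\ (\int[mu]_(x in `]a, b[) (`|u x| `^ p)%:E < +oo)%E.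
Proof.
move=> p1; have p0 : 0 < p by exact: lt_le_trans p1.
have mD : measurable (`]a, b[%classic : set R) by exact: measurable_itv.
have E : ('N[mu]_p%:E[EFin \o (u \_ `]a, b[)] `^ p =
    \int[mu]_(x in `]a, b[) (`|u x| `^ p)%:E)%E.
  rewrite powR_Lnorm ?gt_eqF// [RHS]integral_mkcond; apply: eq_integral => x _ /=.
  rewrite /patch; case: ifPn => // _.
  by rewrite (_ : point = 0 :> R)// normr0 powR0 ?gt_eqF.
rewrite /Lp_space /=; split.
  move=> /andP[/set_mem mf /set_mem fin]; split; first exact: mf.
  by rewrite -E; exact: poweR_lty.
move=> [mf fin]; apply/andP; split; first exact/mem_set.
rewrite inE /= /finite_norm.
by apply: (lty_poweRy (lt0r_neq0 p0)); rewrite E.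
Qed.

Lemma Lp_space_integrable a b p u : 1 <= p -> Lp_space a b p u ->
  mu.-integrable `]a, b[ (EFin \o u).
Proof.
move=> p1; have p0 : 0 < p by exact: lt_le_trans p1.
have mD : measurable (`]a, b[%classic : set R) by exact: measurable_itv.
move=> /(Lp_spaceP _ _ _ p1)[mf fin].
have mfD : measurable_fun `]a, b[ u.
  by apply/(measurable_restrictT _ mD).
apply/integrableP; split; first exact/measurable_EFinP.
have mup : (mu `]a, b[%classic < +oo)%E.
  by rewrite lebesgue_measure_itv/=; case: ifP => //; rewrite ltry.
apply: (@le_lt_trans _ _ (\int[mu]_(x in `]a, b[) (1 + (`|u x| `^ p)%:E))%E).
  apply: ge0_le_integral => //.
  - by apply/measurable_EFinP; exact: measurableT_comp.
  - apply: emeasurable_funD => //; apply/measurable_EFinP.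
    by apply: (measurableT_comp (measurable_powR _)); exact: measurableT_comp.
  - move=> x _ /=; rewrite -EFinD lee_fin.
    have [x1|x1] := leP `|u x| 1; first by rewrite (le_trans x1)// lerDl powR_ge0.
    rewrite -[leLHS]powRr1// -[leLHS]add0r lerD//.
    by apply: ler_powR => //; exact: ltW.
rewrite ge0_integralD//.
- by rewrite lte_add_pinfty// integral_cst// mul1e.
- apply/measurable_EFinP.
  by apply: (measurableT_comp (measurable_powR _)); exact: measurableT_comp.
Qed.

(** The difference [U] of the cumulative functions satisfies the same identity as [u], so [u - U] is
    orthogonal to all derivatives of test functions and is therefore constant. *)
Lemma by_parts_repr a b u (m1 m2 : {finite_measure set TR -> \bar R}) : a < b ->
  mu.-integrable `]a, b[ (EFin \o u) ->
  (forall phi, test_function a b phi ->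
    \int[mu]_(x in `]a, b[) (u x * derive1 phi x) =
    - (\int[m1]_(x in `]a, b[) phi x - \int[m2]_(x in `]a, b[) phi x)) ->
  exists c, {ae mu, forall x, `]a, b[%classic x ->
    u x = c + fine (m1 `]-oo, x]%classic) - fine (m2 `]-oo, x]%classic)}.
Proof.
move=> ab iu uphi.
have mD : measurable (`]a, b[%classic : set R) by exact: measurable_itv.
pose U x := 0 + fine (m1 `]-oo, x]%classic) - fine (m2 `]-oo, x]%classic).
have mU : measurable_fun setT U.
  apply: measurable_funB; first apply: measurable_funD => //;
  apply: nondecreasing_measurable => // x y xy;
    rewrite fine_le ?fin_num_measure// le_measure ?inE//;
    by apply: subset_itvl; rewrite bnd_simp.
have UB x : `|U x| <= fine (m1 setT) + fine (m2 setT).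
  rewrite /U add0r; apply: (le_trans (ler_normB _ _)).
  by apply: lerD; rewrite ger0_norm ?fine_ge0// fine_le ?fin_num_measure// le_measure ?inE.
have mup : (mu `]a, b[%classic < +oo)%E.
  by rewrite lebesgue_measure_itv/=; case: ifP => //; rewrite ltry.
have iUD : mu.-integrable `]a, b[ (EFin \o U).
  apply: measurable_bounded_integrable => //; first exact: measurable_funTS.
  exists (fine (m1 setT) + fine (m2 setT)); split; first exact: num_real.
  by move=> M ltM x _ /=; rewrite (le_trans (UB x))// ltW.
have imul phi h : test_function a b phi -> mu.-integrable `]a, b[ (EFin \o h) ->
    mu.-integrable `]a, b[ (EFin \o (fun x => h x * derive1 phi x)).
  move=> tphi ih; have [B phiB] := test_function_derive_bounded ab tphi.
  have [iphi' phiE] := test_function_is_primitive ab tphi.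
  have mphi' : measurable_fun setT (derive1 phi) := integrableT_measurable iphi'.
  have := @integrableMT _ _ B (derive1 phi) _ mphi' phiB ((integrable_restrictT h mD).1 ih).
  move=> /(integrableT mD); apply: eq_integrable => // x xD /=.
  by rewrite restrict_id 1?mulrC//; exact: set_mem.
have [c cE] : exists c, {ae mu, forall x, `]a, b[%classic x -> ((fun x => u x - U x) \_ `]a, b[) x = c}.
  apply: du_bois_reymond => //.
    apply/(integrable_restrictT _ mD).
    exact: (integrable_sub mD iu iUD).
  move=> phi tphi.
  transitivity (\int[mu]_(x in `]a, b[) (u x * derive1 phi x - U x * derive1 phi x)).
    by apply: eq_Rintegral => x /set_mem xD; rewrite restrict_id// mulrBl.
  rewrite RintegralB//; [|exact: imul|exact: imul].
  rewrite uphi// (cumulative_by_parts ab (u := U) (r := 0) (m1 := m1) (m2 := m2)) ?subrr//.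
    exact: measurable_funTS.
  exact: aeW.
exists c; apply: ae_imply cE => x + xD => /(_ xD).
rewrite restrict_id// /U => h; rewrite -h; ring.
Qed.

Lemma charge_repr a b u (nu : {charge set TR -> \bar R}) : a < b ->
  mu.-integrable `]a, b[ (EFin \o u) -> is_distr_derivative a b u nu ->
  exists c, {ae mu, forall x, `]a, b[%classic x ->
    u x = c + fine (charge_pos nu `]-oo, x]%classic) - fine (charge_neg nu `]-oo, x]%classic)}.
Proof. by move=> ab iu [_ nuE]; apply: by_parts_repr. Qed.

Lemma weak_repr a b u g : a < b ->
  mu.-integrable `]a, b[ (EFin \o u) -> mu.-integrable `]a, b[ (EFin \o g) ->
  (forall phi, test_function a b phi ->
    \int[mu]_(x in `]a, b[) (u x * derive1 phi x) =
    - \int[mu]_(x in `]a, b[) (g x * phi x)) ->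
  exists c, {ae mu, forall x, `]a, b[%classic x ->
    u x = c + \int[mu]_(t in `]-oo, x]) (g \_ `]a, b[) t}.
Proof.
move=> ab iu ig uphi.
have mD : measurable (`]a, b[%classic : set R) by exact: measurable_itv.
have [m1 [m2 [mE _ mI]]] := density_split ((integrable_restrictT _ mD).1 ig).
have [c cE] : exists c, {ae mu, forall x, `]a, b[%classic x ->
    u x = c + fine (m1 `]-oo, x]%classic) - fine (m2 `]-oo, x]%classic)}.
  apply: by_parts_repr => // phi tphi; rewrite uphi//; congr (- _).
  have [B phiB] := test_function_bounded ab tphi.
  have mphi : measurable_fun setT phi.
    by apply: continuous_measurable_fun; exact: test_function_continuous tphi.
  rewrite (mI _ _ _ mD mphi phiB); apply: eq_Rintegral => x /set_mem xD.
  by rewrite restrict_id// mulrC.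
exists c; apply: ae_imply cE => x + xD => /(_ xD) ->; rewrite -addrA; congr (_ + _).
have m1f := @fin_num_measure _ _ _ m1 _ (measurable_itv `]-oo, x]).
have m2f := @fin_num_measure _ _ _ m2 _ (measurable_itv `]-oo, x]).
by rewrite -fineB// mE.
Qed.

Lemma weak_by_parts a b u g c phi : a < b ->
  measurable_fun `]a, b[ u -> mu.-integrable setT (EFin \o g) ->
  {ae mu, forall x, `]a, b[%classic x -> u x = c + \int[mu]_(t in `]-oo, x]) g t} ->
  test_function a b phi ->
    \int[mu]_(x in `]a, b[) (u x * derive1 phi x) =
    - \int[mu]_(x in `]a, b[) (g x * phi x).
Proof.
move=> ab mu_ ig uE tphi.
have mD : measurable (`]a, b[%classic : set R) by exact: measurable_itv.
have [m1 [m2 [mE _ mI]]] := density_split ig.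
have [B phiB] := test_function_bounded ab tphi.
have mphi : measurable_fun setT phi.
  by apply: continuous_measurable_fun; exact: test_function_continuous tphi.
rewrite (cumulative_by_parts ab (r := c) (m1 := m1) (m2 := m2) mu_ _ tphi).
  rewrite (mI _ _ _ mD mphi phiB); congr (- _); apply: eq_Rintegral => x _.
  by rewrite mulrC.
apply: ae_imply uE => x + xD => /(_ xD) ->; rewrite -addrA; congr (_ + _).
have m1f := @fin_num_measure _ _ _ m1 _ (measurable_itv `]-oo, x]).
have m2f := @fin_num_measure _ _ _ m2 _ (measurable_itv `]-oo, x]).
by rewrite -fineB// mE.
Qed.

Lemma ae_setD_countable (D : set R) (P : R -> Prop) (E : nat -> set R) :
  (forall n, {ae mu, forall x, E n x -> P x}) -> (forall x, D x -> exists n, E n x) ->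
  {ae mu, forall x, D x -> P x}.
Proof.
move=> h DE.
have : mu.-negligible (\bigcup_n ~` [set x | E n x -> P x]).
  by apply: negligible_bigcup => n; exact: h.
apply: negligibleS => x /= /not_implyP[Dx nP].
have [n nE] := DE _ Dx; exists n => //= h'; exact: nP (h' nE).
Qed.

(** Weak derivatives are only locally integrable in []a, b[], whereas testing against bumps uses
    integrability; hence the exhaustion by the intervals []a + 1/(n+1), b - 1/(n+1)[]. *)
Lemma is_weak_derivative_uniq a b u g1 g2 : a < b ->
  is_weak_derivative a b u g1 -> is_weak_derivative a b u g2 ->
  {ae mu, forall x, `]a, b[%classic x -> g1 x = g2 x}.
Proof.
move=> ab [lu [mg1 oD ig1] h1] [_ [mg2 _ ig2] h2].
pose E n := `]a + n.+1%:R^-1, b - n.+1%:R^-1[%classic : set R.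
apply: (@ae_setD_countable _ _ E); last first.
  move=> x /=; rewrite in_itv/= => /andP[ax xb].
  have [e1 e2] : 0 < x - a /\ 0 < b - x by rewrite !subr_gt0.
  near \oo => n; exists n; rewrite /E /= in_itv/=; apply/andP; split.
    rewrite -ltrBrDl; near: n; exact: near_invn.
  rewrite ltrBrDr -ltrBrDl; near: n; exact: near_invn.
move=> n.
have [lec|ltc] := leP (b - n.+1%:R^-1) (a + n.+1%:R^-1).
  by apply: aeW => x; rewrite /E /= in_itv/= => /andP[cx xd]; have := lt_trans cx xd; rewrite ltNge lec.
have i0 : 0 < n.+1%:R^-1 :> R by rewrite invr_gt0.
rewrite /E; set c := _ + _ in ltc *; set d := _ - _ in ltc *.
have ac : a < c by rewrite ltrDl.
have db : d < b by rewrite gtrBl.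
move: (c) (d) ac db ltc => {}c {}d ac db cd {E i0}.
have mE : measurable (`]c, d[%classic : set R) by exact: measurable_itv.
have iloc g : measurable_fun `]a, b[ g ->
    (forall K, K `<=` `]a, b[ -> compact K -> (\int[mu]_(x in K) `|g x|%:E < +oo)%E) ->
    mu.-integrable `]c, d[ (EFin \o g).
  move=> mg ig; apply: (@integrableS _ _ _ mu `[c, d]%classic) => //.
    by apply: subset_itvW.
  have sub : `[c, d]%classic `<=` (`]a, b[%classic : set R).
    by move=> x /=; rewrite !in_itv/= => /andP[cx xd]; apply/andP; split; lra.
  apply/integrableP; split.
    by apply/measurable_EFinP; apply: measurable_funS mg => //; exact: measurable_itv.
  exact: (ig _ sub (@segment_compact _ _ _)).
have i1 := iloc _ mg1 ig1; have i2 := iloc _ mg2 ig2.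
have key : {ae mu, forall x, `]c, d[%classic x -> ((fun x => g1 x - g2 x) \_ `]c, d[) x = 0}.
  apply: ae0_bump.
    apply/(integrable_restrictT _ mE).
    exact: (integrable_sub mE i1 i2).
  move=> x y k; have tphi := test_function_bump_oc c d x y k.
  set phi := bump_oc c d x y k in tphi *.
  have tphi' := test_functionS (ltW ac) (ltW db) tphi.
  have := h1 _ tphi'; rewrite h2// => /oppr_inj.
  have EE g : \int[mu]_(x in `]a, b[) (g x * phi x) = \int[mu]_(x in `]c, d[) (g x * phi x).
    rewrite [LHS]Rintegral_indicT [RHS]Rintegral_indicT; apply: eq_Rintegral => t _.
    have [tE|tE] := pselect (`]c, d[%classic t); last first.
      by rewrite (test_function_out tphi tE) mulr0 !mul0r.
    rewrite !(indic_bool (e := true)) ?mulr1//; split=> // _.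
    by move: tE; rewrite /= !in_itv/= => /andP[ct td]; apply/andP; split; lra.
  rewrite !EE => e12.
  have iM g : mu.-integrable `]c, d[ (EFin \o g) -> mu.-integrable `]c, d[ (EFin \o (fun x => g x * phi x)).
    move=> ig; have [B phiB] := test_function_bounded ab tphi'.
    have mphi : measurable_fun setT phi.
      by apply: continuous_measurable_fun; exact: test_function_continuous tphi.
    have := @integrableMT _ _ B phi _ mphi phiB ((integrable_restrictT g mE).1 ig).
    move=> /(integrableT mE); apply: eq_integrable => // t tD /=.
    by rewrite restrict_id 1?mulrC//; exact: set_mem.
  transitivity (\int[mu]_(x in `]c, d[) (g1 x * phi x - g2 x * phi x)).
    by apply: eq_Rintegral => t /set_mem tD; rewrite restrict_id// mulrC mulrBl.
  by rewrite RintegralB ?e12 ?subrr//; exact: iM.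
apply: ae_imply key => x + xE => /(_ xE); rewrite restrict_id// => /eqP.
by rewrite subr_eq0 => /eqP.
Unshelve. all: by end_near. Qed.

End representations.

(** * Sobolev functions as primitives, and the energy written through them *)

Section sobolev.
Context {R : realType}.
Local Notation TR := (measurableTypeR R).
Local Notation mu := (@lebesgue_measure R).
Implicit Types (a b p : R) (u f g psi : R -> R).

Lemma weak_derivativeP a b u g : is_weak_derivative a b u g ->
  is_weak_derivative a b u (weak_derivative a b u).
Proof. by move=> ug; apply: (@getPex _ [set g | is_weak_derivative a b u g]); exists g. Qed.

Lemma distr_derivativeP a b u (nu : {charge set TR -> \bar R}) :
  is_distr_derivative a b u nu -> is_distr_derivative a b u (distr_derivative a b u).
Proof.
move=> unu; rewrite /distr_derivative; case: xgetP => [nu' _ //|/(_ nu)].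
by case.
Qed.

Lemma bounded_on_itv f (a b : R) : continuous f ->
  exists2 B : R, 0 < B & forall x, a <= x <= b -> `|f x| <= B.
Proof.
move=> cf.
have [|B [Br HB]] := @compact_bounded _ R^o (f @` `[a, b]%classic).
  apply: continuous_compact; last exact: segment_compact.
  exact: continuous_subspaceT.
exists (Num.max B 0 + 1); first by rewrite ltr_wpDl// le_max lexx orbT.
move=> x xab; apply: HB.
  by rewrite (@le_lt_trans _ _ (Num.max B 0))// ?ltrDl// le_max lexx.
by exists x => //=; rewrite in_itv.
Qed.

Lemma is_primitiveE v g x y : is_primitive v g -> x <= y ->
  \int[mu]_(t in `]x, y]) g t = v y - v x.
Proof.
move=> [_ vE]; rewrite le_eqVlt => /predU1P[->|]; last exact: vE.
by rewrite subrr set_itvoc0 Rintegral_set0.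
Qed.

Lemma measurable_normp (D : set R) f p : measurable D -> measurable_fun D f ->
  measurable_fun D (fun x => `|f x| `^ p).
Proof.
by move=> mD mf; apply: (measurableT_comp (measurable_powR _)); exact: measurableT_comp.
Qed.

Lemma eq_integral_lty (D : set R) (f1 f2 : R -> \bar R) : (forall x, D x -> f1 x = f2 x) ->
  (\int[mu]_(x in D) f2 x < +oo)%E -> (\int[mu]_(x in D) f1 x < +oo)%E.
Proof.
by move=> f12; rewrite (@eq_integral _ _ _ mu D f1)// => x /set_mem /f12.
Qed.

Lemma bounded_Lp a b p u (B : R) : 0 <= p -> measurable_fun `]a, b[ u ->
  {ae mu, forall x, `]a, b[%classic x -> `|u x| <= B} ->
  (\int[mu]_(x in `]a, b[) (`|u x| `^ p)%:E < +oo)%E.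
Proof.
move=> p0 mu_ uB.
have mD : measurable (`]a, b[%classic : set R) by exact: measurable_itv.
apply: (@le_lt_trans _ _ (\int[mu]_(x in `]a, b[) (`|B| `^ p)%:E)%E).
  apply: ae_ge0_le_integral => //.
    by apply/measurable_EFinP; exact: measurable_normp.
  apply: ae_imply uB => x + xD => /(_ xD) h; rewrite lee_fin.
  by rewrite ge0_ler_powR ?nnegrE// (le_trans h)// ler_norm.
have muD : (mu `]a, b[%classic < +oo)%E.
  by rewrite lebesgue_measure_itv/=; case: ifP => //; rewrite ltry.
by rewrite integral_cst// lte_mul_pinfty ?lee_fin ?powR_ge0.
Qed.

(** The weak derivative is a choice, known only up to null sets; later arguments use the continuous
    representative [f] and a density [g] extended by 0. *)
Lemma W1p_repr a b p u : a < b -> 1 <= p -> W1p_space a b p u ->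
  exists f g, [/\ is_primitive f g,
    {ae mu, forall x, `]a, b[%classic x -> u x = f x},
    {ae mu, forall x, `]a, b[%classic x -> weak_derivative a b u x = g x},
    (\int[mu]_(x in `]a, b[) (`|g x| `^ p)%:E < +oo)%E &
    forall x, ~ `]a, b[%classic x -> g x = 0].
Proof.
move=> ab p1 [Lu [g Lg ug]].
have mD : measurable (`]a, b[%classic : set R) by exact: measurable_itv.
have iu := Lp_space_integrable p1 Lu; have ig := Lp_space_integrable p1 Lg.
have [_ _ ibp] := ug.
have [c cE] := weak_repr ab iu ig ibp.
exists (fun x => c + \int[mu]_(t in `]-oo, x]) (g \_ `]a, b[) t), (g \_ `]a, b[).
split => //.
- have [igD gE] := integrable_primitive ((integrable_restrictT g mD).1 ig).
  by split=> // x y xy; rewrite gE//; ring.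
- apply: ae_imply (is_weak_derivative_uniq ab (weak_derivativeP ug) ug) => x + xD => /(_ xD) ->.
  by rewrite restrict_id.
- have [_ h] := (Lp_spaceP a b g p1).1 Lg.
  by apply: eq_integral_lty h => x xD; rewrite restrict_id.
- by move=> x xD; rewrite restrict_out.
Qed.

Lemma W1p_intro a b p u f g : a < b -> 1 <= p -> measurable_fun `]a, b[ u ->
  is_primitive f g -> {ae mu, forall x, `]a, b[%classic x -> u x = f x} ->
  measurable_fun `]a, b[ g ->
  (\int[mu]_(x in `]a, b[) (`|g x| `^ p)%:E < +oo)%E ->
  W1p_space a b p u /\
  {ae mu, forall x, `]a, b[%classic x -> weak_derivative a b u x = g x}.
Proof.
move=> ab p1 mu_ fg uf mg gp.
have p0 : 0 <= p by rewrite (le_trans _ p1).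
have mD : measurable (`]a, b[%classic : set R) by exact: measurable_itv.
have cf := is_primitive_continuous fg.
have [B B0 fB] := bounded_on_itv a b cf.
have Lu : Lp_space a b p u.
  apply/(Lp_spaceP _ _ _ p1); split; first exact/(measurable_restrictT _ mD).
  apply: (@bounded_Lp _ _ _ _ B) => //.
  apply: ae_imply uf => x + xD => /(_ xD) ->; apply: fB.
  by move: xD; rewrite /= in_itv/= => /andP[/ltW -> /ltW ->].
have Lg : Lp_space a b p g.
  by apply/(Lp_spaceP _ _ _ p1); split => //; exact/(measurable_restrictT _ mD).
have ug : is_weak_derivative a b u g.
  split.
  - by apply: open_integrable_locally; [exact: interval_open|exact: Lp_space_integrable Lu].
  - by apply: open_integrable_locally; [exact: interval_open|exact: Lp_space_integrable Lg].
  move=> phi tphi.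
  have [ig fE] := fg.
  apply: (@weak_by_parts _ _ _ _ _ (f a - \int[mu]_(t in `]-oo, a]) g t)) => //.
  apply: ae_imply uf => x + xD => /(_ xD) ->.
  have ax : a < x by move: xD; rewrite /= in_itv/= => /andP[].
  by have [_ /(_ _ _ ax)] := integrable_primitive ig; rewrite fE// => h; lra.
split; first by split=> //; exists g.
exact: is_weak_derivative_uniq (weak_derivativeP ug) ug.
Qed.

Lemma F_functional_integralE a b p psi u f g : a < b -> measurable_fun setT psi ->
  measurable_fun `]a, b[ f -> measurable_fun `]a, b[ g ->
  u \in W2p_space a b p ->
  {ae mu, forall x, `]a, b[%classic x -> weak_derivative a b u x = f x} ->
  {ae mu, forall x, `]a, b[%classic x ->
    weak_derivative a b (weak_derivative a b u) x = g x} ->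
  F_functional a b p psi u = (\int[mu]_(x in `]a, b[) `|f x|%:E +
    \int[mu]_(x in `]a, b[) (psi (f x) * `|g x| `^ p)%:E)%E.
Proof.
move=> ab mpsi mf mg uW uf ug.
have mD : measurable (`]a, b[%classic : set R) by exact: measurable_itv.
rewrite /F_functional /= uW.
have [[_ [d _ ud]] [_ [d2 _ ud2]]] := set_mem uW.
have [_ [mw _ _] _] := weak_derivativeP ud.
have [_ [mw2 _ _] _] := weak_derivativeP ud2.
congr (_ + _)%E; apply: ae_eq_integral => //.
- by apply/measurable_EFinP; exact: measurableT_comp.
- by apply/measurable_EFinP; exact: measurableT_comp.
- by apply: ae_imply uf => x + xD => /(_ xD) ->.
- by apply/measurable_EFinP; apply: measurable_funM; [exact: measurableT_comp|exact: measurable_normp].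
- by apply/measurable_EFinP; apply: measurable_funM; [exact: measurableT_comp|exact: measurable_normp].
- by apply: ae_imply2 uf ug => x + + xD => /(_ xD) -> /(_ xD) ->.
Qed.

Lemma F_functional_repr a b p psi u : a < b -> 1 <= p -> measurable_fun setT psi ->
  (F_functional a b p psi u < +oo)%E ->
  exists c f g, [/\ is_primitive f g,
    {ae mu, forall x, `]a, b[%classic x -> u x = c + \int[mu]_(t in `]a, x]) f t},
    forall x, ~ `]a, b[%classic x -> g x = 0 &
    F_functional a b p psi u = (\int[mu]_(x in `]a, b[) `|f x|%:E +
    \int[mu]_(x in `]a, b[) (psi (f x) * `|g x| `^ p)%:E)%E].
Proof.
move=> ab p1 mpsi Fu.
have uW : u \in W2p_space a b p.
  by move: Fu; rewrite /F_functional; case: ifP => //; rewrite ltxx.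
have [W1 W2] := set_mem uW.
have [U [g1 [Ug1 uU ug1 _ _]]] := W1p_repr ab p1 W1.
have [f [g [fg uf ug _ g0]]] := W1p_repr ab p1 W2.
exists (U a), f, g; split => //.
- apply: ae_imply uU => x + xD => /(_ xD) ->.
  have ax : a < x by move: xD; rewrite /= in_itv/= => /andP[].
  rewrite (_ : \int[mu]_(t in _) _ = \int[mu]_(t in `]a, x]) g1 t).
    by rewrite (is_primitiveE Ug1 (ltW ax)); ring.
  have mI : measurable (`]a, x]%classic : set R) by exact: measurable_itv.
  rewrite /Rintegral; congr fine; apply: ae_eq_integral => //.
  + by apply/measurable_EFinP; apply: measurable_funTS; exact: is_primitive_measurable fg.
  + by apply/measurable_EFinP; exact: integrableT_measurable (proj1 Ug1).
  + apply: ae_imply2 uf ug1 => y + + yx.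
    have yD : `]a, b[%classic y.
      move: xD yx; rewrite /= !in_itv/= => /andP[_ xb] /andP[ay yx].
      by rewrite ay (le_lt_trans yx).
    by move=> /(_ yD) -> /(_ yD) ->.
- apply: F_functional_integralE => //.
  + by apply: measurable_funTS; exact: is_primitive_measurable fg.
  + exact: integrableT_measurable (proj1 fg).
Qed.

Lemma F_functional_intro a b p psi u f g c : a < b -> 1 <= p -> measurable_fun setT psi ->
  is_primitive f g -> (\int[mu]_(x in `]a, b[) (`|g x| `^ p)%:E < +oo)%E ->
  (forall x, `]a, b[%classic x -> u x = c + \int[mu]_(t in `]a, x]) f t) ->
  Lp_space a b 1 u /\
  F_functional a b p psi u = (\int[mu]_(x in `]a, b[) `|f x|%:E +
    \int[mu]_(x in `]a, b[) (psi (f x) * `|g x| `^ p)%:E)%E.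
Proof.
move=> ab p1 mpsi fg gp uE.
have mD : measurable (`]a, b[%classic : set R) by exact: measurable_itv.
have mf : measurable_fun setT f := is_primitive_measurable fg.
have mfD : measurable_fun `]a, b[ f := measurable_funTS mf.
have mg : measurable_fun setT g := integrableT_measurable (proj1 fg).
have mgD : measurable_fun `]a, b[ g := measurable_funTS mg.
have p0 : 0 <= p by rewrite (le_trans _ p1).
have [B B0 fB] := bounded_on_itv a b (is_primitive_continuous fg).
have fBD x : `]a, b[%classic x -> `|f x| <= B.
  by move=> xD; apply: fB; move: xD; rewrite /= in_itv/= => /andP[/ltW -> /ltW ->].
have Lf q : 1 <= q -> Lp_space a b q f.
  move=> q1; apply/(Lp_spaceP _ _ _ q1); split; first exact/(measurable_restrictT _ mD).
  apply: (@bounded_Lp _ _ _ _ B) => //; first by rewrite (le_trans _ q1).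
  exact: aeW.
have ifD := (integrable_restrictT f mD).1 (Lp_space_integrable p1 (Lf _ p1)).
have [_ UE] := integrable_primitive ifD.
pose U x := c + (\int[mu]_(t in `]-oo, x]) (f \_ `]a, b[) t - \int[mu]_(t in `]-oo, a]) (f \_ `]a, b[) t).
have UP : is_primitive U (f \_ `]a, b[).
  by split => // x y xy; rewrite UE// /U; ring.
have uU x : `]a, b[%classic x -> u x = U x.
  move=> xD; rewrite uE// /U; congr (_ + _).
  move: (xD); rewrite /= in_itv/= => /andP[ax xb].
  rewrite -UE//; apply: eq_Rintegral => t /set_mem tx; rewrite restrict_id//.
  by move: tx; rewrite /= !in_itv/= => /andP[-> /le_lt_trans ->].
have mu_ : measurable_fun `]a, b[ u.
  apply: (eq_measurable_fun U); first by move=> x /set_mem xD; rewrite uU.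
  by apply: measurable_funTS; exact: is_primitive_measurable UP.
(* Used with [q = p] for the Sobolev space and with [q = 1] for membership in [L^1]. *)
have intro q : 1 <= q -> W1p_space a b q u /\
    {ae mu, forall x, `]a, b[%classic x -> weak_derivative a b u x = (f \_ `]a, b[) x}.
  move=> q1; apply: (W1p_intro ab q1 mu_ UP); first exact: aeW.
    by apply: measurable_funTS; exact/(measurable_restrictT _ mD).
  have [_ h] := (Lp_spaceP a b f q1).1 (Lf _ q1).
  by apply: eq_integral_lty h => x xD; rewrite restrict_id.
have [W1 wf] := intro _ p1.
have wf' : {ae mu, forall x, `]a, b[%classic x -> weak_derivative a b u x = f x}.
  by apply: ae_imply wf => x + xD => /(_ xD) ->; rewrite restrict_id.
have mw : measurable_fun `]a, b[ (weak_derivative a b u).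
  by have [_ [d _ ud]] := W1; have [_ [] ] := weak_derivativeP ud.
have [W2 wg] := W1p_intro ab p1 mw fg wf' mgD gp.
split; first by have [[]] := intro _ (lexx 1).
by apply: F_functional_integralE => //; rewrite inE.
Qed.

End sobolev.

(** * Lebesgue decomposition of charges *)

Section lebesgue_decomposition.
Context {R : realType}.
Local Notation TR := (measurableTypeR R).
Local Notation mu := (@lebesgue_measure R).
Implicit Types (nu s : {charge set TR -> \bar R}) (w : R -> R).
Implicit Types (m n k : {finite_measure set TR -> \bar R}).

(** Minimality of the Jordan decomposition: the positive part of [s] is [s] restricted to the
    positive Hahn set, where it is at most [m]; likewise for the negative part and [n]. *)
Lemma charge_posneg_le s m n :
  (forall A : set R, measurable A -> s A = (m A - n A)%E) ->
  forall A : set R, measurable A -> (charge_pos s A <= m A)%E /\ (charge_neg s A <= n A)%E.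
Proof.
move=> sE A mA; rewrite /charge_pos /charge_neg.
move: (projT1 (cid (Hahn_decomposition s))) (projT1 (cid (projT2 (cid (Hahn_decomposition s))))) (hahn_proof s) => P N sPN.
have [[mP _] [mN _] _ _] := sPN.
have pE : jordan_pos sPN A = s (A `&` P).
  by have := jordan_posE sPN A; rewrite cjordan_posE /crestr0 mem_set.
have nE : jordan_neg sPN A = (- s (A `&` N))%E.
  by have := jordan_negE sPN A; rewrite cjordan_negE /crestr0 mem_set.
suff : (s (A `&` P) <= m A)%E /\ (- s (A `&` N) <= n A)%E.
  by rewrite -pE -nE => -[h1 h2]; split; [exact: h1|exact: h2].
have mAP : measurable (A `&` P) by exact: measurableI.
have mAN : measurable (A `&` N) by exact: measurableI.
rewrite !sE// fin_num_oppeB ?fin_num_measure//; split.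
  apply: (@le_trans _ _ (m (A `&` P))); first by rewrite leeBlDr ?fin_num_measure// leeDl.
  by rewrite le_measure ?inE//; exact: subIsetl.
apply: (@le_trans _ _ (n (A `&` N))).
  by rewrite addeC leeBlDr ?fin_num_measure// leeDl.
by rewrite le_measure ?inE//; exact: subIsetl.
Qed.

Lemma tot_varE nu A : tot_var nu A = (charge_pos nu A + charge_neg nu A)%E.
Proof. by []. Qed.

Lemma tot_var_le nu m n :
  (forall A : set R, measurable A -> nu A = (m A - n A)%E) ->
  forall A : set R, measurable A -> (tot_var nu A <= m A + n A)%E.
Proof.
by move=> h A mA; rewrite tot_varE; have [h1 h2] := charge_posneg_le h mA; exact: leeD.
Qed.

(** [N] is a null set of maximal mass for [k], obtained as a countable union of nearly maximal ones.
    By maximality [k] gives no mass to null sets outside it, so the rest of [k] has a density. *)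
Lemma lebesgue_decomp_measure k : exists N : set R, exists h : R -> R,
  [/\ measurable N, mu N = 0%E, mu.-integrable setT (EFin \o h) &
    forall A : set R, measurable A -> k A = ((\int[mu]_(x in A) h x)%:E + k (A `&` N))%E].
Proof.
pose E := [set fine (k N) | N in [set N : set R | measurable N /\ mu N = 0%E]].
have supE : has_sup E.
  split; first by exists (fine (k set0)), set0 => //; split => //; exact: measure0.
  exists (fine (k setT)) => _ [N [mN _] <-].
  by rewrite fine_le ?fin_num_measure// le_measure ?inE.
have /choice[N HN] : forall i : nat, exists N : set R,
    (measurable N /\ mu N = 0%E) /\ sup E - i.+1%:R^-1 < fine (k N).
  move=> i; have i0 : 0 < i.+1%:R^-1 :> R by rewrite invr_gt0.
  by have [_ [N HN <-] lt] := sup_adherent i0 supE; exists N.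
pose NN := \bigcup_i N i : set R.
have mNN : measurable NN by apply: bigcup_measurable => i _; have [[]] := HN i.
have muNN : mu NN = 0%E.
  apply: measure_negligible => //; apply: negligible_bigcup => i.
  by have [[mNi Ni0] _] := HN i; exists (N i); split => //; exact: Ni0.
have supNN : sup E <= fine (k NN).
  apply/ler_addgt0Pr => e e0.
  have [i lti] : exists i : nat, i.+1%:R^-1 < e.
    by have [i _ /(_ i (leqnn _)) h] := near_invn e0; exists i.
  have [[mNi Ni0] lt] := HN i.
  have : fine (k (N i)) <= fine (k NN).
    by rewrite fine_le ?fin_num_measure// le_measure ?inE//; exact: bigcup_sup.
  move: lti lt; move: (i.+1%:R^-1) => t; lra.
have [k' k'E] := restr_finite k (measurableC mNN).
have k'0 (A : set R) : measurable A -> mu A = 0%E -> k' A = 0%E.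
  move=> mA muA; rewrite k'E//.
  have mU : measurable (NN `|` A) by exact: measurableU.
  have muU : mu (NN `|` A) = 0%E by rewrite measureU0.
  have : fine (k (NN `|` A)) <= fine (k NN).
    apply: le_trans supNN; apply: (sup_ubound supE.2); by exists (NN `|` A).
  have -> : NN `|` A = NN `|` (A `&` ~` NN) by rewrite setUIr setUCr setIT.
  have mD : measurable (A `&` ~` NN) by apply: measurableI => //; exact: measurableC.
  rewrite measureU//; last by rewrite setICA setICr setI0.
  rewrite fineD ?fin_num_measure// gerDl => h.
  apply/eqP; rewrite eq_le measure_ge0 andbT -(fineK (fin_num_measure k _ mD)) lee_fin.
  exact: h.
have incr x y : x < y -> `|fine (k' `]-oo, y]%classic) - fine (k' `]-oo, x]%classic)|
    = fine (k' `]x, y]%classic).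
  by move=> xy; rewrite -(finite_measure_oc k' (ltW xy)) ger0_norm// fine_ge0.
have [||h ih hE] := @absolutely_continuous_density R (fun x => fine (k' `]-oo, x]%classic)) k'.
- by move=> x y xy; rewrite incr.
- move=> A e mA muA e0; exists k'; split; first by move=> x y xy; rewrite incr.
  by rewrite k'0// lee_fin ltW.
exists NN, h; split => // A mA.
have [m1 [m2 [mE _ _]]] := density_split ih.
have mz : measurable (set0 : set R) by exact: measurable0.
(* The zero measure, which turns an identity between three measures into one between two sums of
   two. *)
have [z zE] := restr_finite k mz.
have z0 (B : set R) : measurable B -> z B = 0%E by move=> mB; rewrite zE// setI0 measure0.
have key : (m1 A + z A = m2 A + k' A)%E.
  apply: eq_add_measure_oc => // x y xy.
  have mI := measurable_itv `]x, y] : measurable (`]x, y]%classic : set R).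
  have e1 : (m1 `]x, y]%classic - m2 `]x, y]%classic = k' `]x, y]%classic)%E.
    rewrite mE// (EFin_Rintegral mI ih) hE// -(finite_measure_oc k' (ltW xy)).
    by rewrite fineK ?fin_num_measure.
  by rewrite z0// adde0 -e1 addeC subeK ?fin_num_measure.
have kA : k A = (k' A + k (A `&` NN))%E.
  rewrite k'E// -measureU//; first by rewrite -setIUr setUC setUv setIT.
  - exact: measurableI (measurableC _).
  - exact: measurableI.
  - by rewrite setIACA setIid setICl setI0.
rewrite -mE// -[m1 A]adde0 -(z0 A mA) key {1}kA; congr (_ + _)%E.
by rewrite addeAC subee ?add0e ?fin_num_measure.
Qed.

Lemma tot_var_null s (S A : set R) : measurable S -> tot_var s (~` S) = 0%E ->
  measurable A -> charge_pos s A = charge_pos s (A `&` S) /\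
    charge_neg s A = charge_neg s (A `&` S).
Proof.
move=> mS; rewrite tot_varE => s0 mA.
have mCS : measurable (~` S) by exact: measurableC.
have split_ k : k (~` S) = 0%E -> k A = k (A `&` S).
  move=> k0; rewrite -[X in k X = _](setIT A) -(setUv S) setIUr measureU//.
  - rewrite [X in (_ + X)%E](_ : _ = 0%E) ?adde0//.
    apply/eqP; rewrite eq_le measure_ge0 andbT -[leRHS]k0.
    by rewrite le_measure ?inE//; exact: measurableI.
  - exact: measurableI.
  - exact: measurableI.
  - by rewrite setIACA setIid setICr setI0.
have [p0 n0] : charge_pos s (~` S) = 0%E /\ charge_neg s (~` S) = 0%E.
  by move/eqP: s0; rewrite padde_eq0 ?measure_ge0// => /andP[/eqP -> /eqP ->].
by split; exact: split_.
Qed.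

Lemma tot_var_nullE s (S A : set R) : measurable S -> tot_var s (~` S) = 0%E ->
  measurable A -> s A = s (A `&` S).
Proof.
move=> mS s0 mA; have [pE nE] := tot_var_null mS s0 mA.
by rewrite charge_split// pE nE -charge_split//; exact: measurableI.
Qed.

Lemma null_Rintegral (A S : set R) w : measurable A -> measurable S -> mu S = 0%E ->
  mu.-integrable setT (EFin \o w) ->
  \int[mu]_(x in A) w x = \int[mu]_(x in A `&` ~` S) w x /\
  \int[mu]_(x in A `&` S) w x = 0.
Proof.
move=> mA mS S0 iw; split; last first.
  rewrite /Rintegral (_ : integral _ _ _ = 0%E)//; apply: null_set_integral.
  - exact: measurableI.
  - apply/measurable_EFinP; exact: integrableT_measurable iw.
  - by apply: subset_measure0 S0 => //; exact: measurableI.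
rewrite /Rintegral; congr fine; rewrite -setDE; apply: negligible_integral => //.
exact: integrableT.
Qed.

Lemma lebesgue_decomp_exists nu : exists w s, lebesgue_decomp mu nu w s.
Proof.
have [N1 [h1 [mN1 N10 ih1 kE1]]] := lebesgue_decomp_measure (charge_pos nu).
have [N2 [h2 [mN2 N20 ih2 kE2]]] := lebesgue_decomp_measure (charge_neg nu).
have [k1 k1E] := restr_finite (charge_pos nu) mN1.
have [k2 k2E] := restr_finite (charge_neg nu) mN2.
have [s sE] := cadd_sub k1 k2.
exists (fun x => h1 x - h2 x), s; split.
- exact: integrableBT.
- exists (N1 `|` N2); split.
  + exact: measurableU.
  + by rewrite measureU0.
  + have mC : measurable (~` (N1 `|` N2)) by apply: measurableC; exact: measurableU.
    apply/eqP; rewrite eq_le adde_ge0 ?measure_ge0// andbT.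
    apply: le_trans (tot_var_le sE mC) _.
    rewrite k1E// k2E// setCU -setIA (setIC (~` N2)) setIA setICl set0I.
    by rewrite -setIA setICl setI0 !measure0 adde0.
- move=> A mA; rewrite charge_split// kE1// kE2// sE// k1E// k2E//.
  rewrite -(EFin_Rintegral mA (integrableBT ih1 ih2)).
  rewrite RintegralB//; [|exact: integrableT|exact: integrableT].
  rewrite EFinB fin_num_oppeD ?fin_num_measure//; last exact: measurableI.
  by rewrite addeACA.
Qed.

Lemma lebesgue_decomp_singular nu w s : lebesgue_decomp mu nu w s ->
  exists S : set R, [/\ measurable S, mu S = 0%E, tot_var s (~` S) = 0%E &
    forall A : set R, measurable A -> s A = nu (A `&` S) /\
      (\int[mu]_(x in A) w x)%:E = nu (A `&` ~` S)].
Proof.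
move=> [iw [S [mS S0 sS]] nuE]; exists S; split => // A mA.
have mAS : measurable (A `&` S) by exact: measurableI.
have mAC : measurable (A `&` ~` S) by apply: measurableI => //; exact: measurableC.
have [wE w0] := null_Rintegral mA mS S0 iw.
rewrite !nuE// -!EFin_Rintegral// w0 add0e wE; split; first exact: tot_var_nullE sS mA.
rewrite (tot_var_nullE mS sS mAC) -setIA setICl setI0 charge0 adde0 //.
Qed.

Lemma lebesgue_decomp_uniq nu w1 s1 w2 s2 :
  lebesgue_decomp mu nu w1 s1 -> lebesgue_decomp mu nu w2 s2 ->
  {ae mu, forall x, w1 x = w2 x} /\ forall A : set R, measurable A -> s1 A = s2 A.
Proof.
move=> d1 d2; have [S1 [mS1 S10 s1S _]] := lebesgue_decomp_singular d1.
have [S2 [mS2 S20 s2S _]] := lebesgue_decomp_singular d2.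
move: d1 d2 => [iw1 _ nuE1] [iw2 _ nuE2].
(* A null set that carries both singular parts: the densities contribute nothing on it, so the
   singular parts are identified first. *)
pose S := S1 `|` S2.
have mS : measurable S by exact: measurableU.
have S0 : mu S = 0%E by rewrite measureU0.
have sub s (S' : set R) : measurable S' -> tot_var s (~` S') = 0%E -> S' `<=` S -> tot_var s (~` S) = 0%E.
  move=> mS' h sub; apply/eqP; rewrite eq_le adde_ge0 ?measure_ge0// andbT -[leRHS]h.
  by apply: leeD; rewrite le_measure ?inE//; try exact: measurableC; exact: subsetC.
have s1S' := sub _ _ mS1 s1S (@subsetUl _ _ _).
have s2S' := sub _ _ mS2 s2S (@subsetUr _ _ _).
have sE A : measurable A -> s1 A = s2 A.
  move=> mA; rewrite (tot_var_nullE mS s1S' mA) (tot_var_nullE mS s2S' mA).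
  have mAS : measurable (A `&` S) by exact: measurableI.
  have := nuE1 _ mAS; rewrite nuE2// -!EFin_Rintegral//.
  have [_ ->] := null_Rintegral mA mS S0 iw1.
  by have [_ ->] := null_Rintegral mA mS S0 iw2; rewrite !add0e.
split=> //.
have wE A : measurable A -> \int[mu]_(x in A) w1 x = \int[mu]_(x in A) w2 x.
  move=> mA; have := nuE1 _ mA; rewrite nuE2// sE// -!EFin_Rintegral//.
  by rewrite -(fineK (fin_num_measure s2 _ mA)) => -[] /addIr.
have h1 := ae_le_Rintegral iw1 iw2; have h2 := ae_le_Rintegral iw2 iw1.
apply: ae_imply2 (h1 _) (h2 _) => [x a1 a2|A mA|A mA].
- by apply/eqP; rewrite eq_le a1 a2.
- by rewrite wE.
- by rewrite wE.
Qed.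

Lemma ac_sing_decomp nu : lebesgue_decomp mu nu (ac_density mu nu) (sing_part mu nu).
Proof.
have [w [s ws]] := lebesgue_decomp_exists nu.
have [s' d1] : exists s, lebesgue_decomp mu nu (ac_density mu nu) s.
  by apply: (@getPex _ [set w | exists s, lebesgue_decomp mu nu w s]); exists w, s.
have [w' d2] : exists w, lebesgue_decomp mu nu w (sing_part mu nu).
  by rewrite /sing_part; case: xgetP => [? //|/(_ s)]; case; exists w.
have [_ sE] := lebesgue_decomp_uniq d1 d2.
have [i1 _ nuE] := d1; have [_ sing _] := d2.
by split=> // A mA; rewrite nuE// sE.
Qed.

(** Cut [nu] by the null set [S] carrying [s]. On [S] the bound is minimality of the Jordan parts of
    [s]; off [S] the integral of [|w|] is split by the sign of [w], and each half is bounded by one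
    Jordan part of [nu]. *)
Lemma tot_var_decomp nu w s (A : set R) : lebesgue_decomp mu nu w s -> measurable A ->
  ((\int[mu]_(x in A) `|w x|)%:E + tot_var s A <= tot_var nu A)%E.
Proof.
move=> d mA; have [S [mS S0 sS sE]] := lebesgue_decomp_singular d.
have [iw _ _] := d.
have mCS : measurable (~` S) by exact: measurableC.
have [m1 m1E] := restr_finite (charge_pos nu) mS.
have [m2 m2E] := restr_finite (charge_neg nu) mS.
have [n1 n1E] := restr_finite (charge_pos nu) mCS.
have [n2 n2E] := restr_finite (charge_neg nu) mCS.
have dec k : k A = (k (A `&` ~` S) + k (A `&` S))%E.
  rewrite -measureU//; first by rewrite -setIUr setUC setUv setIT.
  - exact: measurableI.
  - exact: measurableI.
  - by rewrite setIACA setIid setICl setI0.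
rewrite (tot_varE nu) dec (dec (charge_neg nu)) addeACA; apply: leeD; last first.
  rewrite -m1E// -m2E//; apply: tot_var_le => // B mB.
  rewrite (sE _ mB).1 charge_split ?m1E ?m2E//; exact: measurableI.
rewrite -n1E// -n2E//.
pose P := [set x | 0 < w x].
have mw : measurable_fun setT w := integrableT_measurable iw.
have mP : measurable P by apply: measurable_lt_set => //; exact: measurable_cst.
have iaw := integrable_normT iw.
have wB (B : set R) : measurable B -> (\int[mu]_(x in B) w x)%:E = (n1 B - n2 B)%E.
  move=> mB; rewrite (sE _ mB).2 charge_split ?n1E ?n2E//; exact: measurableI.
have mAP : measurable (A `&` P) by exact: measurableI.
have mAC : measurable (A `&` ~` P) by apply: measurableI => //; exact: measurableC.
have dec' : \int[mu]_(x in A) `|w x| = \int[mu]_(x in A `&` P) w x - \int[mu]_(x in A `&` ~` P) w x.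
  rewrite -[X in \int[mu]_(x in X) `|w x|](setIT A) -(setUv P) setIUr Rintegral_setU//.
  - congr (_ + _); first by apply: eq_Rintegral => x /set_mem [_ Px]; rewrite gtr0_norm.
    transitivity (\int[mu]_(x in A `&` ~` P) (- 1 * w x)).
      apply: eq_Rintegral => x /set_mem [_ Px]; rewrite mulN1r ler0_norm//.
      by rewrite leNgt; exact/negP.
    by rewrite RintegralZl ?mulN1r//; exact: integrableT.
  - by apply: integrableT => //; exact: measurableU.
  - by apply/disj_set2P; rewrite setIACA setIid setICr setI0.
rewrite dec' EFinB !wB// fin_num_oppeB ?fin_num_measure//.
have n12 (k k' : {finite_measure set TR -> \bar R}) (B : set R) : measurable B -> (k B - k' B <= k B)%E.
  by move=> mB; rewrite leeBlDr ?fin_num_measure// leeDl.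
apply: (@le_trans _ _ ((n1 (A `&` P) + n2 (A `&` ~` P)))%E).
  by apply: leeD; [exact: n12|rewrite addeC; exact: n12].
by apply: leeD; rewrite le_measure ?inE//; exact: subIsetl.
Qed.
End lebesgue_decomposition.

(** * The function Psi *)

Section clamp_function.
Context {R : realType}.
Local Notation TR := (measurableTypeR R).
Local Notation mu := (@lebesgue_measure R).

Definition clamp (l h t : R) : R := Num.max l (Num.min t h).

Lemma clamp_in l h t : l <= h -> l <= clamp l h t <= h.
Proof. by move=> lh; rewrite /clamp le_max lexx /= ge_max lh ge_min lexx orbT. Qed.

Lemma clamp_id l h t : l <= t <= h -> clamp l h t = t.
Proof. by move=> /andP[lt th]; rewrite /clamp (min_idPl th) (max_idPr lt). Qed.

Lemma clamp_hi l h t : l <= h -> h <= t -> clamp l h t = h.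
Proof. by move=> lh ht; rewrite /clamp (min_idPr ht) (max_idPr lh). Qed.

Lemma clamp_lo l h t : l <= h -> t <= l -> clamp l h t = l.
Proof. by move=> lh tl; rewrite /clamp (min_idPl (le_trans tl lh)) (max_idPl tl). Qed.

Lemma clamp_lipschitz l h s t : l <= h -> `|clamp l h s - clamp l h t| <= `|s - t|.
Proof.
move=> lh; wlog st : s t / s <= t.
  move=> hw; have [|/ltW] := leP s t; first exact: hw.
  by move/hw; rewrite distrC [leRHS]distrC.
rewrite !(distrC _ t) (distrC _ (clamp l h t)).
have mono : clamp l h s <= clamp l h t.
  by rewrite /clamp ge_max !le_max lexx /= (le_min2 st (lexx _)) orbT.
rewrite !ger0_norm ?subr_ge0//.
have [sl|ls] := leP s l.
  have [tl|lt] := leP t l; first by rewrite !clamp_lo ?subrr ?subr_ge0.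
  rewrite (clamp_lo lh sl); have [th|ht] := leP t h.
    by rewrite clamp_id ?(ltW lt)//; lra.
  by rewrite clamp_hi ?(ltW ht)//; lra.
have [hs|sh] := leP h s.
  by rewrite !clamp_hi ?subrr ?subr_ge0// (le_trans hs).
rewrite (@clamp_id _ _ s) ?(ltW ls) ?(ltW sh)//; have [th|ht] := leP t h.
  by rewrite clamp_id ?th ?andbT// (le_trans (ltW ls)).
by rewrite clamp_hi ?(ltW ht)//; lra.
Qed.

(** [W] inverts [P] on [[- h, h]] and is constant beyond; the lower bound [m] on the slope of [P]
    makes it Lipschitz. *)
Lemma clamp_inverse (P : R -> R) (h m : R) : continuous P ->
  {homo P : x y / x < y} -> 0 < h -> 0 < m ->
  (forall s t, - h <= s -> s <= t -> t <= h -> m * (t - s) <= P t - P s) ->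
  exists W : R -> R,
    [/\ forall s t, `|W s - W t| <= m^-1 * `|s - t|,
        forall t, W (P t) = clamp (- h) h t,
        forall s, P h <= s -> W s = h, forall s, s <= P (- h) -> W s = - h &
        forall s, - h <= W s <= h /\ P (W s) = clamp (P (- h)) (P h) s].
Proof.
move=> cP hP h0 m0 mP.
have hh : - h <= h by lra.
have Phh : P (- h) <= P h by apply/ltW/hP; lra.
have /choice[W HW] : forall s, exists t, (- h <= t <= h) /\ P t = clamp (P (- h)) (P h) s.
  move=> s; have [|t tI <-] := @IVT R P (- h) h (clamp (P (- h)) (P h) s) hh (continuous_subspaceT cP).
    by rewrite (min_idPl Phh) (max_idPr Phh) clamp_in.
  by exists t; move: tI; rewrite in_itv.
have inj s t : P s = P t -> s = t.
  by move=> Pst; case: (ltgtP s t) => // /hP; rewrite Pst ltxx.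
have WE s t : P t = clamp (P (- h)) (P h) s -> W s = t.
  by move=> E; apply: inj; rewrite E; exact: (HW s).2.
exists W; split.
- move=> s t; apply: (@le_trans _ _ (m^-1 * `|clamp (P (- h)) (P h) s - clamp (P (- h)) (P h) t|)); last first.
    by rewrite ler_pM2l ?invr_gt0// clamp_lipschitz.
  rewrite -(HW s).2 -(HW t).2 ler_pdivlMl//.
  have [/andP[s1 s2] _] := HW s; have [/andP[t1 t2] _] := HW t.
  have [st|/ltW ts] := leP (W s) (W t).
    have := mP _ _ s1 st t2 => k.
    have k' : 0 <= P (W t) - P (W s) by apply: le_trans k; rewrite mulr_ge0 ?subr_ge0// ltW.
    by rewrite distrC ger0_norm ?subr_ge0// distrC (ger0_norm k').
  have := mP _ _ t1 ts s2 => k.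
  have k' : 0 <= P (W s) - P (W t) by apply: le_trans k; rewrite mulr_ge0 ?subr_ge0// ltW.
  by rewrite ger0_norm ?subr_ge0// (ger0_norm k').
- move=> t; apply: WE.
  have mono := ltW_homo hP.
  have [tl|lt] := leP t (- h); first by rewrite (clamp_lo hh tl) clamp_lo// mono.
  have [th|ht] := leP t h.
    by rewrite [in LHS]clamp_id ?(ltW lt)// clamp_id// !mono// ltW.
  by rewrite (clamp_hi hh (ltW ht)) clamp_hi// mono// ltW.
- by move=> s hs; apply: WE; rewrite clamp_hi.
- by move=> s hs; apply: WE; rewrite clamp_lo.
- by move=> s; exact: HW.
Qed.
End clamp_function.

Section Psi_function.
Context {R : realType} (p : R) (psi : R -> R) (p1 : 1 < p)
  (psi_borel : measurable_fun setT psi)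
  (psi_gt0 : forall t : R, 0 < psi t)
  (psi_bounded : bounded_fun psi)
  (psi_root_integral :
    (\int[lebesgue_measure]_(t in setT) (psi t `^ p^-1)%:E < +oo)%E)
  (psi_inf : forall K : set R, compact K ->
    (0 < ereal_inf [set (psi t)%:E | t in K])%E).
Local Notation TR := (measurableTypeR R).
Local Notation mu := (@lebesgue_measure R).

Definition root t := psi t `^ p^-1.
Definition PsiR t := Psi p psi t%:E.
Definition PsiM := \int[mu]_t root t.

Lemma root_gt0 t : 0 < root t. Proof. by rewrite powR_gt0. Qed.

Lemma measurable_root : measurable_fun setT root.
Proof. exact: (measurableT_comp (measurable_powR _)). Qed.

Lemma root_bounded : exists B, forall t, 0 <= root t <= B.
Proof.
have [M [_ HM]] := psi_bounded.
exists ((`|M| + 1) `^ p^-1) => t; rewrite powR_ge0/=.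
have p0 : 0 <= p^-1 by rewrite invr_ge0 (le_trans ler01) ?(ltW p1).
apply: ge0_ler_powR => //; rewrite ?nnegrE ?addr_ge0//; first exact: ltW.
apply: (le_trans (ler_norm _)); apply: HM => //.
by rewrite (le_lt_trans (ler_norm M))// ltrDl.
Qed.

Lemma integrable_root : mu.-integrable setT (EFin \o root).
Proof.
apply/integrableP; split; first by apply/measurable_EFinP; exact: measurable_root.
apply: le_lt_trans psi_root_integral; rewrite le_eqVlt; apply/orP; left; apply/eqP.
by apply: eq_integral => t _ /=; rewrite gtr0_norm ?root_gt0.
Qed.

Lemma PsiRE t : PsiR t = \int[mu]_(s in `]-oo, t]) root s.
Proof.
rewrite /PsiR /Psi (_ : [set s : R | _] = `]-oo, t]%classic)//.
Qed.

Lemma PsiR_primitive : is_primitive PsiR root.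
Proof. by rewrite (funext PsiRE); exact: integrable_primitive integrable_root. Qed.

Lemma PsiR_continuous : continuous PsiR.
Proof. exact: is_primitive_continuous PsiR_primitive. Qed.

(** The positive infimum of [psi] on a compact interval bounds the slope of [PsiR] from below, which
    makes the truncated inverse Lipschitz. *)
Lemma PsiR_lower h : exists2 m, 0 < m &
  forall s t, - h <= s -> s <= t -> t <= h -> m * (t - s) <= PsiR t - PsiR s.
Proof.
have := psi_inf (@segment_compact _ (- h) h).
set e := ereal_inf _ => e0.
have [d d0 hd] : exists2 d, 0 < d & forall t, - h <= t <= h -> d <= psi t.
  have le t : - h <= t <= h -> (e <= (psi t)%:E)%E.
    by move=> tI; apply: ereal_inf_lbound; exists t => //=; rewrite in_itv.
  case: (e) e0 le => [r|_|//].
    by rewrite lte_fin => r0 le; exists r => // t /le; rewrite lee_fin.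
  (* The infimum is infinite only when [[- h, h]] is empty, and then any positive constant will
     do. *)
  by move=> le; exists 1 => // t /le; rewrite leye_eq.
exists (d `^ p^-1); first by rewrite powR_gt0.
move=> s t hs st th; rewrite -(is_primitiveE PsiR_primitive st).
have mI : measurable (`]s, t]%classic : set R) by exact: measurable_itv.
have -> : d `^ p^-1 * (t - s) = \int[mu]_(x in `]s, t]) (d `^ p^-1).
  by rewrite Rintegral_cst// lebesgue_measure_oc.
apply: le_Rintegral => //.
- apply: measurable_bounded_integrable => //; last exact: bounded_cst.
  by have := lebesgue_measure_oc st => -> ; rewrite ltry.
- exact: integrableT integrable_root.
- move=> x; rewrite /= in_itv/= => /andP[sx xt].
  have xI : - h <= x <= h by rewrite (le_trans hs (ltW sx)) (le_trans xt th).
  apply: ge0_ler_powR; rewrite ?nnegrE ?(ltW d0) ?(ltW (psi_gt0 _)) ?hd//.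
  by rewrite invr_ge0 (le_trans ler01) ?(ltW p1).
Qed.

Lemma PsiR_lt : {homo PsiR : x y / x < y}.
Proof.
move=> x y xy; have [m m0 /(_ x y)] := PsiR_lower (`|x| + `|y|).
have hx : - (`|x| + `|y|) <= x by rewrite lerNl (le_trans (ler_norm _))// normrN lerDl.
have hy : y <= `|x| + `|y| by rewrite (le_trans (ler_norm _))// lerDr.
move=> /(_ hx (ltW xy) hy) h; rewrite -subr_gt0; apply: lt_le_trans h.
by rewrite mulr_gt0// subr_gt0.
Qed.

Lemma PsiR_measure : exists k : {finite_measure set TR -> \bar R},
  [/\ forall t, k `]-oo, t]%classic = (PsiR t)%:E,
      forall t, k `]t, +oo[%classic = (PsiM - PsiR t)%:E & k setT = PsiM%:E].
Proof.
have [k kE] := density_measureR integrable_root (fun x => ltW (root_gt0 x)).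
have kT : k setT = PsiM%:E by rewrite kE.
have kt t : k `]-oo, t]%classic = (PsiR t)%:E by rewrite kE ?PsiRE.
exists k; split=> // t.
have : k setT = (k `]-oo, t]%classic + k `]t, +oo[%classic)%E.
  rewrite -measureU//.
    by rewrite -setCitvl setUv.
  by rewrite -setCitvl setICr.
rewrite kT kt => h.
have := fineK (fin_num_measure k _ (measurable_itv `]t, +oo[)).
move: h; case: (k `]t, +oo[%classic) => [r|//|//].
by rewrite -EFinD => -[->] _; congr EFin; ring.
Qed.

Lemma PsiR_hi e : 0 < e -> exists n : nat, PsiM - e < PsiR n%:R.
Proof.
move=> e0; have [k [kl _ kT]] := PsiR_measure.
have : (k \o (fun n : nat => `]-oo, (n%:R : R)]%classic)) n @[n --> \oo] -->
    k (\bigcup_n `]-oo, (n%:R : R)]%classic).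
  apply: nondecreasing_cvg_mu => //.
  - by apply: bigcup_measurable => n _; exact: measurable_itv.
  - by move=> m n mn; apply/subsetPset/subset_itvl; rewrite bnd_simp ler_nat.
rewrite (_ : \bigcup_n _ = setT) ?kT; last first.
  apply/seteqP; split=> // x _; exists (Num.bound `|x|) => //=.
  by rewrite in_itv/= (le_trans (ler_norm _))// ltW// archi_boundP.
rewrite (_ : _ \o _ = fun n : nat => (PsiR n%:R)%:E); last by apply/funext => n /=; rewrite kl.
move/fine_cvg => /cvgr_gt /(_ (PsiM - e)); rewrite /= gtrBl => /(_ e0)[n _ /(_ n (leqnn n))].
by exists n.
Qed.

Lemma PsiR_lo e : 0 < e -> exists n : nat, PsiR (- n%:R) < e.
Proof.
move=> e0; have [k [_ kr kT]] := PsiR_measure.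
have : (k \o (fun n : nat => `](- n%:R : R), +oo[%classic)) n @[n --> \oo] -->
    k (\bigcup_n `](- n%:R : R), +oo[%classic).
  apply: nondecreasing_cvg_mu => //.
  - by apply: bigcup_measurable => n _; exact: measurable_itv.
  - by move=> m n mn; apply/subsetPset/subset_itvr; rewrite bnd_simp lerN2 ler_nat.
rewrite (_ : \bigcup_n _ = setT) ?kT; last first.
  apply/seteqP; split=> // x _; exists (Num.bound `|x|) => //=.
  by rewrite in_itv/= andbT ltrNl (le_lt_trans (ler_norm _))// normrN archi_boundP.
rewrite (_ : _ \o _ = fun n : nat => (PsiM - PsiR (- n%:R))%:E); last by apply/funext => n /=; rewrite kr.
move/fine_cvg => /cvgr_gt /(_ (PsiM - e)); rewrite /= gtrBl => /(_ e0)[n _ /(_ n (leqnn n))].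
by rewrite ltrD2l ltrN2; exists n.
Qed.

Lemma PsiR_gt0 t : 0 < PsiR t.
Proof.
have [k [kl _ _]] := PsiR_measure.
have : 0 <= PsiR (t - 1) by rewrite -lee_fin -kl.
by move/le_lt_trans; apply; apply: PsiR_lt; lra.
Qed.

Lemma PsiR_ltM t : PsiR t < PsiM.
Proof.
have [k [_ kr _]] := PsiR_measure.
have : 0 <= PsiM - PsiR (t + 1) by rewrite -lee_fin -kr.
rewrite subr_ge0; apply: lt_le_trans; apply: PsiR_lt; lra.
Qed.

Lemma PsiR_surj s : 0 < s < PsiM -> exists t, PsiR t = s.
Proof.
move=> /andP[s0 sM].
have [n1 h1] := PsiR_lo s0.
have sM' : 0 < PsiM - s by rewrite subr_gt0.
have [n2] := PsiR_hi sM'; rewrite subKr => h2.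
have le : - n1%:R <= n2%:R :> R by rewrite (@le_trans _ _ 0)// oppr_le0.
have [|t _ <-] := @IVT R PsiR (- n1%:R) n2%:R s le (continuous_subspaceT PsiR_continuous).
  have l12 := lt_trans h1 h2.
  by rewrite (min_idPl (ltW l12)) (max_idPr (ltW l12)) (ltW h1) (ltW h2).
by exists t.
Qed.

Lemma PsiR_inverse h : 0 < h -> exists W : R -> R, exists2 L, 0 < L &
    [/\ forall s t, `|W s - W t| <= L * `|s - t|,
        forall t, W (PsiR t) = clamp (- h) h t,
        forall s, PsiR h <= s -> W s = h, forall s, s <= PsiR (- h) -> W s = - h &
        forall s, - h <= W s <= h /\ PsiR (W s) = clamp (PsiR (- h)) (PsiR h) s].
Proof.
move=> h0; have [m m0 mP] := PsiR_lower h.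
have [W [H1 H2 H3 H4 H5]] := clamp_inverse PsiR_continuous PsiR_lt h0 m0 mP.
by exists W, m^-1 => //; rewrite invr_gt0.
Qed.

End Psi_function.

(** * Lower bound *)

Section ultralimits.
Context {R : realType} (U : set_system nat) {FU : UltraFilter U}.

(** An ultrafilter lets uncountably many bounded sequences, one for each point of the line, converge
    at the same time without extracting subsequences. *)
Lemma ultra_bounded_cvg (x : nat -> R) B : (forall k, `|x k| <= B) ->
  exists l : R, x k @[k --> U] --> l.
Proof.
move=> xB.
have := @segment_compact R (- B) B.
move=> /(_ (x @ U) _) [].
  by apply: (@filterS _ U _ setT) => [k _ /=|]; rewrite ?in_itv/= -?ler_norml ?xB//; exact: filterT.
move=> l [_ cl]; exists l => A Al.
have [//|nA] := in_ultra_setVsetC (x @^-1` A) FU.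
by have [y [ny Ay]] := cl (~` A) A nA Al.
Qed.

End ultralimits.

(** * Limits of densities controlled only through truncations *)

Section concentration.
Context {R : realType}.
Local Notation TR := (measurableTypeR R).
Local Notation mu := (@lebesgue_measure R).

Let lin1 (x y s e : R) : 0 < e -> x - y <= e / 2 -> y <= s - e -> x < s.
Proof. lra. Qed.

Let lin2 (x d s r : R) : 0 < d -> x - d / 2 < s -> s < x -> s < r -> r <= x + d / 2 ->
  `|x - r| < d.
Proof. by rewrite ltr_norml; lra. Qed.

Let lin3 (x r s : R) : - ((s - x) / 2) < x - r -> r <= s - (s - x) / 2.
Proof. lra. Qed.

(** A monotone limit and its right-continuous version compare only across a strict inequality;
    estimates are proved at points slightly to the right and brought back by continuity of the other
    terms. *)
Lemma continuous_ge_right (f : R -> R) x y c : continuous f -> x < y ->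
  (forall t, x < t < y -> c <= f t) -> c <= f x.
Proof.
move=> cf xy H; have cr := cvg_at_right_filter (cf x).
apply: (cvgr_to_ge cr); near=> t; apply: H; apply/andP; split.
  by near: t; exact: nbhs_right_gt.
by near: t; exact: nbhs_right_lt.
Unshelve. all: by end_near. Qed.

Lemma continuous_le_right (f : R -> R) x y c : continuous f -> x < y ->
  (forall t, x < t < y -> f t <= c) -> f x <= c.
Proof.
move=> cf xy H; rewrite -lerN2; apply: (@continuous_ge_right (fun t => - f t) x y) => //.
  by move=> t; apply: cvgN; exact: cf.
by move=> t /H; rewrite lerN2.
Qed.

(** Countably many intervals with rational endpoints cover [B], and each of them is null; the
    distance [d] leaves room for such endpoints on both sides of a point. *)
Lemma rational_cover (B : set R) (good : R -> R -> Prop) (m : {finite_measure set TR -> \bar R}) :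
  (forall x, B x -> exists d, 0 < d /\ forall s t, x - d < s -> s < x -> x < t -> t < x + d -> good s t) ->
  (forall s t, good s t -> m `]s, t]%classic = 0%E) ->
  m.-negligible B.
Proof.
move=> HB H0.
pose F i : set R := if unpickle i is Some (r1, r2) then
  (if `[< good (ratr r1) (ratr r2) >] then `]ratr r1, ratr r2]%classic else set0) else set0.
apply: (@negligibleS _ _ _ m (\bigcup_i F i)).
  move=> x /HB[d [d0 Hd]].
  have [l1 l2] : x - d < x /\ x < x + d by rewrite ltrDl gtrBl.
  have [r1] := rat_in_itvoo l1; rewrite in_itv/= => /andP[a1 a2].
  have [r2] := rat_in_itvoo l2; rewrite in_itv/= => /andP[b1 b2].
  have FE : F (pickle (r1, r2)) = `]ratr r1, ratr r2]%classic.
    rewrite /F pickleK; case: ifPn => [_|/asboolP ng]; first by [].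
    by case: ng; exact: Hd.
  exists (pickle (r1, r2)); first exact: I.
  by rewrite FE /= in_itv/= a2 ltW.
apply: negligible_bigcup => i; rewrite /F.
case: (unpickle i) => [[r1 r2]|]; last exact: negligible_set0.
case: ifPn => [/asboolP g|_]; last exact: negligible_set0.
by exists `]ratr r1, ratr r2]%classic; split => //; exact: H0.
Qed.

(* [Phi n o v_ k] is [q k] truncated at height [n], and the truncation is active
   only where [v_ k] is at least [sigma n].  Uniform convergence of [v_ k] passes
   to the truncations, so the limit of the measures [q k dx] has density [w] away
   from the set [Z] where every truncation of the limit is active. *)
Section truncations.
Context (U : set_system nat) {FU : UltraFilter U} (a b : R) (ab : a < b)
  (q v_ : nat -> R -> R) (v w : R -> R) (Phi : nat -> R -> R) (L sigma : nat -> R)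
  (P : R -> R) (Q : R)
  (q0 : forall k x, 0 <= q k x) (qc : forall k, continuous (q k))
  (vc : continuous v)
  (vu : forall e, 0 < e -> \forall k \near U, forall x, a < x < b -> `|v_ k x - v x| <= e)
  (PhiL : forall n s t, `|Phi n s - Phi n t| <= L n * `|s - t|)
  (Phiq : forall n k x, Phi n (v_ k x) = Num.min (q k x) n%:R)
  (Phi0 : forall n s, 0 <= Phi n s <= n%:R)
  (Phisig : forall n s, sigma n <= s -> Phi n s = n%:R)
  (vsig : forall n k x, v_ k x < sigma n -> q k x <= n%:R)
  (sigmand : forall m n, (m <= n)%N -> sigma m <= sigma n)
  (wE : forall n x, v x < sigma n -> w x = Phi n (v x))
  (w0 : forall x, (forall n, sigma n <= v x) -> w x = 0)
  (PE : forall x, \int[mu]_(t in `]-oo, x]) (q k \_ `]a, b[) t @[k --> U] --> P x)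
  (QE : \int[mu]_t (q k \_ `]a, b[) t @[k --> U] --> Q).

Let D : set R := `]a, b[%classic.
Let mD : measurable D. Proof. exact: measurable_itv. Qed.
Let h n := (fun x => Phi n (v x)) \_ D.
Let Z := [set x | forall n, sigma n <= v x].

Let muD : (mu D < +oo)%E.
Proof. by rewrite lebesgue_measure_itv/=; case: ifP => //; rewrite ltry. Qed.

Let iqD k : mu.-integrable setT (EFin \o (q k \_ D)).
Proof.
apply/(integrable_restrictT _ mD); have [B B0 qB] := bounded_on_itv a b (qc (k := k)).
apply: measurable_bounded_integrable => //.
  by apply: measurable_funTS; apply: continuous_measurable_fun; exact: qc.
exists B; split; first exact: num_real.
move=> M ltM x /=; rewrite /D /= in_itv/= => /andP[/ltW ax /ltW xb].
by rewrite (le_trans (qB _ _)) ?ax// ltW.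
Qed.

Let qD_ge0 k x : 0 <= (q k \_ D) x.
Proof. by rewrite /patch; case: ifP. Qed.

Let cPhi n : continuous (fun x => Phi n (v x)).
Proof.
move=> x; apply/cvgrPdist_le => e e0.
have L0 : 0 < `|L n| + 1 by rewrite ltr_wpDl.
have /cvgrPdist_le /(_ (e / (`|L n| + 1))) := vc (x := x).
rewrite divr_gt0// => /(_ isT); apply: filterS => t vt.
apply: (le_trans (PhiL _ _ _)); apply: (@le_trans _ _ ((`|L n| + 1) * `|v x - v t|)).
  by rewrite ler_wpM2r// (le_trans (ler_norm _))// lerDl.
by rewrite mulrC -ler_pdivlMr.
Qed.

Let ihn n : mu.-integrable setT (EFin \o h n).
Proof.
apply/(integrable_restrictT _ mD); apply: measurable_bounded_integrable => //.
  by apply: measurable_funTS; apply: continuous_measurable_fun; exact: cPhi.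
exists n%:R; split; first exact: num_real.
move=> M ltM x /= _; have /andP[p0 pn] := Phi0 n (v x).
by rewrite ger0_norm// (le_trans pn)// ltW.
Qed.

Let h_ge0 n x : 0 <= h n x.
Proof. by rewrite /h /patch; case: ifP => // _; have /andP[] := Phi0 n (v x). Qed.

Let H n x := \int[mu]_(t in `]-oo, x]) h n t.

Let HP n : is_primitive (H n) (h n). Proof. exact: integrable_primitive. Qed.

Let Pincr x y : x < y -> \int[mu]_(t in `]x, y]) (q k \_ D) t @[k --> U] --> P y - P x.
Proof.
move=> xy; rewrite (_ : (fun k => _) = (fun k => \int[mu]_(t in `]-oo, y]) (q k \_ `]a, b[) t -
    \int[mu]_(t in `]-oo, x]) (q k \_ `]a, b[) t)); first by apply: cvgB; exact: PE.
by apply/funext => k; have [_ ->] := integrable_primitive (iqD k).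
Qed.

Let err e n x y : 0 < e -> exists2 d, 0 < d & forall f1 f2 : R -> R,
  mu.-integrable setT (EFin \o f1) -> mu.-integrable setT (EFin \o f2) ->
  (forall t, x < t <= y -> a < t < b -> f1 t <= f2 t + `|L n| * d) ->
  (forall t, ~ D t -> f1 t = 0) -> (forall t, ~ D t -> f2 t = 0) ->
  \int[mu]_(t in `]x, y]) f1 t <= \int[mu]_(t in `]x, y]) f2 t + e.
Proof.
move=> e0; have L0 : 0 < `|L n| + 1 by rewrite ltr_wpDl.
have ba : 0 < b - a by rewrite subr_gt0.
(* A pointwise error [|L n| d] then integrates over []a, b[] to at most [e]; the 1 keeps the
   denominator positive. *)
pose d := e / ((`|L n| + 1) * (b - a)); exists d; first by rewrite divr_gt0// mulr_gt0.
move=> f1 f2 i1 i2 f12 f10 f20.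
have c0 : 0 <= `|L n| * d by rewrite mulr_ge0// ltW// divr_gt0// mulr_gt0.
have mI : measurable (`]x, y]%classic : set R) by exact: measurable_itv.
have ic : mu.-integrable setT (EFin \o ((fun=> `|L n| * d) \_ D)).
  apply/(integrable_restrictT _ mD); apply: measurable_bounded_integrable => //.
  exact: bounded_cst.
apply: (@le_trans _ _ (\int[mu]_(t in `]x, y]) (f2 t + ((fun=> `|L n| * d) \_ D) t))).
  apply: le_Rintegral => //.
  - exact: integrableT.
  - by apply: integrableT => //; exact: integrableDT.
  - move=> t; rewrite /= in_itv/= => xy.
    have [tD|tD] := pselect (D t); last by rewrite f10// f20// restrict_out// addr0.
    by rewrite restrict_id//; apply: f12 => //; move: tD; rewrite /D /= in_itv.
rewrite RintegralD//; [|exact: integrableT|exact: integrableT].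
rewrite lerD2l; apply: (@le_trans _ _ (\int[mu]_t ((fun=> `|L n| * d) \_ D) t)).
  by apply: subset_Rintegral => // t; rewrite /patch; case: ifP.
rewrite (_ : \int[mu]_t _ t = \int[mu]_(t in D) (`|L n| * d)); last first.
  rewrite [RHS]Rintegral_indicT; apply: eq_Rintegral => t _.
  have [tD|tD] := pselect (D t); first by rewrite restrict_id// (indic_bool (e := true)) ?mulr1.
  by rewrite restrict_out// (indic_bool (e := false)) ?mulr0.
rewrite Rintegral_cst// (_ : fine _ = b - a); last first.
  by have /(congr1 fine) := lebesgue_measure_itv `]a, b[; rewrite /= lte_fin ab.
rewrite /d -mulrA; have -> : e / ((`|L n| + 1) * (b - a)) * (b - a) = e / (`|L n| + 1).
  by rewrite invfM mulrA -mulrA mulVf ?mulr1// gt_eqF.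
by rewrite mulrA ler_pdivrMr// mulrC ler_pM2l// lerDl.
Qed.

(** Truncating can only decrease [q k], and the truncations [Phi n (v_ k t)] converge uniformly to
    [Phi n (v t)]. *)
Let lower n x y : x < y -> H n y - H n x <= P y - P x.
Proof.
move=> xy; have [_ <-//] := HP n; apply/ler_addgt0Pr => e e0.
have [d d0 hd] := err n x y e0.
apply: (cvgr_to_ge (cvgD (Pincr xy) (cvg_cst e))).
apply: filterS (vu d0) => k vk; apply: hd => //.
- move=> t _ tD; rewrite [leRHS](_ : _ = q k t + `|L n| * d); last by rewrite restrict_id// /D /= in_itv.
  have := PhiL n (v t) (v_ k t); rewrite Phiq => hL.
  have vt := vk _ tD.
  have : Phi n (v t) - Num.min (q k t) n%:R <= `|L n| * d.
    apply: (le_trans (ler_norm _)); apply: (le_trans hL).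
    apply: (@le_trans _ _ (`|L n| * `|v t - v_ k t|)); first by rewrite ler_wpM2r// ler_norm.
    by rewrite ler_wpM2l// distrC.
  have : Num.min (q k t) n%:R <= q k t by rewrite ge_min lexx.
  rewrite /h restrict_id; last by rewrite /D /= in_itv.
  by move: (Num.min _ _) (_ * d) => z1 z2; lra.
- by move=> t tD; rewrite /h restrict_out.
- by move=> t tD; rewrite restrict_out.
Qed.

(** If [v] stays below [sigma n] by a margin, then for [k] near [U] so does [v_ k]; there [q k] is
    at most [n], its truncation is [q k] itself, and the inequality reverses. *)
Let upper n x y e0 : x < y -> 0 < e0 ->
  (forall t, x < t <= y -> a < t < b -> v t <= sigma n - e0) ->
  P y - P x <= H n y - H n x.
Proof.
move=> xy e00 vs; have [_ <-//] := HP n; apply/ler_addgt0Pr => e e0'.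
have [d d0 hd] := err n x y e0'.
apply: (cvgr_to_le (Pincr xy)).
have m0 : 0 < Num.min d (e0 / 2) by rewrite lt_min d0 divr_gt0.
apply: filterS (vu m0) => k vk; apply: hd => //.
- move=> t txy tD; rewrite (_ : h n t = Phi n (v t)); last by rewrite /h restrict_id// /D /= in_itv.
  rewrite restrict_id; last by rewrite /D /= in_itv.
  have := vk _ tD; rewrite le_min => /andP[vt vt2].
  have qn : q k t <= n%:R.
    apply: vsig; have := vs _ txy tD; move: vt2; rewrite ler_norml => /andP[_].
    exact: lin1 e00.
  have := PhiL n (v_ k t) (v t); rewrite Phiq (min_idPl qn) => hL.
  have : q k t - Phi n (v t) <= `|L n| * d.
    apply: (le_trans (ler_norm _)); apply: (le_trans hL).
    apply: (@le_trans _ _ (`|L n| * `|v_ k t - v t|)); first by rewrite ler_wpM2r// ler_norm.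
    by rewrite ler_wpM2l.
  by move: (Phi n _) (_ * d) => z1 z2; lra.
- by move=> t tD; rewrite restrict_out.
- by move=> t tD; rewrite /h restrict_out.
Qed.

Let Pnd x y : x <= y -> P x <= P y.
Proof.
rewrite le_eqVlt => /predU1P[->//|xy]; rewrite -subr_ge0.
apply: (cvgr_to_ge (Pincr xy)); apply: filterS filterT => k _.
exact: Rintegral_ge0.
Qed.

Let P0Q x : 0 <= P x <= Q.
Proof.
apply/andP; split.
  by apply: (cvgr_to_ge (PE (x := x))); apply: filterS filterT => k _; exact: Rintegral_ge0.
apply: (ler_cvg_to (PE (x := x)) QE); apply: filterS filterT => k _.
by apply: subset_Rintegral => //; exact: measurable_itv.
Qed.

(** The measure sees the right-continuous version of [P], so both comparisons are made at nearby
    points on the right and passed to the limit by continuity of [H n]. This is why the second one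
    assumes control of [v] up to some [y'] beyond [y]. *)
Let Pmeasure : exists m : {finite_measure set TR -> \bar R},
  [/\ (m setT <= Q%:E)%E,
      exists c, countable [set x | P x != c + fine (m `]-oo, x]%classic)],
      forall n x y, x < y -> H n y - H n x <= fine (m `]x, y]%classic) &
      forall n x y e0 y', x < y -> y < y' -> 0 < e0 ->
        (forall t, x < t <= y' -> a < t < b -> v t <= sigma n - e0) ->
        fine (m `]x, y]%classic) <= H n y - H n x].
Proof.
have [m [Pr [mE PrE cPr mQ]]] := stieltjes_measure Pnd P0Q.
have cH n : continuous (H n) := is_primitive_continuous (HP n).
exists m; split.
- by move: mQ; rewrite subr0.
- pose F x := fine (m `]-oo, x]%classic).
  have PrF x : Pr x = (Pr 0 - F 0) + F x.
    have E s t : s < t -> Pr t - Pr s = F t - F s.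
      by move=> st; rewrite -(finite_measure_oc m (ltW st)) mE.
    have [x0|x0|->] := ltgtP x 0; last by ring.
      by have := E _ _ x0; lra.
    by have := E _ _ x0; lra.
  exists (Pr 0 - F 0); apply: sub_countable cPr; apply: subset_card_le => x /=.
  by rewrite -PrF eq_sym.
- move=> n x y xy; rewrite mE//=.
  suff : H n y - (Pr y - Pr x) <= H n x by lra.
  apply: (@continuous_ge_right _ x y) => // t /andP[xt ty].
  have := lower n ty.
  have [/andP[_ p1] /andP[p2 _]] := (PrE _ _ xt, PrE _ _ (ltr_pwDr ltr01 (lexx y))).
  lra.
- move=> n x y e0 y' xy yy' e00 vs; rewrite mE//=.
  suff : Pr y - Pr x + H n x <= H n y by lra.
  apply: (@continuous_ge_right _ y y') => // t /andP[yt ty'].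
  have : P t - P x <= H n t - H n x.
    apply: (upper (lt_trans xy yt) e00) => s /andP[xs st]; apply: vs.
    by rewrite xs (le_trans st)// ltW.
  have [/andP[_ p1] /andP[p2 _]] := (PrE _ _ yt, PrE _ _ xy).
  lra.
Qed.

Let mS n : measurable [set x | v x < sigma n].
Proof.
apply: measurable_lt_set; last exact: measurable_cst.
exact: continuous_measurable_fun.
Qed.

Let ZE : Z = ~` \bigcup_n [set x | v x < sigma n].
Proof.
apply/seteqP; split=> [x Zx [n _ /=]|x nx n]; first by rewrite ltNge Zx.
by rewrite leNgt; apply/negP => vn; apply: nx; exists n.
Qed.

Let mZ : measurable Z.
Proof. by rewrite ZE; apply: measurableC; apply: bigcup_measurable. Qed.

(** The lower comparison makes [m] minus the measure of density [h n] a positive measure [E]. The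
    upper one makes [E] vanish on small intervals around each point where [v x < sigma n], hence on
    that whole set. *)
Let split_n : exists m : {finite_measure set TR -> \bar R},
  [/\ (m setT <= Q%:E)%E,
      exists c, countable [set x | P x != c + fine (m `]-oo, x]%classic)],
      forall n (A : set R), measurable A -> \int[mu]_(x in A) h n x <= fine (m A) &
      forall n (A : set R), measurable A -> A `<=` [set x | v x < sigma n] ->
        m A = (\int[mu]_(x in A) h n x)%:E].
Proof.
have [m [mQ mc mlo mhi]] := Pmeasure.
have [z zE] := restr_finite m (measurable0 : measurable (set0 : set R)).
have z0 (B : set R) : measurable B -> z B = 0%E by move=> mB; rewrite zE// setI0 measure0.
have key n : exists E : {finite_measure set TR -> \bar R},
    (forall A : set R, measurable A -> m A = (E A + (\int[mu]_(x in A) h n x)%:E)%E) /\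
    E.-negligible [set x | v x < sigma n].
  have [k kE] := density_measureR (ihn n) (h_ge0 n).
  have kxy x y : x < y -> k `]x, y]%classic = (H n y - H n x)%:E.
    by move=> xy; rewrite kE//; have [_ <-] := HP n.
  have [|E EE] := @stieltjes_sum R (fun x => - H n x) m.
    move=> x y xy; rewrite opprK addrC distrC ger0_norm; first exact: mlo.
    by rewrite -lee_fin -kxy.
  exists E; split.
    move=> A mA; rewrite -kE// -[LHS]adde0 -(z0 A mA).
    symmetry; apply: eq_add_measure_oc => // x y xy.
    rewrite kxy// z0// adde0.
    rewrite EE// addeAC -EFinD.
    rewrite (_ : - H n y - - H n x + (H n y - H n x) = 0) ?add0e//.
    by move: (H n y) (H n x) => ? ?; ring.
  apply: (@rational_cover _ (fun s t => s < t /\ exists e0 y', [/\ t < y', 0 < e0 &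
     forall r, s < r <= y' -> a < r < b -> v r <= sigma n - e0])).
    move=> x /= vx; pose e0 := (sigma n - v x) / 2.
    have e00 : 0 < e0 by rewrite divr_gt0// subr_gt0.
    have /cvgrPdist_lt /(_ _ e00) /nbhs_ballP[d /= d0 hd] := vc (x := x).
    exists (d / 2); split; first by rewrite divr_gt0.
    move=> s t ds sx xt td; split; first exact: lt_trans xt.
    exists e0, (x + d / 2); split => // r /andP[sr rd] _.
    have : `|v x - v r| < e0.
      by apply: hd; rewrite /ball /=; exact: lin2 d0 ds sx sr rd.
    by rewrite ltr_norml /e0 => /andP[+ _]; exact: lin3.
  move=> s t [st [e0 [y' [ty' e00 vs]]]].
  have := mhi _ _ _ _ _ st ty' e00 vs; have := mlo n _ _ st; rewrite EE//.
  rewrite -(fineK (fin_num_measure m _ (measurable_itv `]s, t]))) -EFinD => h1 h2.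
  by congr EFin; lra.
exists m; split => //.
- move=> n A mA; have [E [mE _]] := key n.
  have := mE _ mA; rewrite -(fineK (fin_num_measure m _ mA)) -(fineK (fin_num_measure E _ mA)).
  by rewrite -EFinD => -[->]; rewrite lerDr fine_ge0.
- move=> n A mA An; have [E [mE E0]] := key n.
  rewrite mE// (_ : E A = 0%E) ?add0e//.
  by apply: measure_negligible => //; exact: negligibleS E0.
Qed.

(** On [Z] inside [D] every [h n] equals [n] while its integral is at most the total mass of [m], so
    this set is Lebesgue null. The rest of [D] is exhausted by the sets where [v x < sigma n], on
    which [m] has density [h n], equal to [w]. *)
Lemma concentration : exists m : {finite_measure set TR -> \bar R},
  [/\ (m setT <= Q%:E)%E /\
      (exists c, countable [set x | P x != c + fine (m `]-oo, x]%classic)]),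
      measurable Z, mu (Z `&` D) = 0%E,
      mu.-integrable setT (EFin \o (w \_ D)) &
      forall A : set R, measurable A ->
        m (A `&` D) = ((\int[mu]_(x in A) (w \_ D) x)%:E + m (A `&` D `&` Z))%E].
Proof.
have [m [mQ mc mlo mhi]] := split_n.
have mZD : measurable (Z `&` D) by exact: measurableI.
have Zh n x : (Z `&` D) x -> h n x = n%:R.
  by move=> [Zx Dx]; rewrite /h restrict_id// Phisig.
have mwn : measurable_fun setT (w \_ D).
  (* Measurability of [w] is not assumed, since [w] will come from a pointwise choice; it follows
     from that of the truncations. *)
  apply: (@measurable_fun_cvg _ _ _ _ (fun n x => h n x * \1_[set x | v x < sigma n] x)).
    by move=> n; apply: measurable_funM => //; exact: integrableT_measurable (ihn n).
  move=> x _; have [[n vn]|nv] := pselect (exists n, v x < sigma n).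
    apply: cvg_near_cst; exists n => // i /= ni.
    have vi : v x < sigma i by rewrite (lt_le_trans vn)// sigmand.
    rewrite (indic_bool (e := true)) ?mulr1// /h /patch.
    by case: ifP => // _; rewrite -wE.
  have vZ n : sigma n <= v x by rewrite leNgt; apply/negP => vn; apply: nv; exists n.
  apply: cvg_near_cst; exists 0%N => // i _.
  rewrite (indic_bool (e := false)) ?mulr0; last by split=> //=; rewrite ltNge vZ.
  by rewrite /patch; case: ifP => // _; rewrite w0.
have w_ge0 x : (0 <= ((w \_ D) x)%:E)%E.
  rewrite lee_fin /patch; case: ifP => // _.
  have [[n vn]|nv] := pselect (exists n, v x < sigma n).
    by rewrite (wE vn); have /andP[] := Phi0 n (v x).
  by rewrite w0// => n; rewrite leNgt; apply/negP => vn; apply: nv; exists n.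
have key (A : set R) : measurable A ->
    m (A `&` D `&` ~` Z) = (\int[mu]_(x in A) ((w \_ D) x)%:E)%E.
  move=> mA; pose F n := A `&` D `&` [set x | v x < sigma n].
  have mF n : measurable (F n) by apply: measurableI => //; exact: measurableI.
  have mUF : measurable (\bigcup_n F n) by exact: bigcup_measurable.
  have ndF : nondecreasing_seq F.
    move=> i j ij; apply/subsetPset => x [ADx /= vx]; split=> //=.
    by rewrite (lt_le_trans vx)// sigmand.
  have FE : \bigcup_n F n = A `&` D `&` ~` Z.
    by rewrite ZE setCK /F -setI_bigcupr.
  have -> : (\int[mu]_(x in A) ((w \_ D) x)%:E = \int[mu]_(x in \bigcup_n F n) ((w \_ D) x)%:E)%E.
    rewrite [LHS]integral_mkcond [RHS]integral_mkcond; apply: eq_integral => x _.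
    rewrite /patch; have [xF|xF] := pselect ((\bigcup_n F n) x).
      have [[xA _] _] : (A `&` D `&` ~` Z) x by rewrite -FE.
      by rewrite (mem_set xA) (mem_set xF).
    rewrite (memNset xF); case: ifPn => // /set_mem xA; case: ifPn => // /set_mem xD.
    rewrite w0//; apply: contrapT => nZ; apply: xF.
    by rewrite FE; split.
  rewrite -FE; apply: (@cvg_unique _ _ ((m \o F) i @[i --> \oo])).
  - exact: ereal_hausdorff.
  - exact: nondecreasing_cvg_mu.
  - rewrite (_ : m \o F = fun n => \int[mu]_(x in F n) ((w \_ D) x)%:E)%E.
      apply: ge0_nondecreasing_set_cvg_integral => //.
      by move=> n; apply/measurable_EFinP; exact: measurable_funTS.
    apply/funext => n /=; rewrite (mhi n)//; last by move=> x [].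
    rewrite EFin_Rintegral//; apply: eq_integral => x /set_mem[[_ Dx] /= vx].
    by rewrite /h !restrict_id// -wE.
have iw : mu.-integrable setT (EFin \o (w \_ D)).
  apply/integrableP; split; first exact/measurable_EFinP.
  have -> : (\int[mu]_x `|(EFin \o (w \_ D)) x| = \int[mu]_x ((w \_ D) x)%:E)%E.
    by apply: eq_integral => x _ /=; congr EFin; rewrite ger0_norm// -lee_fin.
  rewrite -key//; apply: (@le_lt_trans _ _ (m setT)); last exact: finite_measure_lty.
  by rewrite le_measure ?inE//; apply: measurableI; [exact: measurableI|exact: measurableC].
exists m; split => //.
- have fin : mu (Z `&` D) \is a fin_num.
    rewrite ge0_fin_numE//; apply: le_lt_trans muD.
    by rewrite le_measure ?inE//; exact: subIsetr.
  have bnd (n : nat) : n%:R * fine (mu (Z `&` D)) <= fine (m setT).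
    rewrite -Rintegral_cst//.
    rewrite (_ : \int[mu]_(_ in _) _ = \int[mu]_(x in Z `&` D) h n x); last first.
      by apply: eq_Rintegral => x /set_mem xZ; rewrite Zh.
    apply: (le_trans (mlo n _ mZD)).
    by rewrite fine_le ?fin_num_measure// le_measure ?inE.
  apply/eqP; rewrite eq_le measure_ge0 andbT -(fineK fin) lee_fin leNgt; apply/negP => f0.
  have := bnd (Num.bound (fine (m setT) / fine (mu (Z `&` D)))).
  rewrite leNgt => /negP; apply; rewrite -ltr_pdivrMr// archi_boundP//.
  by rewrite divr_ge0 ?fine_ge0.
- move=> A mA.
  rewrite EFin_Rintegral// -key//.
  rewrite -[X in m X = _](setIT (A `&` D)) -(setUv Z) setIUr measureU//; last 3 first.
  + by apply: measurableI => //; exact: measurableI.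
  + by apply: measurableI; [exact: measurableI|exact: measurableC].
  + by rewrite setIACA setIid setICr setI0.
  by rewrite addeC.
Qed.

End truncations.
End concentration.

(** * Equicontinuity and the derivative of the limit, from Young's inequality *)

Section compactness.
Context {R : realType}.
Local Notation TR := (measurableTypeR R).
Local Notation mu := (@lebesgue_measure R).

Lemma scale_measure (m : {finite_measure set TR -> \bar R}) (c : R) : 0 <= c ->
  exists m' : {finite_measure set TR -> \bar R},
    forall A : set R, measurable A -> m' A = (c * fine (m A))%:E.
Proof.
move=> c0; pose m' : {measure set TR -> \bar R} := mscale (NngNum c0) m.
have m'E (A : set R) : measurable A -> m' A = (c * fine (m A))%:E.
  by move=> mA; rewrite /m' /= /mscale /= EFinM fineK// fin_num_measure.
have fin : fin_num_fun m' by move=> A mA; rewrite m'E.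
pose m'' : {finite_measure set TR -> \bar R} :=
  HB.pack (Measure.sort m') (Measure_isFinite.Build _ _ _ (Measure.sort m') fin).
by exists m''.
Qed.

Let lin4 (x a d z : R) : z <= (x - a) / d -> (x - a) / d < z + 1 -> 0 < d ->
  `|x - (a + z * d)| <= d.
Proof.
move=> + + d0; rewrite ler_pdivlMr// ltr_pdivrMr// mulrDl mul1r ler_norml.
by move: (z * d) => y; lra.
Qed.

(** The inequality for conjugate exponents applied to [t] and [expR ((p - 1) * s)]; equality holds
    at [t = expR s]. *)
Lemma young_exp (p t s : R) : 1 < p -> 0 <= t ->
  p * expR ((p - 1) * s) * t <= t `^ p + (p - 1) * expR (p * s).
Proof.
move=> p1 t0; have p0 : 0 < p by exact: lt_trans p1.
have q0 : 0 < p - 1 by rewrite subr_gt0.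
have := @conjugate_powR R t (expR ((p - 1) * s)) p (p / (p - 1)) t0 (ltW (expR_gt0 _)) p0.
rewrite divr_gt0// => /(_ isT).
rewrite invf_div -[X in X + _]mul1r -mulrDl addrCA subrr addr0 divff ?gt_eqF// => /(_ erefl).
have -> : expR ((p - 1) * s) `^ (p / (p - 1)) = expR (p * s).
  rewrite /powR gt_eqF ?expR_gt0// expRK; congr expR.
  by field; exact: lt0r_neq0.
rewrite -(ler_pM2l p0) mulrDr => h.
apply: le_trans (le_trans _ h) _; first by rewrite (mulrC t) mulrA.
by rewrite le_eqVlt; apply/orP; left; apply/eqP; field; exact: lt0r_neq0.
Qed.

Lemma Rintegral_lin (A : set R) (c e : R) (f g : R -> R) : measurable A ->
  mu.-integrable setT (EFin \o f) -> mu.-integrable setT (EFin \o g) ->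
  \int[mu]_(x in A) (c * (f x + e * g x)) = c * (\int[mu]_(x in A) f x + e * \int[mu]_(x in A) g x).
Proof.
move=> mA fi gi; rewrite RintegralZl//; last first.
  by apply: integrableT => //; apply: integrableDT => //; exact: integrableZT.
rewrite RintegralD//; [|exact: integrableT|by apply: integrableT => //; exact: integrableZT].
by rewrite RintegralZl//; exact: integrableT.
Qed.

Lemma ae_foralln (P : nat -> R -> Prop) : (forall n, {ae mu, forall x, P n x}) ->
  {ae mu, forall x, forall n, P n x}.
Proof.
move=> h; have : mu.-negligible (\bigcup_n ~` [set x | P n x]).
  by apply: negligible_bigcup => n; exact: h.
by apply: negligibleS => x /= /existsNP[n nP]; exists n.
Qed.

Section young_inequality_limit.
Context (U : set_system nat) {FU : UltraFilter U} (a b p C Q : R) (ab : a < b) (p1 : 1 < p)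
  (v_ h : nat -> R -> R) (v : R -> R)
  (h0 : forall k x, 0 <= h k x) (ih : forall k, mu.-integrable setT (EFin \o h k))
  (hC : forall k, \int[mu]_x h k x <= C)
  (Y : forall s k x y, x < y -> p * expR ((p - 1) * s) * `|v_ k y - v_ k x| <=
     \int[mu]_(t in `]x, y]) h k t + (p - 1) * expR (p * s) *
       fine (mu (`]x, y]%classic `&` `]a, b[%classic)))
  (vE : forall x, v_ k x @[k --> U] --> v x)
  (QE : \int[mu]_x h k x @[k --> U] --> Q).

Let D : set R := `]a, b[%classic.
Let mD : measurable D. Proof. exact: measurable_itv. Qed.
Let al s := p * expR ((p - 1) * s).
Let be s := (p - 1) * expR (p * s).
Let al0 s : 0 < al s. Proof. by rewrite /al mulr_gt0 ?expR_gt0// (lt_trans ltr01). Qed.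
Let be0 s : 0 < be s. Proof. by rewrite /be mulr_gt0 ?expR_gt0// subr_gt0. Qed.

Let C0 : 0 <= C.
Proof. by apply: le_trans (hC 0%N); exact: Rintegral_ge0. Qed.

Let large c : 0 < c -> exists s, c <= al s.
Proof.
move=> c0; have q0 : 0 < p - 1 by rewrite subr_gt0.
exists (ln c / (p - 1)); rewrite /al (_ : (p - 1) * (ln c / (p - 1)) = ln c).
  by rewrite lnK ?posrE// ler_peMl ?ltW.
by field; exact: lt0r_neq0.
Qed.

Let muoc x y : x < y -> fine (mu (`]x, y]%classic `&` D)) <= y - x.
Proof.
move=> xy; have e := @lebesgue_measure_oc R _ _ (ltW xy).
have mI : measurable (`]x, y]%classic : set R) by exact: measurable_itv.
have le : (mu (`]x, y]%classic `&` D) <= (y - x)%:E)%E.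
  rewrite -[leRHS]e; by apply: le_measure; rewrite ?inE//; exact: measurableI.
have fin : mu (`]x, y]%classic `&` D) \is a fin_num.
  by rewrite ge0_fin_numE//; apply: le_lt_trans le _; rewrite ltry.
by rewrite -lee_fin fineK.
Qed.

Let hoc k x y : x < y -> \int[mu]_(t in `]x, y]) h k t <= C.
Proof. by move=> xy; apply: le_trans (hC k); apply: subset_Rintegral. Qed.

(** First [s] is taken so large that the energy bound divided by [al s] is at most [e / 2]; then [d]
    is chosen so that the Lebesgue term, also divided by [al s], is at most [e / 2]. *)
Let equi e : 0 < e -> exists2 d, 0 < d & forall k x y, `|x - y| <= d -> `|v_ k x - v_ k y| <= e.
Proof.
move=> e0; have c0 : 0 < 2 * (C + 1) / e by rewrite divr_gt0// mulr_gt0// ltr_wpDl.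
have [s hs] := large c0.
pose d := al s * e / 2 / be s.
have d0 : 0 < d by rewrite /d !divr_gt0// mulr_gt0.
exists d => // k.
suff H x y : x < y -> y - x <= d -> `|v_ k y - v_ k x| <= e.
  move=> x y; have [xy|yx|->] := ltgtP x y; last by move=> _; rewrite subrr normr0 ltW.
    by rewrite ler0_norm ?subr_le0 ?(ltW xy)// opprB distrC => /(H _ _ xy).
  by rewrite ger0_norm ?subr_ge0 ?(ltW yx)// => /(H _ _ yx).
move=> xy yxd; rewrite -(ler_pM2l (al0 s)); apply: (le_trans (Y s k xy)).
have h1 := hoc k xy.
have h2 : be s * fine (mu (`]x, y]%classic `&` D)) <= al s * e / 2.
  apply: (@le_trans _ _ (be s * d)).
    by rewrite ler_pM2l//; apply: le_trans yxd; exact: muoc.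
  by rewrite /d mulrC divfK ?gt_eqF.
have h3 : C <= al s * e / 2.
  by move: hs; rewrite ler_pdivrMr// => hs; rewrite ler_pdivlMr//; lra.
apply: le_trans (lerD h1 h2) _.
by move: h3; rewrite -/(al s); move: (al s * e) => z; lra.
Qed.

Let equi_lim e : 0 < e -> exists2 d, 0 < d & (forall k x y, `|x - y| <= d -> `|v_ k x - v_ k y| <= e) /\
  (forall x y, `|x - y| <= d -> `|v x - v y| <= e).
Proof.
move=> e0; have [d d0 hd] := equi e0; exists d => //; split=> // x y xy.
apply: (cvgr_to_le (cvg_norm (cvgB (vE (x := x)) (vE (x := y))))).
by apply: filterS filterT => k _; exact: hd.
Qed.

Lemma limit_continuous : continuous v.
Proof.
move=> x; apply/cvgrPdist_le => e e0; have [d d0 [_ hd]] := equi_lim e0.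
apply/nbhs_ballP; exists d => //= t xt; apply: hd; exact: ltW.
Qed.

(** Equicontinuity reduces uniform convergence to convergence at the points [a + i d], finitely many
    of which come within [d] of every point of []a, b[]. *)
Lemma limit_uniform e : 0 < e ->
  \forall k \near U, forall x, a < x < b -> `|v_ k x - v x| <= e.
Proof.
move=> e0; have e30 : 0 < e / 3 by rewrite divr_gt0.
have [d d0 [hd1 hd2]] := equi_lim e30.
pose N := Num.bound ((b - a) / d).
have : \forall k \near U, forall i : 'I_N.+1, `|v (a + i%:R * d) - v_ k (a + i%:R * d)| <= e / 3.
  apply: filter_forall => i.
  by have /cvgrPdist_le := vE (x := a + i%:R * d); exact.
apply: filterS => k vk x /andP[ax xb].
have x0 : 0 <= (x - a) / d by rewrite divr_ge0// ?subr_ge0 ltW.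
pose i := Num.truncn ((x - a) / d).
have /andP[i1 i2] := truncn_itv x0.
have iN : (i < N.+1)%N.
  rewrite ltnS -(ler_nat R); apply: (le_trans i1); apply: (@le_trans _ _ ((b - a) / d)).
    by rewrite ler_pM2r ?invr_gt0//; lra.
  by apply/ltW/archi_boundP; rewrite divr_ge0 ?subr_ge0 ?ltW.
have := vk (Ordinal iN); rewrite /=; set y := a + _ => vy.
have xy : `|x - y| <= d.
  by apply: lin4 => //; rewrite natr1.
have h1 := hd1 k _ _ xy; have h2 := hd2 _ _ xy.
rewrite (_ : v_ k x - v x = (v_ k x - v_ k y) - (v y - v_ k y) - (v x - v y)); last by ring.
by apply: (le_trans (ler_normB _ _)); apply: (le_trans (lerD (ler_normB _ _) (lexx _))); lra.
Qed.

Let H_cvg x : exists l : R, \int[mu]_(t in `]-oo, x]) h k t @[k --> U] --> l.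
Proof.
apply: (@ultra_bounded_cvg _ _ _ _ C) => k; rewrite ger0_norm; last exact: Rintegral_ge0.
by apply: le_trans (hC k); apply: subset_Rintegral => //; exact: measurable_itv.
Qed.

Let limit_measure : exists mH : {finite_measure set TR -> \bar R},
  (mH setT <= Q%:E)%E /\ forall s x y, x < y ->
    al s * `|v y - v x| <= fine (mH `]x, y]%classic) + be s * fine (mu (`]x, y]%classic `&` D)).
Proof.
have /choice[H HE] := H_cvg.
have HI x y : x < y -> \int[mu]_(t in `]x, y]) h k t @[k --> U] --> H y - H x.
  move=> xy; rewrite (_ : (fun k => _) = (fun k => \int[mu]_(t in `]-oo, y]) h k t -
    \int[mu]_(t in `]-oo, x]) h k t)); first by apply: cvgB; exact: HE.
  by apply/funext => k; have [_ ->] := integrable_primitive (ih k).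
have Hnd : {homo H : x y / x <= y}.
  move=> x y; rewrite le_eqVlt => /predU1P[->//|xy]; rewrite -subr_ge0.
  apply: (cvgr_to_ge (HI _ _ xy)); apply: filterS filterT => k _.
  exact: Rintegral_ge0.
have H0Q x : 0 <= H x <= Q.
  apply/andP; split.
    by apply: (cvgr_to_ge (HE x)); apply: filterS filterT => k _; exact: Rintegral_ge0.
  apply: (ler_cvg_to (HE x) QE); apply: filterS filterT => k _.
  by apply: subset_Rintegral => //; exact: measurable_itv.
have [mH [Hr [mE HrE _ mQ]]] := stieltjes_measure Hnd H0Q.
exists mH; split; first by move: mQ; rewrite subr0.
move=> s x y xy; rewrite mE//=.
(* [Hr x <= H t] needs [x < t], so the left endpoint is moved to [t] and brought back by continuity
   of [v]. *)
apply: (@continuous_le_right _ (fun t => al s * `|v y - v t|) x y) => //.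
  move=> t; apply: cvgM; first exact: cvg_cst.
  by apply: cvg_norm; apply: cvgB; [exact: cvg_cst|exact: limit_continuous].
move=> t /andP[xt ty].
have mono : fine (mu (`]t, y]%classic `&` D)) <= fine (mu (`]x, y]%classic `&` D)).
  have muD : (mu D < +oo)%E.
    by rewrite lebesgue_measure_itv/=; case: ifP => //; rewrite ltry.
  have fin z : mu (`]z, y]%classic `&` D) \is a fin_num.
    rewrite ge0_fin_numE//; apply: le_lt_trans muD.
    by rewrite le_measure ?inE//; apply: measurableI.
  rewrite fine_le//; apply: le_measure; rewrite ?inE//; try exact: measurableI.
  by apply: setSI; apply: subset_itvr; rewrite bnd_simp ltW.
apply: (@le_trans _ _ (H y - H t + be s * fine (mu (`]t, y]%classic `&` D)))).
  have cl : al s * `|v_ k y - v_ k t| @[k --> U] --> al s * `|v y - v t|.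
    by apply: cvgM; [exact: cvg_cst|apply: cvg_norm; apply: cvgB; exact: vE].
  have cr : \int[mu]_(r in `]t, y]) h k r + be s * fine (mu (`]t, y]%classic `&` D))
      @[k --> U] --> H y - H t + be s * fine (mu (`]t, y]%classic `&` D)).
    by apply: cvgD; [exact: HI|exact: cvg_cst].
  by apply: (ler_cvg_to cl cr); apply: filterS filterT => k _; exact: Y.
apply: lerD; last by rewrite ler_pM2l.
have [/andP[_ q1] /andP[q2 _]] := (HrE _ _ xt, HrE _ _ (ltr_pwDr ltr01 (lexx y))).
by move: q1 q2; move: (H _) (H _) (Hr _) (Hr _) => *; lra.
Qed.

(** The function [G] attains the value [t] to the power [p] at [s = ln t]; by continuity a rational
    [s] close to [ln t] already exceeds any smaller number. *)
Lemma expR_family_bound (h1 t : R) : 0 <= h1 -> 0 <= t ->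
  (forall r : rat, al (ratr r) * t <= h1 + be (ratr r)) -> t `^ p <= h1.
Proof.
move=> h10; rewrite le_eqVlt => /predU1P[<- _|t0 H].
  by rewrite powR0// gt_eqF// (lt_trans ltr01).
rewrite leNgt; apply/negP => lt.
pose G s := al s * t - be s.
have GE : G (ln t) = t `^ p.
  rewrite /G /al /be /powR gt_eqF// -[X in _ * X - _](lnK (x := t)) ?posrE//.
  rewrite -mulrA -expRD (_ : (p - 1) * ln t + ln t = p * ln t); first ring.
  by ring.
have cG : G s @[s --> ln t] --> G (ln t).
  apply: cvgB; last first.
    apply: cvgM; first exact: cvg_cst.
    by apply: continuous_comp; [apply: mulrl_continuous|exact: continuous_expR].
  apply: cvgM; last exact: cvg_cst.
  apply: cvgM; first exact: cvg_cst.
  by apply: continuous_comp; [apply: mulrl_continuous|exact: continuous_expR].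
move: (cG) => /cvgr_gt /(_ h1); rewrite GE => /(_ lt) /nbhs_ballP[d /= d0 hd].
have lt' : ln t - d < ln t + d by lra.
have [r] := rat_in_itvoo lt'; rewrite in_itv/= => /andP[r1 r2].
have := hd (ratr r); rewrite /ball /= ltr_norml => hr.
have := H r; rewrite leNgt => /negP; apply.
by rewrite -ltrBrDr; apply: hr; lra.
Qed.

(** For each [s] the limit inequality says that one measure dominates the increments of [v]. Letting
    [s] grow gives absolute continuity, and comparing densities for all rational [s] bounds the
    [p]-th power of [|g|] by the density of the limit energy [mH]. *)
Lemma limit_primitive : exists2 g, is_primitive v g &
  (\int[mu]_(x in D) (`|g x| `^ p)%:E <= Q%:E)%E.
Proof.
have [mH [mQ mHY]] := limit_measure.
pose iD x : R := 1 * \1_D x.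
have muD : (mu D < +oo)%E.
  by rewrite lebesgue_measure_itv/=; case: ifP => //; rewrite ltry.
have iiD : mu.-integrable setT (EFin \o iD).
  rewrite (_ : iD = (fun _ : R => 1 : R) \_ D).
    apply/(integrable_restrictT _ mD); apply: measurable_bounded_integrable => //.
    exact: bounded_cst.
  apply/funext => x; rewrite /iD; have [xD|xD] := pselect (D x).
    by rewrite restrict_id// (indic_bool (e := true)) ?mulr1.
  by rewrite restrict_out// (indic_bool (e := false)) ?mulr0.
have iDE (A : set R) : measurable A -> \int[mu]_(x in A) iD x = fine (mu (A `&` D)).
  by move=> mA; rewrite Rintegral_indic_mul Rintegral_cst ?mul1r//; exact: measurableI.
have iD01 x : 0 <= iD x <= 1.
  by rewrite /iD mul1r indicE; case: (_ \in _); rewrite ?ler01 ?lexx.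
have [kD kDE] := density_measureR iiD (fun x => proj1 (andP (iD01 x))).
have kap s : exists k : {finite_measure set TR -> \bar R}, forall A : set R, measurable A ->
    k A = ((al s)^-1 * (fine (mH A) + be s * \int[mu]_(x in A) iD x))%:E.
  have [k1 k1E] := scale_measure kD (ltW (be0 s)).
  have [k2 [k2E _]] := sum_measure mH k1.
  have al0' : 0 <= (al s)^-1 by rewrite invr_ge0 ltW.
  have [k3 k3E] := scale_measure k2 al0'.
  exists k3 => A mA; rewrite k3E// k2E// fineD ?fin_num_measure// k1E// kDE//.
have kapV s (k : {finite_measure set TR -> \bar R}) : (forall A : set R, measurable A ->
    k A = ((al s)^-1 * (fine (mH A) + be s * \int[mu]_(x in A) iD x))%:E) ->
    forall x y, x < y -> `|v y - v x| <= fine (k `]x, y]%classic).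
  move=> kE x y xy; rewrite kE//= ler_pdivlMl// iDE//; exact: mHY.
have [k0 k0E] := kap 0.
have [||g ig gE] := @absolutely_continuous_density R v k0.
- exact: kapV k0E.
(* On a null set only the [mH] term of the dominating measure survives, and division by a large
   [al s] makes it at most [e]. *)
- move=> N e mN N0 e0.
  have c0 : 0 < (fine (mH setT) + 1) / e by rewrite divr_gt0// ltr_wpDl// fine_ge0.
  have [s hs] := large c0; have [k kE] := kap s.
  exists k; split; first exact: kapV kE.
  rewrite kE// iDE// (_ : mu (N `&` D) = 0%E); last first.
    by apply: subset_measure0 N0 => //; exact: measurableI.
  rewrite mulr0 addr0 lee_fin ler_pdivrMl//.
  move: hs; rewrite ler_pdivrMr// => hs; apply: le_trans hs.
  rewrite (@le_trans _ _ (fine (mH setT)))// ?lerDl//.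
  by rewrite fine_le ?fin_num_measure// le_measure ?inE.
have vg : is_primitive v g.
  by split => // x y xy; apply: EFin_inj; rewrite EFin_Rintegral// gE.
exists g => //.
have [N [h1 [mN N0 ih1 hE]]] := lebesgue_decomp_measure mH.
have mCN : measurable (~` N) by exact: measurableC.
have hE' (A : set R) : measurable A -> fine (mH (A `&` ~` N)) = \int[mu]_(x in A) h1 x.
  move=> mA; have mAC : measurable (A `&` ~` N) by exact: measurableI.
  by rewrite hE// -setIA setICl setI0 measure0 adde0/= (null_Rintegral mA mN N0 ih1).1.
(* Leaving out the null set [N] changes no integral of [g] and removes the singular part of [mH], so
   only the density [h1] enters the bound. *)
pose wf s x := (al s)^-1 * (h1 x + be s * iD x).
have iw s : mu.-integrable setT (EFin \o wf s).
  by apply: integrableZT; apply: integrableDT => //; exact: integrableZT.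
have key s : {ae mu, forall x, `|g x| <= wf s x}.
  have [k kE] := kap s.
  have bnd (A : set R) : measurable A -> `|\int[mu]_(x in A) g x| <= \int[mu]_(x in A) wf s x.
    move=> mA; have mAC : measurable (A `&` ~` N) by exact: measurableI.
    rewrite (null_Rintegral mA mN N0 ig).1.
    apply: (le_trans (is_primitive_dominated vg (kapV _ _ kE) mAC)).
    rewrite kE//= hE'// -(null_Rintegral mA mN N0 iiD).1.
    by rewrite /wf Rintegral_lin.
  have g1 := @ae_le_Rintegral R g (wf s) ig (iw s).
  have g2 := @ae_le_Rintegral R (fun x => - 1 * g x) (wf s) (integrableZT (- 1) ig) (iw s).
  apply: ae_imply2 (g1 _) (g2 _) => [x a1 a2|A mA|A mA].
  - by rewrite ler_norml a1 andbT lerNl -mulN1r.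
  - by apply: le_trans (bnd _ mA); exact: ler_norm.
  - rewrite RintegralZl//; last exact: integrableT.
    by rewrite mulN1r; apply: le_trans (bnd _ mA); rewrite -normrN ler_norm.
have h1_ge0 : {ae mu, forall x, 0 <= h1 x}.
  have i0 : mu.-integrable setT (EFin \o (fun=> 0 : R)) by exact: integrable0.
  apply: (ae_le_Rintegral i0 ih1) => A mA.
  by rewrite Rintegral_cst// mul0r -hE'// fine_ge0.
(* Enumerating the rationals keeps the union of the exceptional sets null; codes that represent no
   rational are sent to 0. *)
have gh : {ae mu, forall x, `|g x| `^ p <= h1 x}.
  have := ae_foralln (fun n => key (if unpickle n is Some r then ratr (r : rat) else 0)).
  apply: ae_imply2 h1_ge0 => x h1x H.
  apply: expR_family_bound => // r; have := H (pickle r); rewrite pickleK /wf.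
  rewrite ler_pdivlMl// => /le_trans; apply; rewrite lerD2l ler_piMr ?(ltW (be0 _))//.
  by have /andP[] := iD01 x.
have mg : measurable_fun D g := integrableT_measurable ig.
have mh1 : measurable_fun D h1 := integrableT_measurable ih1.
apply: (@le_trans _ _ (\int[mu]_(x in D) `|h1 x|%:E)%E).
  apply: ae_ge0_le_integral => //.
  - by apply/measurable_EFinP; exact: measurable_normp.
  - by apply/measurable_EFinP; exact: measurableT_comp.
  by apply: ae_imply gh => x ghx _; rewrite lee_fin (le_trans ghx)// ler_norm.
have -> : (\int[mu]_(x in D) `|h1 x|%:E = (\int[mu]_(x in D) h1 x)%:E)%E.
  rewrite EFin_Rintegral//; apply: ae_eq_integral => //.
  - by apply/measurable_EFinP; exact: measurableT_comp.
  - exact/measurable_EFinP.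
  by apply: ae_imply h1_ge0 => x h1x _; rewrite ger0_norm.
apply: le_trans mQ; rewrite -hE'// -[leRHS]fineK ?fin_num_measure// lee_fin.
by rewrite fine_le ?fin_num_measure ?le_measure ?inE//; exact: measurableI.
Qed.

End young_inequality_limit.
End compactness.

(** * Local averages and the points where they diverge *)

Section averages.
Context {R : realType}.
Local Notation TR := (measurableTypeR R).
Local Notation mu := (@lebesgue_measure R).
Implicit Types (w v : R -> R).

Lemma average_le w x d e T : mu.-integrable setT (EFin \o w) ->
  {ae mu, forall t, `]x - d, x + d[%classic t -> w t <= T} -> 0 < e <= d ->
  average w x e <= T.
Proof.
move=> iw wT /andP[e0 ed].
have mI : measurable (`]x - e, x + e[%classic : set R) by exact: measurable_itv.
have muI : fine (mu `]x - e, x + e[%classic) = 2 * e.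
  rewrite lebesgue_measure_itv/= lte_fin ifT/=; first by ring.
  by lra.
pose J : set R := `]x - e, x + e[%classic.
have muI' : (mu J < +oo)%E.
  by rewrite lebesgue_measure_itv/=; case: ifP => //; rewrite ltry.
rewrite /average ler_pdivrMl ?mulr_gt0//.
have -> : 2 * e * T = \int[mu]_(y in `]x - e, x + e[) T by rewrite Rintegral_cst// muI mulrC.
have iT : mu.-integrable `]x - e, x + e[ (EFin \o (fun=> T)).
  by apply: measurable_bounded_integrable => //; exact: bounded_cst.
have iwI : mu.-integrable `]x - e, x + e[ (EFin \o w) by exact: integrableT.
have mw : measurable_fun `]x - e, x + e[ w := integrableT_measurable iw.
(* The bound on [w] holds only almost everywhere; taking the minimum with [T] makes it pointwise
   without changing the integral. *)
have -> : \int[mu]_(y in `]x - e, x + e[) w y = \int[mu]_(y in `]x - e, x + e[) Num.min (w y) T.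
  rewrite /Rintegral; congr fine; apply: ae_eq_integral => //.
  - exact/measurable_EFinP.
  - by apply/measurable_EFinP; exact: measurable_minr.
  apply: ae_imply wT => t h; rewrite /= in_itv/= => /andP[t1 t2].
  rewrite min_l// h//= in_itv/=; apply/andP; split; lra.
apply: le_Rintegral => //.
- apply: (@le_integrable _ _ _ mu _ _ _ (fun y => (`|w y| - - `|T|)%:E)) => //.
  + by apply/measurable_EFinP; exact: measurable_minr.
  + move=> y _ /=; rewrite lee_fin opprK [leRHS]ger0_norm ?addr_ge0//.
    by rewrite /Num.min; case: ifP => _; rewrite ?lerDl ?lerDr.
  + apply: (integrable_sub mI (f := fun y => `|w y|) (g := fun=> - `|T|)).
      by apply: integrableT => //; exact: integrable_normT.
    by apply: measurable_bounded_integrable => //; exact: bounded_cst.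
- by move=> y _; rewrite ge_min lexx orbT.
Qed.

Lemma average_opp w x e : mu.-integrable setT (EFin \o w) ->
  average (fun t => - w t) x e = - average w x e.
Proof.
move=> iw; have mI : measurable (`]x - e, x + e[%classic : set R) by exact: measurable_itv.
rewrite /average; have -> : \int[mu]_(y in `]x - e, x + e[) (- w y) = \int[mu]_(y in `]x - e, x + e[) (-1 * w y).
  by apply: eq_Rintegral => y _; rewrite mulN1r.
by rewrite RintegralZl//; [ring|exact: integrableT].
Qed.

Lemma average_ge w x d e T : mu.-integrable setT (EFin \o w) ->
  {ae mu, forall t, `]x - d, x + d[%classic t -> T <= w t} -> 0 < e <= d ->
  T <= average w x e.
Proof.
move=> iw wT ed; rewrite -lerN2 -average_opp//.
apply: average_le ed => //; first exact: integrableNT.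
by apply: ae_imply wT => t + tI => /(_ tI); rewrite lerN2.
Qed.

Lemma average_cvg_pinfty w x : mu.-integrable setT (EFin \o w) ->
  (forall T, exists2 d, 0 < d & {ae mu, forall t, `]x - d, x + d[%classic t -> T <= w t}) ->
  average w x e @[e --> 0^'+] --> +oo.
Proof.
move=> iw H; apply/cvgryPge => T; have [d d0 hd] := H T.
near=> e; apply: average_ge hd _ => //; apply/andP; split.
  by near: e; exact: nbhs_right_gt.
by near: e; exact: nbhs_right_le.
Unshelve. all: by end_near. Qed.

Lemma average_cvg_ninfty w x : mu.-integrable setT (EFin \o w) ->
  (forall T, exists2 d, 0 < d & {ae mu, forall t, `]x - d, x + d[%classic t -> w t <= T}) ->
  average w x e @[e --> 0^'+] --> -oo.
Proof.
move=> iw H; apply/cvgrNyPle => T; have [d d0 hd] := H T.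
near=> e; apply: average_le hd _ => //; apply/andP; split.
  by near: e; exact: nbhs_right_gt.
by near: e; exact: nbhs_right_le.
Unshelve. all: by end_near. Qed.

Lemma ae_ball_sub a b (P : R -> Prop) x : a < x < b ->
  {ae mu, forall t, `]a, b[%classic t -> P t} ->
  exists2 d, 0 < d & forall d', d' <= d -> {ae mu, forall t, `]x - d', x + d'[%classic t -> P t}.
Proof.
move=> /andP[ax xb] h; exists (Num.min (x - a) (b - x)).
  by rewrite lt_min !subr_gt0 ax.
move=> d'; rewrite le_min => /andP[d1 d2]; apply: ae_imply h => t + tI; apply.
by move: tI; rewrite /= !in_itv/= => /andP[t1 t2]; apply/andP; split; lra.
Qed.

Lemma min_clamp (n t : R) : 0 <= n -> Num.max (clamp (- n) n t) 0 = Num.min (Num.max t 0) n.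
Proof.
move=> n0; have nn : - n <= n by lra.
have [tl|lt] := leP t (- n).
  rewrite clamp_lo// max_r ?oppr_le0// (@max_r _ _ t) ?min_l//.
  by rewrite (le_trans tl)// oppr_le0.
have [th|ht] := leP t n; first by rewrite clamp_id ?(ltW lt)// min_l// ge_max th.
rewrite (clamp_hi nn (ltW ht)) max_l// min_r// le_max (ltW ht)//.
Qed.
Section divergence_sets.
Context (a b : R) (G v w : R -> R) (Gh : {homo G : x y / x < y}) (vc : continuous v)
  (iw : mu.-integrable setT (EFin \o w))
  (Gw : {ae mu, forall t, `]a, b[%classic t -> G (w t) = v t}).

Let Ghom x y : (G x <= G y) = (x <= y).
Proof. by rewrite (leW_mono (le_mono Gh)) || exact: (le_mono Gh). Qed.

Let near_gt x s : a < x < b -> s < v x ->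
  exists2 d, 0 < d & {ae mu, forall t, `]x - d, x + d[%classic t -> s <= G (w t)}.
Proof.
move=> xD sx; have [d1 d10 hd1] := ae_ball_sub xD Gw.
have /cvgr_gt /(_ _ sx) /nbhs_ballP[d2 /= d20 hd2] := vc (x := x).
exists (Num.min d1 d2); first by rewrite lt_min d10.
have /hd1 : Num.min d1 d2 <= d1 by rewrite ge_min lexx.
apply: ae_imply => t + tI => /(_ tI) ->; apply: ltW; apply: hd2.
have m2 : Num.min d1 d2 <= d2 by rewrite ge_min lexx orbT.
move: tI; rewrite /= in_itv/= => /andP[t1 t2]; rewrite /ball /= ltr_norml.
by move: (Num.min d1 d2) m2 t1 t2 => z *; apply/andP; split; lra.
Qed.

Let near_lt x s : a < x < b -> v x < s ->
  exists2 d, 0 < d & {ae mu, forall t, `]x - d, x + d[%classic t -> G (w t) <= s}.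
Proof.
move=> xD sx; have [d1 d10 hd1] := ae_ball_sub xD Gw.
have /cvgr_lt /(_ _ sx) /nbhs_ballP[d2 /= d20 hd2] := vc (x := x).
exists (Num.min d1 d2); first by rewrite lt_min d10.
have /hd1 : Num.min d1 d2 <= d1 by rewrite ge_min lexx.
apply: ae_imply => t + tI => /(_ tI) ->; apply: ltW; apply: hd2.
have m2 : Num.min d1 d2 <= d2 by rewrite ge_min lexx orbT.
move: tI; rewrite /= in_itv/= => /andP[t1 t2]; rewrite /ball /= ltr_norml.
by move: (Num.min d1 d2) m2 t1 t2 => z *; apply/andP; split; lra.
Qed.

(** Above any level [G n] the continuous [v] stays above it near [x]; monotonicity of [G] turns this
    into [w >= n] almost everywhere nearby, so the averages exceed every bound. *)
Lemma Zpos_intro x : a < x < b -> (forall n : nat, G n%:R <= v x) -> Zpos a b w x.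
Proof.
move=> xD H; split; first by rewrite /= in_itv.
apply: average_cvg_pinfty => // T; pose n := Num.bound `|T|.
have Tn : T <= n%:R by rewrite (le_trans (ler_norm _))// ltW// archi_boundP.
(* The hypothesis at [n.+1] provides the strict inequality that is stable near [x]. *)
have Gn : G n%:R < v x by apply: lt_le_trans (H n.+1); apply: Gh; rewrite ltr_nat.
have [d d0 hd] := near_gt xD Gn; exists d => //.
by apply: ae_imply hd => t + tI => /(_ tI); rewrite Ghom; exact: le_trans.
Qed.

Lemma Zneg_intro x : a < x < b -> (forall n : nat, v x <= G (- n%:R)) -> Zneg a b w x.
Proof.
move=> xD H; split; first by rewrite /= in_itv.
apply: average_cvg_ninfty => // T; pose n := Num.bound `|T|.
have Tn : - n%:R <= T.
  by rewrite lerNl (le_trans (ler_norm _))// normrN ltW// archi_boundP.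
have Gn : v x < G (- n%:R) by apply: le_lt_trans (H n.+1) _; apply: Gh; rewrite ltrN2 ltr_nat.
have [d d0 hd] := near_lt xD Gn; exists d => //.
by apply: ae_imply hd => t + tI => /(_ tI); rewrite Ghom => /le_trans; exact.
Qed.

(** If [v x < G t], then [w <= t] almost everywhere near [x], and the averages could not exceed
    [t]. *)
Lemma Zpos_elim x t : Zpos a b w x -> G t <= v x.
Proof.
move=> [xD /cvgryPge/(_ (t + 1)) av]; rewrite leNgt; apply/negP => lt.
have xD' : a < x < b by move: xD; rewrite /= in_itv.
have [d d0 hd] := near_lt xD' lt.
have : \forall e \near (0 : R)^'+, False.
  near=> e.
  have : average w x e <= t.
    apply: (@average_le w x d) => //.
      by apply: ae_imply hd => s + sI => /(_ sI); rewrite Ghom.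
    apply/andP; split; first by near: e; exact: nbhs_right_gt.
    by near: e; exact: nbhs_right_le.
  have : t + 1 <= average w x e by near: e.
  lra.
by move=> /filter_ex[].
Unshelve. all: by end_near. Qed.

Lemma Zneg_elim x t : Zneg a b w x -> v x <= G t.
Proof.
move=> [xD /cvgrNyPle/(_ (t - 1)) av]; rewrite leNgt; apply/negP => lt.
have xD' : a < x < b by move: xD; rewrite /= in_itv.
have [d d0 hd] := near_gt xD' lt.
have : \forall e \near (0 : R)^'+, False.
  near=> e.
  have : t <= average w x e.
    apply: (@average_ge w x d) => //.
      by apply: ae_imply hd => s + sI => /(_ sI); rewrite Ghom.
    apply/andP; split; first by near: e; exact: nbhs_right_gt.
    by near: e; exact: nbhs_right_le.
  have : average w x e <= t - 1 by near: e.
  lra.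
by move=> /filter_ex[].
Unshelve. all: by end_near. Qed.
End divergence_sets.
End averages.

Section clamp_facts.
Context {R : realType}.
Lemma max_lip (x y : R) : `|Num.max x 0 - Num.max y 0| <= `|x - y|.
Proof.
have [x0|x0] := leP 0 x; have [y0|y0] := leP 0 y; rewrite ?subrr ?normr0 ?subr0 ?sub0r ?normrN//.
  by rewrite ger0_norm// (le_trans _ (ler_norm _))// lerDl oppr_ge0 ltW.
by rewrite ger0_norm// distrC (le_trans _ (ler_norm _))// lerDl oppr_ge0 ltW.
Qed.

Lemma clampN (n t : R) : 0 <= n -> - clamp (- n) n t = clamp (- n) n (- t).
Proof.
move=> n0; have nn : - n <= n by lra.
have [tl|lt] := leP t (- n).
  by rewrite (clamp_lo nn tl) clamp_hi ?opprK// lerNr.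
have [th|ht] := leP t n.
  by rewrite !clamp_id ?(ltW lt)// lerN2 th lerNl ltW.
by rewrite (clamp_hi nn (ltW ht)) clamp_lo// lerN2 ltW.
Qed.
End clamp_facts.

(** * Limits of sequences of bounded energy *)

Section lower_bound.
Context {R : realType} (p : R) (psi : R -> R) (p1 : 1 < p)
  (psi_borel : measurable_fun setT psi)
  (psi_gt0 : forall t : R, 0 < psi t)
  (psi_bounded : bounded_fun psi)
  (psi_root_integral :
    (\int[lebesgue_measure]_(t in setT) (psi t `^ p^-1)%:E < +oo)%E)
  (psi_inf : forall K : set R, compact K ->
    (0 < ereal_inf [set (psi t)%:E | t in K])%E)
  (a b : R) (ab : a < b).
Local Notation TR := (measurableTypeR R).
Local Notation mu := (@lebesgue_measure R).
Local Notation G := (PsiR p psi).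
Local Notation M := (PsiM p psi).
Local Notation rt := (root p psi).
Let D : set R := `]a, b[%classic.
Let mD : measurable D. Proof. exact: measurable_itv. Qed.

Let Gc : continuous G. Proof. exact: PsiR_continuous. Qed.
Let Glt : {homo G : x y / x < y}. Proof. exact: PsiR_lt. Qed.
Let G0 t : 0 < G t. Proof. exact: PsiR_gt0. Qed.
Let GM t : G t < M. Proof. exact: PsiR_ltM. Qed.
Let Gle x y : (G x <= G y) = (x <= y). Proof. exact: (le_mono Glt). Qed.
Let Gltm x y : (G x < G y) = (x < y). Proof. exact: (leW_mono (le_mono Glt)). Qed.

Lemma root_powR t : rt t `^ p = psi t.
Proof.
have p0 : p != 0 by rewrite gt_eqF// (lt_trans ltr01).
by rewrite /root -powRrM mulVf// powRr1// ltW.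
Qed.

(** The general inverse is built for positive heights; at height 0 the constant function 0 meets all
    the requirements. *)
Lemma PsiR_inverse_nat (n : nat) : exists W : R -> R, exists2 L, 0 < L &
    [/\ forall s t, `|W s - W t| <= L * `|s - t|,
        forall t, W (G t) = clamp (- n%:R) n%:R t,
        forall s, G n%:R <= s -> W s = n%:R, forall s, s <= G (- n%:R) -> W s = - n%:R &
        forall s, - n%:R <= W s <= n%:R /\ G (W s) = clamp (G (- n%:R)) (G n%:R) s].
Proof.
case: n => [|n]; last by apply: PsiR_inverse => //; rewrite ltr0n.
exists (fun=> 0), 1 => //; split => //.
- by move=> s t; rewrite subrr normr0 mul1r.
- move=> t; have := @clamp_in R (- 0) 0 t; rewrite oppr0 lexx => /(_ isT).
  by rewrite -eq_le => /eqP.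
- by rewrite oppr0.
- move=> s; rewrite oppr0 lexx; split => //.
  by have := clamp_in s (lexx (G 0)); rewrite -eq_le => /eqP.
Qed.

Section bounded_energy_sequence.
Context (f g : nat -> R -> R) (cc : nat -> R) (u : R -> R) (C : R)
  (fg : forall k, is_primitive (f k) (g k))
  (g0 : forall k x, ~ D x -> g k x = 0)
  (EC : forall k, (\int[mu]_(x in D) `|f k x|%:E +
     \int[mu]_(x in D) (psi (f k x) * `|g k x| `^ p)%:E <= C%:E)%E)
  (iu : mu.-integrable D (EFin \o u))
  (uc : {ae mu, forall x, D x ->
     cc k + \int[mu]_(t in `]a, x]) f k t @[k --> \oo] --> u x}).

Let h k x := psi (f k x) * `|g k x| `^ p.
Let qp k x := Num.max (f k x) 0.
Let qn k x := Num.max (- f k x) 0.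
Let v_ k x := G (f k x).

Let p0 : 0 < p. Proof. exact: lt_trans p1. Qed.
Let h_ge0 k x : 0 <= h k x. Proof. by rewrite mulr_ge0 ?powR_ge0// ltW. Qed.
Let h_out k x : ~ D x -> h k x = 0.
Proof. by move=> xD; rewrite /h g0// normr0 powR0 ?mulr0// gt_eqF. Qed.
Let mf k : measurable_fun setT (f k) := is_primitive_measurable (fg k).
Let mg k : measurable_fun setT (g k) := integrableT_measurable (proj1 (fg k)).
Let mh k : measurable_fun setT (h k).
Proof. by apply: measurable_funM; [exact: measurableT_comp|exact: measurable_normp]. Qed.
Let cf k : continuous (f k) := is_primitive_continuous (fg k).

Let E1 k : (0 <= \int[mu]_(x in D) `|f k x|%:E)%E. Proof. exact: integral_ge0. Qed.
Let E2 k : (0 <= \int[mu]_(x in D) (h k x)%:E)%E.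
Proof. by apply: integral_ge0 => x _; rewrite lee_fin. Qed.

Let ihk k : mu.-integrable setT (EFin \o h k).
Proof.
have -> : h k = h k \_ D.
  apply/funext => x; have [xD|xD] := pselect (D x); first by rewrite restrict_id.
  by rewrite restrict_out// h_out.
apply/(integrable_restrictT _ mD)/integrableP; split.
  by apply/measurable_EFinP; apply: measurable_funTS; exact: mh.
have -> : (\int[mu]_(x in D) `|(EFin \o h k) x| = \int[mu]_(x in D) (h k x)%:E)%E.
  by apply: eq_integral => x _ /=; rewrite ger0_norm.
by apply: (@le_lt_trans _ _ C%:E); [apply: le_trans (EC k); rewrite leeDr|rewrite ltry].
Qed.

Let ifD (q : R -> R) : continuous q -> mu.-integrable setT (EFin \o (q \_ D)).
Proof.
move=> cq; apply/(integrable_restrictT _ mD); have [B B0 qB] := bounded_on_itv a b cq.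
apply: measurable_bounded_integrable => //.
  have muD : (mu D < +oo)%E by rewrite lebesgue_measure_itv/=; case: ifP => //; rewrite ltry.
  exact: muD.
  by apply: measurable_funTS; exact: continuous_measurable_fun.
exists B; split; first exact: num_real.
move=> N ltN x /=; rewrite /D /= in_itv/= => /andP[/ltW ax /ltW xb].
by rewrite (le_trans (qB _ _)) ?ax// ltW.
Qed.

Let cqp k : continuous (qp k).
Proof. by move=> x; apply: (@continuous_max _ _ (f k) (fun=> 0)) => //; exact: cf || exact: cvg_cst. Qed.
Let cqn k : continuous (qn k).
Proof.
move=> x; apply: (@continuous_max _ _ (fun x => - f k x) (fun=> 0)); last exact: cvg_cst.
by apply: cvgN; exact: cf.
Qed.

Let Rsum k : \int[mu]_x (qp k \_ D) x + \int[mu]_x (qn k \_ D) x + \int[mu]_x h k x <= C.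
Proof.
rewrite -RintegralD//; [|exact: ifD|exact: ifD].
have -> : \int[mu]_x ((qp k \_ D) x + (qn k \_ D) x) = \int[mu]_(x in D) `|f k x|.
  rewrite [RHS]Rintegral_indicT; apply: eq_Rintegral => x _.
  have [xD|xD] := pselect (D x).
    rewrite !restrict_id// (indic_bool (e := true))// mulr1 /qp /qn.
    have [h'|h'] := leP 0 (f k x).
      by rewrite max_r ?oppr_le0// addr0 ger0_norm.
    by rewrite max_l ?oppr_ge0 ?(ltW h')// add0r ltr0_norm.
  by rewrite !restrict_out// (indic_bool (e := false)) ?mulr0 ?addr0.
have -> : \int[mu]_x h k x = \int[mu]_(x in D) h k x.
  rewrite [RHS]Rintegral_indicT; apply: eq_Rintegral => x _.
  have [xD|xD] := pselect (D x); first by rewrite (indic_bool (e := true)) ?mulr1.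
  by rewrite h_out// mul0r.
have := EC k; rewrite -lee_fin EFinD.
have -> : (\int[mu]_(x in D) `|f k x|)%:E = (\int[mu]_(x in D) `|f k x|%:E)%E.
  rewrite /Rintegral fineK// ge0_fin_numE//.
  by apply: (@le_lt_trans _ _ C%:E); [apply: le_trans (EC k); rewrite leeDl//; exact: E2|rewrite ltry].
by rewrite EFin_Rintegral.
Qed.

Let I0 (q : R -> R) : (forall x, 0 <= q x) -> 0 <= \int[mu]_x (q \_ D) x.
Proof. by move=> q0; apply: Rintegral_ge0 => x _; rewrite /patch; case: ifP. Qed.
Let qp0 k x : 0 <= qp k x. Proof. by rewrite /qp le_max lexx orbT. Qed.
Let qn0 k x : 0 <= qn k x. Proof. by rewrite /qn le_max lexx orbT. Qed.

Let bounds k : [/\ \int[mu]_x (qp k \_ D) x <= C, \int[mu]_x (qn k \_ D) x <= C &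
  \int[mu]_x h k x <= C].
Proof.
have h1 := I0 (qp0 k); have h2 := I0 (qn0 k).
have h3 : 0 <= \int[mu]_x h k x by exact: Rintegral_ge0.
have := Rsum k; move: h1 h2 h3; move: (\int[mu]_x _) (\int[mu]_x _) (\int[mu]_x _) => x y z *.
by split; lra.
Qed.

(** [v_ k] has derivative [root (f k) * g k], and the [p]-th power of its absolute value is [h k].
    Young's inequality is integrated pointwise inside [D]; outside [D] every term vanishes. *)
Let Y s k x y : x < y -> p * expR ((p - 1) * s) * `|v_ k y - v_ k x| <=
     \int[mu]_(t in `]x, y]) h k t + (p - 1) * expR (p * s) *
       fine (mu (`]x, y]%classic `&` `]a, b[%classic)).
Proof.
move=> xy.
have mI : measurable (`]x, y]%classic : set R) by exact: measurable_itv.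
have [B HB] : exists B, forall t, 0 <= rt t <= B by exact: root_bounded.
have Gp : is_primitive G rt by exact: PsiR_primitive.
have mrt : measurable_fun setT rt by exact: measurable_root.
have rt0 t : 0 < rt t by exact: root_gt0.
have [iv vE] : is_primitive (v_ k) (fun x => rt (f k x) * g k x).
  apply: (is_primitive_comp (fg k) mrt HB) => s' t st.
  exact: (proj2 Gp).
pose al := p * expR ((p - 1) * s); pose be := (p - 1) * expR (p * s).
have al0 : 0 <= al by rewrite mulr_ge0 ?expR_ge0// ltW.
have iav := integrable_normT iv.
rewrite -vE// -/al -/be.
have le1 : `|\int[mu]_(t in `]x, y]) (rt (f k t) * g k t)| <= \int[mu]_(t in `]x, y]) `|rt (f k t) * g k t|.
  by apply: le_normr_Rintegral => //; exact: integrableT.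
apply: (@le_trans _ _ (al * \int[mu]_(t in `]x, y]) `|rt (f k t) * g k t|)); first by rewrite ler_wpM2l.
rewrite -RintegralZl//; last exact: integrableT.
pose iD x : R := 1 * \1_D x.
have iiD : mu.-integrable setT (EFin \o iD).
  rewrite (_ : iD = (fun _ : R => 1 : R) \_ D); first by apply: ifD; exact: cst_continuous.
  apply/funext => z; rewrite /iD; have [xD|xD] := pselect (D z).
    by rewrite restrict_id// (indic_bool (e := true)) ?mulr1.
  by rewrite restrict_out// (indic_bool (e := false)) ?mulr0.
have -> : fine (mu (`]x, y]%classic `&` `]a, b[%classic)) = \int[mu]_(t in `]x, y]) iD t.
  by rewrite Rintegral_indic_mul Rintegral_cst ?mul1r//; exact: measurableI.
have := Rintegral_lin 1 be mI (ihk k) iiD; rewrite mul1r => <-.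
apply: le_Rintegral => //.
- by apply: integrableT => //; exact: integrableZT.
- apply: integrableT => //; apply: integrableZT.
  by apply: integrableDT => //; exact: integrableZT.
move=> t _; rewrite mul1r normrM.
rewrite (ger0_norm (ltW (rt0 (f k t)))).
have [tD|tD] := pselect (D t); last by rewrite g0// normr0 !mulr0 h_out// add0r /iD indicE memNset// !mulr0.
rewrite /iD (indic_bool (e := true))// !mulr1.
have := @young_exp R p (rt (f k t) * `|g k t|) s p1.
rewrite mulr_ge0 ?(ltW (rt0 _))// => /(_ isT).
by rewrite powRM ?root_powR// ltW.
Qed.

Let lim_exists (U : set_system nat) {FU : UltraFilter U} (x : nat -> R) : (forall k, 0 <= x k <= C) ->
  exists l : R, x k @[k --> U] --> l.
Proof.
by move=> xC; apply: (@ultra_bounded_cvg _ _ _ _ C) => k; have /andP[x0 xc] := xC k; rewrite ger0_norm.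
Qed.

Let part (q : nat -> R -> R) : (forall k, continuous (q k)) -> (forall k x, 0 <= q k x) ->
  (forall k, \int[mu]_x (q k \_ D) x <= C) ->
  forall (U : set_system nat) {FU : UltraFilter U}, exists P : R -> R, exists Q : R,
  (forall x, \int[mu]_(t in `]-oo, x]) (q k \_ D) t @[k --> U] --> P x) /\
  (\int[mu]_t (q k \_ D) t @[k --> U] --> Q).
Proof.
move=> cq q0 qC U FU.
have qD0 k x : 0 <= (q k \_ D) x by rewrite /patch; case: ifP.
have /choice[P PE] : forall x, exists l : R, \int[mu]_(t in `]-oo, x]) (q k \_ D) t @[k --> U] --> l.
  move=> x; apply: lim_exists => k; rewrite Rintegral_ge0//=.
  by apply: le_trans (qC k); apply: subset_Rintegral => //; exact: ifD.
have [Q QE] : exists l : R, \int[mu]_t (q k \_ D) t @[k --> U] --> l.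
  by apply: lim_exists => k; rewrite I0//= qC.
by exists P, Q.
Qed.

Let vk_cvg (U : set_system nat) {FU : UltraFilter U} :
  exists v : R -> R, (forall x, v_ k x @[k --> U] --> v x) /\ forall x, 0 <= v x <= M.
Proof.
have vB k x : 0 <= v_ k x <= M by rewrite (ltW (G0 _)) (ltW (GM _)).
have /choice[v vE] : forall x, exists l : R, v_ k x @[k --> U] --> l.
  move=> x; apply: (@ultra_bounded_cvg _ _ _ _ M) => k.
  by have /andP[x0 xc] := vB k x; rewrite ger0_norm.
exists v; split => // x; apply/andP; split.
  by apply: (cvgr_to_ge (vE x)); apply: filterS filterT => k _; have /andP[] := vB k x.
by apply: (cvgr_to_le (vE x)); apply: filterS filterT => k _; have /andP[] := vB k x.
Qed.

Let split_f k x : D x -> \int[mu]_(t in `]a, x]) f k t =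
  \int[mu]_(t in `]-oo, x]) (qp k \_ D) t - \int[mu]_(t in `]-oo, x]) (qn k \_ D) t.
Proof.
move=> xD; rewrite -RintegralB//; last 2 first.
- by apply: integrableT => //; exact: ifD.
- by apply: integrableT => //; exact: ifD.
rewrite [LHS]Rintegral_indicT [RHS]Rintegral_indicT; apply: eq_Rintegral => t _.
move: xD; rewrite /D /= in_itv/= => /andP[ax xb].
have [tD|tD] := pselect (D t); last first.
  rewrite !restrict_out// subrr mul0r indicE memNset ?mulr0//= in_itv/= => /andP[at_ tx].
  by apply: tD; rewrite /D /= in_itv/= at_ (le_lt_trans tx).
rewrite !restrict_id//; congr (_ * _).
  rewrite /qp /qn; have [h'|h'] := leP 0 (f k t).
    by rewrite max_r ?oppr_le0// subr0.
  by rewrite max_l ?oppr_ge0 ?(ltW h')// sub0r opprK.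
rewrite !indicE; congr (nat_of_bool _)%:R; apply/idP/idP; rewrite !inE /= !in_itv/=.
  by move=> /andP[].
by move=> ->; rewrite andbT; move: tD; rewrite /D /= in_itv/= => /andP[].
Qed.

Let Glimhi s : (forall n : nat, G n%:R <= s) -> M <= s.
Proof.
move=> H; rewrite leNgt; apply/negP => sM.
have sM' : 0 < M - s by rewrite subr_gt0.
have [n] : exists n : nat, M - (M - s) < G n%:R by exact: PsiR_hi.
by rewrite subKr ltNge H.
Qed.

Let Glimlo s : (forall n : nat, s <= G (- n%:R)) -> s <= 0.
Proof.
move=> H; rewrite leNgt; apply/negP => s0.
have [n] : exists n : nat, G (- n%:R) < s by exact: PsiR_lo.
by rewrite ltNge H.
Qed.

(** All limit objects are taken along one ultrafilter, which makes them compatible. [m1] and [m2]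
    are the limits of the measures with densities the positive and negative parts of [f k]. [Q1],
    [Q2], [Q3] are the limits of the three contributions to the energy, so their sum inherits the
    bound [C] although each is used separately. *)
Lemma lower_structure : exists (m1 m2 : {finite_measure set TR -> \bar R}) (c : R) (v w gg : R -> R)
    (Zp Zn : set R) (Q1 Q2 Q3 : R),
  [/\ [/\ Zp = [set x | forall n : nat, G n%:R <= v x],
          Zn = [set x | forall n : nat, v x <= G (- n%:R)],
          measurable Zp /\ measurable Zn & mu (Zp `&` D) = 0%E /\ mu (Zn `&` D) = 0%E],
      [/\ (m1 setT <= Q1%:E)%E, (m2 setT <= Q2%:E)%E & Q1 + Q2 + Q3 <= C],
      [/\ mu.-integrable setT (EFin \o (w \_ D)),
          forall x, ~ Zp x -> ~ Zn x -> G (w x) = v x &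
          forall A : set R, measurable A -> (m1 (A `&` D) - m2 (A `&` D) =
            (\int[mu]_(x in A) (w \_ D) x)%:E + (m1 (A `&` D `&` Zp) - m2 (A `&` D `&` Zn)))%E],
      {ae mu, forall x, D x -> u x = c + fine (m1 `]-oo, x]%classic) - fine (m2 `]-oo, x]%classic)} &
      is_primitive v gg /\ (\int[mu]_(x in D) (`|gg x| `^ p)%:E <= Q3%:E)%E].
Proof.
have [U [FU Uoo]] := ultraFilterLemma (@eventually_filter).
have [P1 [Q1 [P1E Q1E]]] := @part qp cqp qp0 (fun k => let: And3 h _ _ := bounds k in h) U FU.
have [P2 [Q2 [P2E Q2E]]] := @part qn cqn qn0 (fun k => let: And3 _ h _ := bounds k in h) U FU.
have [v [vE vM]] := @vk_cvg U FU.
have hC k : \int[mu]_x h k x <= C by have [] := bounds k.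
have [Q3 Q3E] : exists l : R, \int[mu]_x h k x @[k --> U] --> l.
  by apply: lim_exists => k; rewrite Rintegral_ge0//= hC.
have cv : continuous v.
  by move=> x; exact: (limit_continuous p1 h_ge0 ihk hC Y vE).
have uv e : 0 < e -> \forall k \near U, forall x, a < x < b -> `|v_ k x - v x| <= e.
  by move=> e0; exact: (limit_uniform ab p1 h_ge0 ihk hC Y vE e0).
have [gg vgg ggQ] := limit_primitive p1 h_ge0 ihk hC Y vE Q3E.
(* Where [v] is 0 or [M] it has no preimage under [G]; the value 0 makes [w1] and [w2] vanish on the
   extreme sets, as the concentration lemma requires. *)
have /choice[w wE] : forall x, exists t, if 0 < v x < M then G t = v x else t = 0.
  move=> x; have [vx|_] := boolP (0 < v x < M); last by exists 0.
  by have [t tE] : exists t, G t = v x; [exact: PsiR_surj|exists t].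
have /choice[W /= /choice[L HL]] : forall n, exists W, exists L, 0 < L /\
    [/\ forall s t, `|W s - W t| <= L * `|s - t|,
        forall t, W (G t) = clamp (- n%:R) n%:R t,
        forall s, G n%:R <= s -> W s = n%:R, forall s, s <= G (- n%:R) -> W s = - n%:R &
        forall s, - n%:R <= W s <= n%:R /\ G (W s) = clamp (G (- n%:R)) (G n%:R) s].
  by move=> n; have [W [L L0 HL]] := PsiR_inverse_nat n; exists W, L.
pose w1 x : R := Num.max (w x) 0; pose w2 x : R := Num.max (- w x) 0.
pose sg1 n := G (n%:R); pose sg2 n := - G (- n%:R).
pose Phi1 n s : R := Num.max (W n s) 0; pose Phi2 n s : R := Num.max (- W n (- s)) 0.
pose Zp := [set x : R | forall n, sg1 n <= v x]; pose Zm := [set x : R | forall n, sg2 n <= - v x].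
have [m1 [[m1Q [c1 c1E]] mZp Zp0 iw1 m1E]] : exists m : {finite_measure set TR -> \bar R},
  [/\ (m setT <= Q1%:E)%E /\
      (exists c, countable [set x | P1 x != c + fine (m `]-oo, x]%classic)]),
      measurable Zp, mu (Zp `&` D) = 0%E,
      mu.-integrable setT (EFin \o (w1 \_ D)) &
      forall A : set R, measurable A ->
        m (A `&` D) = ((\int[mu]_(x in A) (w1 \_ D) x)%:E + m (A `&` D `&` Zp))%E].
  have conc := @concentration R U FU a b ab qp v_ v w1 Phi1 L sg1 P1 Q1 qp0 cqp cv uv.
  apply: conc => //.
  - move=> n s t; have [_ [HL1 _ _ _ _]] := HL n.
    by apply: le_trans (max_lip _ _) (HL1 _ _).
  - move=> n k x; have [_ [_ HL2 _ _ _]] := HL n.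
    by rewrite /Phi1 /v_ HL2 min_clamp// ler0n.
  - move=> n s; have [_ [_ _ _ _ HL5]] := HL n; have [/andP[_ h2] _] := HL5 s.
    by rewrite /Phi1 le_max lexx orbT /= ge_max h2 ler0n.
  - move=> n s hs; have [_ [_ _ HL3 _ _]] := HL n.
    by rewrite /Phi1 HL3// max_l// ler0n.
  - move=> n k x; rewrite /v_ /sg1 Gltm => fx.
    by rewrite /qp ge_max (ltW fx) ler0n.
  - by move=> m n mn; rewrite /sg1 Gle ler_nat.
  - move=> n x vx; have [_ [_ HL2 _ HL4 _]] := HL n; rewrite /w1 /Phi1.
    have := wE x; case: ifPn => [_ wx|].
      rewrite -wx HL2 min_clamp// min_l// ge_max ler0n andbT -Gle wx; exact: ltW.
    have vxM : v x < M by exact: lt_trans vx (GM _).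
    rewrite vxM andbT -leNgt => vx0 ->.
    have Wn : W n (v x) = - n%:R by apply: HL4; apply: le_trans vx0 (ltW (G0 _)).
    by rewrite Wn maxxx max_r// oppr_le0.
  - move=> x Hx; rewrite /w1; have := wE x.
    by rewrite [v x < M]ltNge (Glimhi Hx) andbF => ->; rewrite maxxx.
have [m2 [[m2Q [c2 c2E]] mZn Zn0 iw2 m2E]] : exists m : {finite_measure set TR -> \bar R},
  [/\ (m setT <= Q2%:E)%E /\
      (exists c, countable [set x | P2 x != c + fine (m `]-oo, x]%classic)]),
      measurable Zm, mu (Zm `&` D) = 0%E,
      mu.-integrable setT (EFin \o (w2 \_ D)) &
      forall A : set R, measurable A ->
        m (A `&` D) = ((\int[mu]_(x in A) (w2 \_ D) x)%:E + m (A `&` D `&` Zm))%E].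
  (* The negative part is the positive one for [- v_ k], with thresholds [- G (- n)]. *)
  have cv2 : continuous (fun x => - v x) by move=> x; apply: cvgN; exact: cv.
  have conc := @concentration R U FU a b ab qn (fun k x => - v_ k x) (fun x => - v x) w2 Phi2 L sg2 P2 Q2 qn0 cqn cv2.
  apply: conc => //.
  - move=> e e0; apply: filterS (uv e e0) => k vk x xab.
    by rewrite -opprD normrN; exact: vk.
  - move=> n s t; have [_ [HL1 _ _ _ _]] := HL n.
    apply: le_trans (max_lip _ _) _; rewrite -opprD normrN.
    by apply: le_trans (HL1 _ _) _; rewrite -opprD normrN.
  - move=> n k x; have [_ [_ HL2 _ _ _]] := HL n.
    by rewrite /Phi2 /v_ opprK HL2 clampN ?min_clamp ?ler0n.
  - move=> n s; have [_ [_ _ _ _ HL5]] := HL n; have [/andP[h2 _] _] := HL5 (- s).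
    by rewrite /Phi2 le_max lexx orbT /= ge_max lerNl h2 ler0n.
  - move=> n s hs; have [_ [_ _ _ HL4 _]] := HL n.
    by rewrite /Phi2 HL4 ?opprK ?max_l ?ler0n// lerNl.
  - move=> n k x; rewrite /v_ /sg2 ltrN2 Gltm => fx.
    by rewrite /qn ge_max ler0n andbT lerNl ltW.
  - by move=> m n mn; rewrite /sg2 lerN2 Gle lerN2 ler_nat.
  - move=> n x; rewrite /sg2 ltrN2 => vx; have [_ [_ HL2 HL3 _ _]] := HL n; rewrite /w2 /Phi2 opprK.
    have := wE x; case: ifPn => [_ wx|].
      rewrite -wx HL2 clampN ?min_clamp ?ler0n// min_l// ge_max ler0n andbT lerNl -Gle wx; exact: ltW.
    have vx0 : 0 < v x by exact: lt_trans (G0 _) vx.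
    rewrite vx0 /= -leNgt => vxM ->.
    have Wn : W n (v x) = n%:R by apply: HL3; apply: le_trans (ltW (GM _)) vxM.
    by rewrite Wn oppr0 maxxx max_r// oppr_le0.
  - move=> x Hx; rewrite /w2; have := wE x.
    have vx0 : v x <= 0 by apply: Glimlo => n; rewrite -lerN2; exact: Hx.
    by rewrite [0 < v x]ltNge vx0 /= => ->; rewrite oppr0 maxxx.
have ZnE : Zm = [set x | forall n : nat, v x <= G (- n%:R)].
  by apply/seteqP; split => x Hx n; have := Hx n; rewrite /sg2 lerN2.
rewrite ZnE in m2E mZn Zn0.
have wD x : (w \_ D) x = (w1 \_ D) x - (w2 \_ D) x.
  have [xD|xD] := pselect (D x); last by rewrite !restrict_out// subrr.
  rewrite !restrict_id// /w1 /w2; have [h'|h'] := leP 0 (w x).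
    by rewrite max_r ?oppr_le0// subr0.
  by rewrite max_l ?oppr_ge0 ?(ltW h')// sub0r opprK.
(* One point of convergence makes the constants [cc k] converge, because the integrals of [f k] up
   to that point converge along [U]. *)
have [x0 x0D ux0] : exists2 x0, D x0 & cc k + \int[mu]_(t in `]a, x0]) f k t @[k --> \oo] --> u x0.
  by have [x xD /(_ xD)] := ae_exists ab uc; exists x.
have toU (s : nat -> R) l : s k @[k --> \oo] --> l -> s k @[k --> U] --> l.
  by move=> sl; apply: cvg_trans sl; apply: cvg_app => B; exact: Uoo.
pose c0 := u x0 - (P1 x0 - P2 x0).
have ccE : cc k @[k --> U] --> c0.
  rewrite (_ : cc = fun k => (cc k + \int[mu]_(t in `]a, x0]) f k t) -
    (\int[mu]_(t in `]-oo, x0]) (qp k \_ D) t - \int[mu]_(t in `]-oo, x0]) (qn k \_ D) t)).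
    by apply: cvgB; [exact: toU|apply: cvgB; [exact: P1E|exact: P2E]].
  by apply/funext => k; rewrite split_f// addrK.
have uE : {ae mu, forall x, D x -> u x = c0 + (P1 x - P2 x)}.
  apply: ae_imply uc => x + xD => /(_ xD) /toU h1.
  have h2 : cc k + \int[mu]_(t in `]a, x]) f k t @[k --> U] --> c0 + (P1 x - P2 x).
    rewrite (_ : (fun k => _) = fun k => cc k +
      (\int[mu]_(t in `]-oo, x]) (qp k \_ D) t - \int[mu]_(t in `]-oo, x]) (qn k \_ D) t)).
      by apply: cvgD => //; apply: cvgB; [exact: P1E|exact: P2E].
    by apply/funext => k; rewrite split_f.
  exact: cvg_unique h1 h2.
(* Up to constants, [P1] and [P2] differ from the cumulative functions of [m1] and [m2] only on
   countable sets. *)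
have cnt (B : set R) : countable B -> {ae mu, forall x, ~ B x}.
  move=> cB; exists B; split.
  - exact: countable_measurable.
  - exact: countable_lebesgue_measure0.
  - by move=> x /= /contrapT.
exists m1, m2, (c0 + c1 - c2), v, w, gg, Zp,
  [set x | forall n : nat, v x <= G (- n%:R)], Q1, Q2, Q3; split.
- by split.
- split => //.
  have S3 : \int[mu]_x (qp k \_ D) x + \int[mu]_x (qn k \_ D) x + \int[mu]_x h k x
      @[k --> U] --> Q1 + Q2 + Q3 by apply: cvgD => //; apply: cvgD.
  by apply: (cvgr_to_le S3); apply: filterS filterT => k _; exact: Rsum.
- split.
  + rewrite (_ : w \_ D = fun x => (w1 \_ D) x - (w2 \_ D) x); first exact: integrableBT.
    exact/funext.
  + move=> x nZp nZn; have := wE x; case: ifP => // /negP[].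
    apply/andP; split; rewrite ltNge; apply/negP => h'; [apply: nZn|apply: nZp] => n /=.
      by rewrite (le_trans h')// ltW.
    by apply: le_trans h'; apply: ltW; exact: GM.
  + move=> A mA; rewrite m1E// m2E//.
    have -> : \int[mu]_(x in A) (w \_ D) x = \int[mu]_(x in A) ((w1 \_ D) x - (w2 \_ D) x).
      by apply: eq_Rintegral => x _; rewrite wD.
    rewrite RintegralB//; [|exact: integrableT|exact: integrableT].
    rewrite EFinB fin_num_oppeD ?fin_num_measure//.
      by rewrite addeACA.
    by apply: measurableI => //; exact: measurableI.
- apply: ae_imply2 uE (ae_foralln (P := fun n x => if n is 0%N then P1 x = c1 + fine (m1 `]-oo, x]%classic) else P2 x = c2 + fine (m2 `]-oo, x]%classic)) _).
    move=> x ux H xD; rewrite ux//; have := H 0%N; have := H 1%N => /= -> ->; ring.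
  case=> [|n].
    by apply: ae_imply (cnt _ c1E) => x /= /negP; rewrite negbK => /eqP.
  by apply: ae_imply (cnt _ c2E) => x /= /negP; rewrite negbK => /eqP.
- by split.
Qed.

(** The limit measures provide a Lebesgue decomposition of the derivative whose singular part is
    carried by the extreme sets of [v]. Uniqueness identifies it with [deriv_ac] and [deriv_sing],
    and minimality of the Jordan parts places each sign on its own set and bounds the total
    variation. *)
Lemma lower_bound : X_space a b p psi u /\
  (tot_var (distr_derivative a b u) D +
   \int[mu]_(x in D) (`|weak_derivative a b (Psi_deriv_ac a b p psi u) x| `^ p)%:E <= C%:E)%E.
Proof.
have [m1 [m2 [c [v [w [gg [Zp [Zn [Q1 [Q2 [Q3 [zs qs ws uE [vgg ggQ]]]]]]]]]]]]] := lower_structure.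
have [ZpE ZnE [mZp mZn] [Zp0 Zn0]] := zs.
have [m1Q m2Q QC] := qs.
have [iw Gw mE] := ws.
have p1' : 1 <= p by exact: ltW.
have muD : measurable_fun D u by apply/measurable_EFinP; exact: (measurable_int _ iu).
have [n1 n1E] := restr_finite m1 mD.
have [n2 n2E] := restr_finite m2 mD.
have [nu nuE] := cadd_sub n1 n2.
have dnu : is_distr_derivative a b u nu.
  by apply: (is_distr_derivative_cumulative ab muD _ uE) => A mA; rewrite nuE// n1E// n2E.
have dd := distr_derivativeP dnu.
set du := distr_derivative a b u in dd *.
have duE (A : set R) : measurable A -> du A = (n1 A - n2 A)%E.
  by move=> mA; rewrite (is_distr_derivative_charge ab dd dnu mA) nuE.
have mZpD : measurable (D `&` Zp) by exact: measurableI.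
have mZnD : measurable (D `&` Zn) by exact: measurableI.
have [s1 s1E] := restr_finite m1 mZpD.
have [s2 s2E] := restr_finite m2 mZnD.
have [s sE] := cadd_sub s1 s2.
pose S := (D `&` Zp) `|` (D `&` Zn).
have mS : measurable S by exact: measurableU.
have dec : lebesgue_decomp mu du (w \_ D) s.
  split => //.
  - exists S; split => //.
      by rewrite measureU0 // setIC.
    apply/eqP; rewrite eq_le adde_ge0 ?measure_ge0// andbT.
    apply: le_trans (tot_var_le sE (measurableC mS)) _.
    rewrite s1E ?s2E; try exact: measurableC.
    rewrite (_ : ~` S `&` (D `&` Zp) = set0); last first.
      by apply/seteqP; split => // x [nS ZD]; apply: nS; left.
    rewrite (_ : ~` S `&` (D `&` Zn) = set0); last first.
      by apply/seteqP; split => // x [nS ZD]; apply: nS; right.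
    by rewrite !measure0 adde0.
  - move=> A mA; rewrite duE// n1E// n2E// mE// -EFin_Rintegral//.
    by rewrite sE// s1E// s2E// !setIA.
have [wE sE'] := lebesgue_decomp_uniq (ac_sing_decomp du) dec.
have sdec A (mA : measurable A) : deriv_sing a b u A = (s1 A - s2 A)%E.
  by rewrite /deriv_sing sE'// sE.
have [iac _ _] := ac_sing_decomp du.
have Gv : {ae mu, forall t, `]a, b[%classic t -> G (deriv_ac a b u t) = v t}.
  have ZpN : {ae mu, forall t, ~ (Zp `&` D) t}.
    exists (Zp `&` D); split => //; first by rewrite setIC.
    by move=> t /= /contrapT.
  have ZnN : {ae mu, forall t, ~ (Zn `&` D) t}.
    exists (Zn `&` D); split => //; first by rewrite setIC.
    by move=> t /= /contrapT.
  apply: ae_imply2 wE (ae_imply2 (fun t h1 h2 => conj h1 h2) ZpN ZnN) => t wt [h1 h2] tD.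
  rewrite /deriv_ac -/du wt restrict_id//; apply: Gw => Zt; [apply: h1|apply: h2]; split => //.
have mac : measurable_fun setT (deriv_ac a b u) := integrableT_measurable iac.
have cv : continuous v := is_primitive_continuous vgg.
have mgg : measurable_fun D gg := integrableT_measurable (proj1 vgg).
have mPsi : measurable_fun D (Psi_deriv_ac a b p psi u).
  apply: measurable_funTS; apply: (@measurableT_comp _ _ _ _ _ _ G) => //.
  exact: continuous_measurable_fun.
have [W1 Wg] := W1p_intro ab p1' mPsi vgg Gv mgg (le_lt_trans ggQ (ltry _)).
have BVu : BV_space a b u.
  split; last by exists du.
  apply/Lp_spaceP => //; split; first exact/(measurable_restrictT _ mD).
  have [_] := integrableP _ _ _ iu; apply: le_lt_trans; rewrite le_eqVlt; apply/orP; left; apply/eqP.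
  by apply: eq_integral => x _; rewrite powRr1.
split.
  split => //.
  - exists (~` (D `&` Zp)); split; first exact: measurableC.
      apply/eqP; rewrite eq_le measure_ge0 andbT.
      have [hle _] := charge_posneg_le sdec (measurableC mZpD).
      by rewrite (le_trans hle)// s1E ?setICl ?measure0//; exact: measurableC.
    move=> x [xD nZ] [_ Zx]; apply: nZ.
    apply: (Zpos_intro Glt cv iac Gv); first by move: xD; rewrite /= in_itv.
    by move: Zx; rewrite ZpE.
  - exists (~` (D `&` Zn)); split; first exact: measurableC.
      apply/eqP; rewrite eq_le measure_ge0 andbT.
      have [_ hle] := charge_posneg_le sdec (measurableC mZnD).
      by rewrite (le_trans hle)// s2E ?setICl ?measure0//; exact: measurableC.
    move=> x [xD nZ] [_ Zx]; apply: nZ.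
    apply: (Zneg_intro Glt cv iac Gv); first by move: xD; rewrite /= in_itv.
    by move: Zx; rewrite ZnE.
have T1 : (tot_var du D <= (Q1 + Q2)%:E)%E.
  apply: le_trans (tot_var_le duE mD) _; rewrite EFinD n1E// n2E// setIid; apply: leeD.
    by apply: le_trans m1Q; rewrite le_measure ?inE.
  by apply: le_trans m2Q; rewrite le_measure ?inE.
have T2 : (\int[mu]_(x in D) (`|weak_derivative a b (Psi_deriv_ac a b p psi u) x| `^ p)%:E <= Q3%:E)%E.
  apply: le_trans ggQ; rewrite le_eqVlt; apply/orP; left; apply/eqP.
  have [_ [d _ ud]] := W1; have [_ [mw _ _] _] := weak_derivativeP ud.
  apply: ae_eq_integral => //.
  - by apply/measurable_EFinP; exact: measurable_normp.
  - by apply/measurable_EFinP; exact: measurable_normp.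
  - by apply: ae_imply Wg => x + xD => /(_ xD) ->.
by apply: le_trans (leeD T1 T2) _; rewrite -EFinD lee_fin.
Qed.

End bounded_energy_sequence.
End lower_bound.

(** * Recovery sequence *)

Section time_change.
Context {R : realType}.
Local Notation TR := (measurableTypeR R).
Local Notation mu := (@lebesgue_measure R).
Implicit Types (k : {finite_measure set TR -> \bar R}).

Let lin5 (x y z m n B : R) : x + B * (m + n) = y + B * m + (z + B * n) -> x = y + z.
Proof. by rewrite mulrDr; move: (B * m) (B * n) => s t; lra. Qed.

Lemma integrable_add (m : {measure set TR -> \bar R}) (A : set R) (f g : R -> R) : measurable A ->
  m.-integrable A (EFin \o f) -> m.-integrable A (EFin \o g) ->
  m.-integrable A (EFin \o (fun x => f x + g x)).
Proof.
move=> mA fi gi; have h := @integrableD _ TR R m A mA _ _ fi gi.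
by apply: eq_integrable h.
Qed.

Lemma le_cumulative k x y : x <= y -> fine (k `]-oo, x]%classic) <= fine (k `]-oo, y]%classic).
Proof.
move=> xy; rewrite fine_le ?fin_num_measure// le_measure ?inE//.
by apply: subset_itvl; rewrite bnd_simp.
Qed.

(* The generalized inverse of [x |-> x + k ]-oo, x]]; it is 1-Lipschitz and maps
   Lebesgue measure to Lebesgue measure plus [k]. *)
Lemma time_change_galois k : exists th : R -> R,
  forall x y, (th y <= x) = (y <= x + fine (k `]-oo, x]%classic)).
Proof.
pose K x := fine (k `]-oo, x]%classic).
have K0 x : 0 <= K x by exact: fine_ge0.
have KT x : K x <= fine (k setT) by rewrite fine_le ?fin_num_measure// le_measure ?inE.
pose E y := [set x | y <= x + K x].
have infE y : has_inf (E y).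
  split; first by exists y; rewrite /E /= lerDl.
  exists (y - fine (k setT)) => x /= /le_trans; rewrite lerBlDr; apply.
  by rewrite lerD2l.
exists (fun y => inf (E y)) => x y; apply/idP/idP; last first.
  by move=> yx; apply: ge_inf => //; exact: (infE y).2.
(* The infimum satisfies the inequality by right-continuity of [K]: an element of [E y] below [t]
   exceeds [x] by at most [e / 2] in position and in mass. *)
move=> thx; apply/ler_addgt0Pr => e e0.
have e20 : 0 < e / 2 by rewrite divr_gt0.
have [z xz kz] := finite_measure_oc_small k x e20.
pose t := Num.min z (x + e / 2).
have xt : x < t by rewrite lt_min xz ltrDl.
have [s Es st] : exists2 s, E y s & s < t.
  have [s Es st] := inf_adherent (ltac:(rewrite subr_gt0; exact: xt) : 0 < t - x) (infE y).
  by exists s => //; apply: lt_le_trans st _; rewrite -lerBrDr opprB addrC subrK.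
have tz : t <= z by rewrite ge_min lexx.
have te : t <= x + e / 2 by rewrite ge_min lexx orbT.
apply: (le_trans Es); apply: (@le_trans _ _ (t + K z)).
  by apply: lerD; [exact: ltW|apply: le_cumulative; apply: le_trans tz; exact: ltW].
have := finite_measure_oc k (ltW xz); rewrite -/(K z) -/(K x) => kE.
have : fine (k `]x, z]%classic) < e / 2.
  by rewrite -lte_fin fineK// fin_num_measure.
by rewrite kE; lra.
Qed.

(** The preimage of []x, y]] under [th] is []x + K x, y + K y]], whose length is [y - x] plus the
    mass [k] gives to []x, y]]; uniqueness of measures extends this to Borel sets. *)
Lemma time_change k : exists th : R -> R,
  [/\ forall x y, (th y <= x) = (y <= x + fine (k `]-oo, x]%classic)),
      measurable_fun setT th,
      forall (A : set R) (f : R -> \bar R), measurable A -> measurable_fun setT f ->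
        (forall x, (0 <= f x)%E) ->
        (\int[mu]_(x in th @^-1` A) f (th x) = \int[mu]_(x in A) f x + \int[k]_(x in A) f x)%E &
      forall (A : set R) (f : R -> R) (B : R), measurable A -> (mu A < +oo)%E ->
        measurable_fun setT f -> (forall x, `|f x| <= B) ->
        \int[mu]_(x in th @^-1` A) f (th x) = \int[mu]_(x in A) f x + \int[k]_(x in A) f x].
Proof.
have [th thE] := time_change_galois k; exists th.
have thmono : {homo th : x y / x <= y}.
  by move=> x y xy; rewrite thE (le_trans xy)// -thE.
have mth : measurable_fun setT th by exact: nondecreasing_measurable.
pose K x := fine (k `]-oo, x]%classic).
have mv : @measurable_fun _ _ TR TR setT th by exact: mth.
pose m1 : {measure set TR -> \bar R} :=
  measure_function_pushforward__canonical__measure_function_Measure mu mv.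
have m1E (A : set R) : m1 A = mu (th @^-1` A) by [].
pose m2 : {measure set TR -> \bar R} := measure_add mu k.
have m2E (A : set R) : m2 A = (mu A + k A)%E by exact: measure_addE.
have ocE x y : x < y -> m1 `]x, y]%classic = ((y - x) + (K y - K x))%:E.
  move=> xy; rewrite m1E (_ : th @^-1` _ = `]x + K x, y + K y]%classic); last first.
    by apply/seteqP; split => t /=; rewrite !in_itv/= !ltNge !thE.
  rewrite lebesgue_measure_oc; first by congr EFin; ring.
  by rewrite lerD// ?le_cumulative// ltW.
have key (A : set R) : measurable A -> m1 A = m2 A.
  move=> mA; apply: eq_measure_oc => // x y; last first.
    have [xy|yx] := ltP x y; first by rewrite ocE// ltry.
    by rewrite set_itv_ge ?measure0 ?ltry// bnd_simp -leNgt.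
  move=> xy; rewrite ocE// m2E lebesgue_measure_oc ?(ltW xy)// EFinD; congr (_ + _)%E.
  by rewrite -(finite_measure_oc k (ltW xy)) fineK// fin_num_measure.
have ge0E (A : set R) (f : R -> \bar R) : measurable A -> measurable_fun setT f ->
    (forall x, (0 <= f x)%E) ->
    (\int[mu]_(x in th @^-1` A) f (th x) = \int[mu]_(x in A) f x + \int[k]_(x in A) f x)%E.
  move=> mA mf f0; have mfA : measurable_fun A f := measurable_funTS mf.
  rewrite -(ge0_integral_pushforward mv) //.
  rewrite -ge0_integral_measure_add//; apply: eq_measure_integral => B mB _.
  exact: key.
split => // A f B mA muA mf fB.
have B0 : 0 <= B by apply: le_trans (fB 0).
have mthA : measurable (th @^-1` A) by rewrite -[X in measurable X]setTI; exact: mth.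
have muthE : mu (th @^-1` A) = (mu A + k A)%E by rewrite -m1E key.
have muth : (mu (th @^-1` A) < +oo)%E.
  by rewrite muthE lte_add_pinfty//; exact: finite_measure_lty.
have mfth : measurable_fun setT (f \o th) by exact: measurableT_comp.
have bnd (D : set R) (q : R -> R) : measurable D -> (mu D < +oo)%E -> measurable_fun setT q ->
    (forall x, `|q x| <= B) -> mu.-integrable D (EFin \o q).
  move=> mD muD mq qB; apply: measurable_bounded_integrable => //; first exact: measurable_funTS.
  exists B; split; first exact: num_real.
  by move=> M ltM x _ /=; rewrite (le_trans (qB x))// ltW.
have cB (D : set R) : measurable D -> (mu D < +oo)%E -> mu.-integrable D (EFin \o (fun=> B)).
  by move=> mD muD; apply: bnd => // x; rewrite ger0_norm.
have ifth := bnd _ _ mthA muth mfth (fun x => fB (th x)).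
have ifA := bnd _ _ mA muA mf fB.
have ifk : k.-integrable A (EFin \o f) by exact: finite_integrable_bounded fB.
have icB : k.-integrable A (EFin \o (fun=> B)).
  by apply: (@finite_integrable_bounded _ _ _ _ B) => // x; rewrite ger0_norm.
(* The signed case is the nonnegative one for [f + B]; the integrals of the constant are finite
   because [mu A] is. *)
have mf' : measurable_fun setT (fun x => (f x + B)%:E).
  by apply/measurable_EFinP; exact: measurable_funD.
have f'0 x : (0 <= (f x + B)%:E)%E.
  by rewrite lee_fin -lerBlDr sub0r; have := fB x; rewrite ler_norml => /andP[].
have := ge0E A (fun x => (f x + B)%:E) mA mf' f'0.
have -> : (\int[mu]_(x in th @^-1` A) (f (th x) + B)%:E =
    (\int[mu]_(x in th @^-1` A) f (th x) + B * fine (mu (th @^-1` A)))%:E)%E.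
  rewrite -Rintegral_cst// -RintegralD//; last exact: cB.
  rewrite /Rintegral fineK//; apply: integrable_fin_num => //.
  exact: (integrable_add mthA ifth (cB _ mthA muth)).
have -> : (\int[mu]_(x in A) (f x + B)%:E =
    (\int[mu]_(x in A) f x + B * fine (mu A))%:E)%E.
  rewrite -Rintegral_cst// -RintegralD//; last exact: cB.
  rewrite /Rintegral fineK//; apply: integrable_fin_num => //.
  exact: (integrable_add mA ifA (cB _ mA muA)).
have -> : (\int[k]_(x in A) (f x + B)%:E =
    (\int[k]_(x in A) f x + B * fine (k A))%:E)%E.
  rewrite -Rintegral_cst// -RintegralD//.
  rewrite /Rintegral fineK//; apply: integrable_fin_num => //.
  exact: (integrable_add mA ifk icB).
rewrite muthE fineD ?fin_num_measure ?ge0_fin_numE// -EFinD => h.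
exact: lin5 (EFin_inj h).
Qed.

End time_change.

(** * Recovery functions at a fixed height *)

Section recovery.
Context {R : realType} (p : R) (psi : R -> R) (p1 : 1 < p)
  (psi_borel : measurable_fun setT psi)
  (psi_gt0 : forall t : R, 0 < psi t)
  (psi_bounded : bounded_fun psi)
  (psi_root_integral :
    (\int[lebesgue_measure]_(t in setT) (psi t `^ p^-1)%:E < +oo)%E)
  (psi_inf : forall K : set R, compact K ->
    (0 < ereal_inf [set (psi t)%:E | t in K])%E)
  (a b : R) (ab : a < b).
Local Notation TR := (measurableTypeR R).
Local Notation mu := (@lebesgue_measure R).
Local Notation G := (PsiR p psi).
Local Notation rt := (root p psi).
Let D : set R := `]a, b[%classic.
Let mD : measurable D. Proof. exact: measurable_itv. Qed.

Lemma integral_null_support (k : {finite_measure set TR -> \bar R}) (B A : set R) (F : R -> \bar R) :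
  measurable B -> k B = 0%E -> measurable A -> measurable_fun setT F ->
  (forall x, ~ B x -> F x = 0%E) -> (\int[k]_(x in A) F x = 0)%E.
Proof.
move=> mB kB mA mF F0; rewrite -[RHS](integral0 k A).
apply: ae_eq_integral => //; first exact: measurable_funTS.
exists B; split => // x /= h; apply: contrapT => nB; apply: h => _; exact: F0.
Qed.

Lemma Rintegral_ae_cst (k : {finite_measure set TR -> \bar R}) (A : set R) (q : R -> R) (c : R) :
  measurable A -> measurable_fun setT q -> {ae k, forall x, q x = c} ->
  \int[k]_(x in A) q x = c * fine (k A).
Proof.
move=> mA mq qc; rewrite -Rintegral_cst// /Rintegral; congr fine; apply: ae_eq_integral => //.
  by apply/measurable_EFinP; exact: measurable_funTS.
by apply: negligibleS qc => x /= nx qx; apply: nx => _; rewrite qx.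
Qed.

Lemma subset_Rintegral_on (A E : set R) (f : R -> R) : measurable A -> measurable E -> A `<=` E ->
  (forall x, 0 <= f x) -> mu.-integrable E (EFin \o f) ->
  \int[mu]_(x in A) f x <= \int[mu]_(x in E) f x.
Proof.
move=> mA mE AE f0 fi; have fiA : mu.-integrable A (EFin \o f) by exact: integrableS fi.
rewrite /Rintegral fine_le ?integrable_fin_num//.
apply: ge0_subset_integral => //; first exact: (measurable_int _ fi).
by move=> x _; rewrite lee_fin.
Qed.

Lemma ae_ge0_le_Rintegral (A : set R) (f1 f2 : R -> R) : measurable A -> measurable_fun A f1 ->
  mu.-integrable A (EFin \o f2) -> (forall x, 0 <= f1 x) -> (forall x, 0 <= f2 x) ->
  {ae mu, forall x, A x -> f1 x <= f2 x} ->
  \int[mu]_(x in A) f1 x <= \int[mu]_(x in A) f2 x.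
Proof.
move=> mA mf1 if2 f10 f20 f12.
have le : (\int[mu]_(x in A) (f1 x)%:E <= \int[mu]_(x in A) (f2 x)%:E)%E.
  apply: ae_ge0_le_integral => //.
  - by move=> x _; rewrite lee_fin.
  - exact/measurable_EFinP.
  - by move=> x _; rewrite lee_fin.
  - exact: (measurable_int _ if2).
have f2fin : (\int[mu]_(x in A) (f2 x)%:E)%E \is a fin_num by exact: integrable_fin_num.
rewrite /Rintegral fine_le// ge0_fin_numE ?integral_ge0//; last by move=> x _; rewrite lee_fin.
by apply: le_lt_trans le _; rewrite ltey_eq f2fin.
Qed.

Section target_data.
Context (w0 v g : R -> R) (S : set R) (sp sn : {finite_measure set TR -> \bar R})
  (iw0 : mu.-integrable setT (EFin \o w0)) (mS : measurable S) (S0 : mu S = 0%E)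
  (spS : sp (~` (D `&` S)) = 0%E) (snS : sn (~` (D `&` S)) = 0%E)
  (spZ : {ae sp, forall x, forall n : nat, G n%:R <= v x})
  (snZ : {ae sn, forall x, forall n : nat, v x <= G (- n%:R)})
  (vg : is_primitive v g)
  (gp : (\int[mu]_(x in D) (`|g x| `^ p)%:E < +oo)%E)
  (Gv : {ae mu, forall x, D x -> G (w0 x) = v x}).

(** The derivative is set to 0 on the null set that carries the singular measures, so that the mass
    inserted by the time change meets a zero integrand. *)
Let gS x : R := `|g x| * \1_(~` S) x.
Let ktot := fine (sp setT) + fine (sn setT).
(** Bounds the displacement of the time change at height [n.+1], whose inserted measure has total
    mass [ktot / n.+1]. *)
Let delta (n : nat) := (ktot + 1) / n.+1%:R.

Let mg : measurable_fun setT g := integrableT_measurable (proj1 vg).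
Let mCS : measurable (~` S). Proof. exact: measurableC. Qed.
Let mgS : measurable_fun setT gS.
Proof. by apply: measurable_funM; [exact: measurableT_comp|exact: measurable_indic]. Qed.
Let gS_ge0 x : 0 <= gS x. Proof. by rewrite mulr_ge0. Qed.
Let gS_le x : gS x <= `|g x|.
Proof. by rewrite ler_piMr// indicE; case: (_ \in _). Qed.
Let igS : mu.-integrable setT (EFin \o gS).
Proof. exact: integrable_indic_mul (integrable_normT (proj1 vg)). Qed.
Let gS_S x : S x -> gS x = 0.
Proof. by move=> Sx; rewrite /gS (indic_bool (e := false)) ?mulr0//; split. Qed.

Let v_incr x y : x <= y -> `|v y - v x| <= \int[mu]_(t in `]x, y[) gS t.
Proof.
rewrite le_eqVlt => /predU1P[->|xy]; first by rewrite subrr normr0 Rintegral_ge0.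
have [ig vE] := vg.
rewrite -vE// -Rintegral_itv_bndo_bndc; last exact: integrableT.
have mI : measurable (`]x, y[%classic : set R) by exact: measurable_itv.
rewrite (null_Rintegral mI mS S0 ig).1.
have mIS : measurable (`]x, y[%classic `&` ~` S) by exact: measurableI.
rewrite /gS Rintegral_indic_mul; apply: le_normr_Rintegral => //; exact: integrableT.
Qed.

(** The last bound controls the error at [x] by the target mass of a short interval ending at [x];
    it tends to 0 unless [x] is an atom of [sp] or [sn]. *)
Lemma recovery (n : nat) : exists wh gh : R -> R,
  [/\ is_primitive wh gh, (\int[mu]_(x in D) (`|gh x| `^ p)%:E < +oo)%E,
    (\int[mu]_(x in D) `|wh x|%:E <= (\int[mu]_(x in D) `|w0 x|)%:E + sp D + sn D)%E,
    (\int[mu]_(x in D) (psi (wh x) * `|gh x| `^ p)%:E <= \int[mu]_(x in D) (`|g x| `^ p)%:E)%E &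
    forall x, D x -> a <= x - delta n ->
      `|\int[mu]_(t in `]a, x]) wh t - (\int[mu]_(t in `]a, x]) clamp (- n.+1%:R) n.+1%:R (w0 t) +
        (fine (sp `]a, x]%classic) - fine (sn `]a, x]%classic)))| <=
      \int[mu]_(t in `]x - delta n, x]) `|w0 t| + fine (sp `]x - delta n, x]%classic) +
        fine (sn `]x - delta n, x]%classic)].
Proof.
pose h : R := n.+1%:R; have h0 : 0 < h by rewrite ltr0n.
have hh : - h <= h by rewrite lerNl (le_trans (ltW _) (ltW h0))// oppr_lt0.
have [W [L L0 [W1 W2 W3 W4 W5]]] : exists W : R -> R, exists2 L, 0 < L &
    [/\ forall s t, `|W s - W t| <= L * `|s - t|,
        forall t, W (G t) = clamp (- h) h t,
        forall s, G h <= s -> W s = h, forall s, s <= G (- h) -> W s = - h &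
        forall s, - h <= W s <= h /\ G (W s) = clamp (G (- h)) (G h) s].
  exact: PsiR_inverse.
have Glt : {homo G : x y / x < y} by exact: PsiR_lt.
have cv : continuous v := is_primitive_continuous vg.
have cW : continuous W.
  move=> x; apply/cvgrPdist_le => e e0.
  apply/nbhs_ballP; exists (e / L) => /=; first by rewrite divr_gt0.
  move=> t; rewrite /ball /= => xt; apply: (le_trans (W1 _ _)).
  by rewrite mulrC -ler_pdivlMr// ltW.
pose q x := W (v x).
have mq : measurable_fun setT q.
  by apply: continuous_measurable_fun => x; apply: continuous_comp; [exact: cv|exact: cW].
have qh x : `|q x| <= h by rewrite ler_norml; exact: (W5 _).1.
have qw : {ae mu, forall x, D x -> q x = clamp (- h) h (w0 x)}.
  by apply: ae_imply Gv => x + xD => /(_ xD) E; rewrite /q -E W2.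
have clamp_norm t : `|clamp (- h) h t| <= `|t|.
  have := clamp_lipschitz t 0 hh; rewrite (@clamp_id _ _ _ 0) ?subr0//.
  by rewrite oppr_le0 (ltW h0).
have hV0 : 0 <= h^-1 by rewrite invr_ge0 ltW.
have [sp' sp'E] := scale_measure sp hV0.
have [sn' sn'E] := scale_measure sn hV0.
have [k [kE kI]] := sum_measure sp' sn'.
have [th [thE mth thI thR]] := time_change k.
have thmono x y : x <= y -> th x <= th y by move=> xy; rewrite thE (le_trans xy)// -thE.
have thle y : th y <= y by rewrite thE lerDl fine_ge0.
have khE (A : set R) : measurable A -> h * fine (k A) = fine (sp A) + fine (sn A).
  by move=> mA; rewrite kE// sp'E// sn'E//= -mulrDr mulrA divff ?mul1r// gt_eqF.
have mDS : measurable (~` (D `&` S)) by apply: measurableC; exact: measurableI.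
have kS : k (~` (D `&` S)) = 0%E.
  by rewrite kE// sp'E// sn'E// spS snS !mulr0 adde0.
have kNS (A : set R) : measurable A -> A `<=` ~` (D `&` S) -> k A = 0%E.
  by move=> mA As; apply/eqP; rewrite eq_le measure_ge0 andbT -[leRHS]kS le_measure ?inE.
have mthA (A : set R) : measurable A -> measurable (th @^-1` A).
  by move=> mA; rewrite -[X in measurable X]setTI; exact: mth.
(* The inserted measure lives on [S], where [F] vanishes, so composing with [th] preserves the
   integral; this is where the energy is kept from increasing. *)
have thNS (F : R -> R) (A : set R) : measurable A -> measurable_fun setT F ->
    (forall x, 0 <= F x) -> (forall x, S x -> F x = 0) ->
    (\int[mu]_(x in th @^-1` A) (F (th x))%:E = \int[mu]_(x in A) (F x)%:E)%E.
  move=> mA mF F0 FS; have mF' : measurable_fun setT (fun x => (F x)%:E) by exact/measurable_EFinP.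
  have := thI A (fun x => (F x)%:E) mA mF' => -> //.
  rewrite (@integral_null_support k (~` S)) ?adde0//.
  - by apply: kNS => // x nS [].
  - by move=> x /contrapT Sx; rewrite FS.
have mgth : measurable_fun setT (fun x => gS (th x)) by exact: (measurableT_comp mgS mth).
have igth : mu.-integrable setT (EFin \o (fun x => gS (th x))).
  apply/integrableP; split; first exact/measurable_EFinP.
  have -> : (\int[mu]_x `|(EFin \o (fun x => gS (th x))) x| = \int[mu]_(x in th @^-1` setT) (gS (th x))%:E)%E.
    by rewrite preimage_setT; apply: eq_integral => x _ /=; rewrite ger0_norm.
  rewrite thNS// -EFin_Rintegral// ltry//.
have vth x y : x < y -> `|v (th y) - v (th x)| <= \int[mu]_(t in `]x, y]) gS (th t).
  move=> xy; apply: (le_trans (v_incr (thmono _ _ (ltW xy)))).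
  have mI : measurable (`]th x, th y[%classic : set R) by exact: measurable_itv.
  have -> : \int[mu]_(t in `]th x, th y[) gS t = \int[mu]_(t in th @^-1` `]th x, th y[%classic) gS (th t).
    by rewrite /Rintegral; congr fine; rewrite thNS.
  apply: subset_Rintegral => //; first exact: mthA.
  (* Strict inequalities between values of the monotone [th] pass to the arguments, which is why
     open intervals are used for the increments of [v]. *)
  move=> t; rewrite /= !in_itv/= => /andP[t1 t2].
  rewrite ltNge; apply/andP; split; first by apply/negP => /thmono; rewrite leNgt t1.
  by rewrite leNgt; apply/negP => /ltW /thmono; rewrite leNgt t2.
pose wh x := q (th x).
have whincr x y : x < y -> `|wh y - wh x| <= \int[mu]_(t in `]x, y]) (L * gS (th t)).
  move=> xy; rewrite RintegralZl//; last by apply: integrableT => //; exact: measurable_itv.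
  by apply: (le_trans (W1 _ _)); rewrite ler_pM2l// vth.
have [gh whgh ghL] := @is_primitive_exists R wh (fun x => L * gS (th x)) (integrableZT L igth)
  (fun x => mulr_ge0 (ltW L0) (gS_ge0 (th x))) whincr.
exists wh, gh.
have mwh : measurable_fun setT wh by exact: (measurableT_comp mq mth).
have mgh : measurable_fun setT gh := integrableT_measurable (proj1 whgh).
(* The bound on [gh] carries the Lipschitz constant [L], which depends on the height. The chain rule
   for [G] composed with [wh] removes it, because [G] after [W] is a clamp and hence 1-Lipschitz. *)
have key : {ae mu, forall x, `|rt (wh x) * gh x| <= gS (th x)}.
  have [B HB] : exists B, forall t, 0 <= rt t <= B by exact: root_bounded.
  have Gp : is_primitive G rt by exact: PsiR_primitive.
  have mrt : measurable_fun setT rt by exact: measurable_root.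
  have Gwh : is_primitive (G \o wh) (fun x => rt (wh x) * gh x).
    apply: (is_primitive_comp whgh mrt HB) => s t st; exact: (proj2 Gp).
  apply: (is_primitive_ae_le Gwh igth) => // x y xy; apply: le_trans (vth _ _ xy).
  rewrite /= /wh /q (W5 _).2 (W5 (v (th x))).2; apply: clamp_lipschitz.
  by apply: ltW_homo hh => s t; exact: Glt.
have K0 x : 0 <= fine (k `]-oo, x]%classic) by exact: fine_ge0.
have Ka : fine (k `]-oo, a]%classic) = 0.
  rewrite kNS// => x /=; rewrite in_itv/= => xa [Dx _].
  by move: Dx; rewrite /D /= in_itv/= ltNge xa.
have thD x : D x -> D (th x).
  rewrite /D /= !in_itv/= => /andP[ax xb]; rewrite (le_lt_trans (thle x) xb) andbT.
  by rewrite ltNge thE Ka addr0 -ltNge.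
have mgSp : measurable_fun setT (fun x => gS x `^ p) by exact: (measurableT_comp (measurable_powR _)).
have p0 : 0 < p by exact: lt_trans p1.
have gthp : (\int[mu]_(x in D) (gS (th x) `^ p)%:E <= \int[mu]_(x in D) (`|g x| `^ p)%:E)%E.
  apply: (@le_trans _ _ (\int[mu]_(x in th @^-1` D) (gS (th x) `^ p)%:E)%E).
    apply: ge0_subset_integral => //; first exact: mthA.
    - by apply/measurable_EFinP; apply: measurable_funTS; exact: (measurableT_comp mgSp mth).
    - by move=> x _; rewrite lee_fin powR_ge0.
  have := @thNS (fun x => gS x `^ p) D mD mgSp (fun x => powR_ge0 _ _) => -> //.
    apply: ge0_le_integral => //.
    - by move=> x _; rewrite lee_fin powR_ge0.
    - by apply/measurable_EFinP; exact: measurable_funTS.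
    - by apply/measurable_EFinP; apply: measurable_normp => //; exact: measurable_funTS.
    - move=> x _; rewrite lee_fin ge0_ler_powR ?nnegrE//; exact: ltW.
  by move=> x Sx; rewrite gS_S// powR0// gt_eqF.
have mgthp : measurable_fun D (fun x => gS (th x) `^ p).
  by apply: measurable_funTS; exact: (measurableT_comp mgSp mth).
split.
- exact: whgh.
- apply: (@le_lt_trans _ _ ((L `^ p)%:E * \int[mu]_(x in D) (gS (th x) `^ p)%:E)%E); last first.
    apply: lte_mul_pinfty; [by rewrite lee_fin powR_ge0|by []|exact: le_lt_trans gthp gp].
  rewrite -ge0_integralZl_EFin ?powR_ge0//; last 2 first.
  + by move=> x _; rewrite lee_fin powR_ge0.
  + exact/measurable_EFinP.
  apply: ae_ge0_le_integral => //.
  + by apply/measurable_EFinP; apply: measurable_normp => //; exact: measurable_funTS.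
  + by move=> x _; rewrite mule_ge0// lee_fin powR_ge0.
  + by apply/measurable_EFinP; apply: measurable_funM.
  + apply: ae_imply ghL => x gx _; rewrite -EFinM lee_fin -powRM// ?(ltW L0)//.
    by rewrite ge0_ler_powR ?nnegrE ?mulr_ge0// ltW.
- have mqa : measurable_fun setT (fun x => `|q x|) by exact: measurableT_comp.
  have mqaE : measurable_fun setT (fun x => `|q x|%:E) by exact/measurable_EFinP.
  apply: (@le_trans _ _ (\int[mu]_(x in th @^-1` D) `|q (th x)|%:E)%E).
    apply: ge0_subset_integral => //; first exact: mthA.
    by apply/measurable_EFinP; apply: measurable_funTS; exact: (measurableT_comp mqa mth).
  have := thI D (fun x => `|q x|%:E) mD mqaE => -> //.
  rewrite -[leRHS]addeA; apply: leeD.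
    rewrite EFin_Rintegral//; last exact: integrable_normT.
    apply: ae_ge0_le_integral => //.
    + by apply/measurable_EFinP; exact: measurable_funTS.
    + by apply/measurable_EFinP; exact: integrableT_measurable (integrable_normT iw0).
    + by apply: ae_imply qw => x + xD => /(_ xD) ->; rewrite lee_fin.
  apply: (@le_trans _ _ (\int[k]_(x in D) h%:E)%E).
    by apply: ge0_le_integral => //; first [exact: measurable_funTS|move=> x _; rewrite lee_fin ?qh// ltW].
  rewrite integral_cst//.
  have kD : (h%:E * k D = sp D + sn D)%E.
    have -> : k D = (fine (k D))%:E by rewrite fineK// fin_num_measure.
    by rewrite -EFinM khE// EFinD !fineK// fin_num_measure.
  by move: kD => /eqP; rewrite eq_le => /andP[+ _]; exact.
- apply: le_trans gthp; apply: ae_ge0_le_integral => //.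
  + by move=> x _; rewrite lee_fin mulr_ge0 ?powR_ge0// ltW.
  + apply/measurable_EFinP; apply: measurable_funTS; apply: measurable_funM.
      exact: measurableT_comp.
    exact: measurable_normp.
  + by move=> x _; rewrite lee_fin powR_ge0.
  + exact/measurable_EFinP.
  + have rt0 t : 0 < rt t by exact: root_gt0.
    apply: ae_imply key => x kx _; rewrite lee_fin -(root_powR p1 psi_gt0) -powRM ?(ltW (rt0 _))//.
    apply: ge0_ler_powR; rewrite ?nnegrE ?mulr_ge0 ?(ltW (rt0 _)) ?(ltW p0)//.
    by apply: le_trans kx; rewrite normrM gtr0_norm.
move=> x xD ax'.
have [ax xb] : a < x /\ x < b by move: xD; rewrite /D /= in_itv/= => /andP.
(* The preimage of []-oo, x]] ends at [phi]: integrated up to [phi], [wh] gives the truncated target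
   exactly, and the error is its integral from [x] to [phi]. *)
pose phi := x + fine (k `]-oo, x]%classic).
have xphi : x <= phi by rewrite lerDl.
have preE : th @^-1` `]a, x]%classic = `]a, phi]%classic.
  have tha t : (a < th t) = (a < t) by rewrite !ltNge thE Ka addr0.
  by apply/seteqP; split => t /=; rewrite !in_itv/= tha thE.
have mI : measurable (`]a, x]%classic : set R) by exact: measurable_itv.
have muI c d : (mu (`]c, d]%classic : set R) < +oo)%E.
  by rewrite lebesgue_measure_itv/=; case: ifP => //; rewrite ltry.
have IsubD t : `]a, x]%classic t -> D t.
  by rewrite /D /= !in_itv/= => /andP[-> /le_lt_trans ->].
have aesp (m m' : {finite_measure set TR -> \bar R}) (P Q : R -> Prop) :
    (forall A : set R, measurable A -> m' A = (h^-1 * fine (m A))%:E) ->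
    (forall x, P x -> Q x) -> {ae m, forall x, P x} -> {ae m', forall x, Q x}.
  move=> mE PQ [N [mN N0 sN]]; exists N; split => //; first by rewrite mE// N0 mulr0.
  by move=> t nQ; apply: sN => Pt; exact: nQ (PQ _ Pt).
have e1 : \int[mu]_(t in `]a, phi]) wh t = \int[mu]_(t in `]a, x]) clamp (- h) h (w0 t) +
    (fine (sp `]a, x]%classic) - fine (sn `]a, x]%classic)).
  rewrite -preE (thR _ q h mI (muI _ _) mq qh) (kI _ _ h mI mq qh); congr (_ + _).
    rewrite /Rintegral; congr fine; apply: ae_eq_integral => //.
    - by apply/measurable_EFinP; exact: measurable_funTS.
    - apply/measurable_EFinP; apply: measurable_funTS.
      apply: measurable_maxr => //; apply: measurable_minr => //; exact: integrableT_measurable iw0.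
    - by apply: ae_imply qw => t + tI => /(_ (IsubD _ tI)) ->.
  (* Where the singular measures live [v] is extreme, so [q] is [h] or [- h] there, and this factor
     cancels the [h^-1] in [sp'] and [sn']. *)
  rewrite (@Rintegral_ae_cst sp' _ _ h) ?(@Rintegral_ae_cst sn' _ _ (- h))//; last 2 first.
  - by apply: (@aesp sn sn' _ _ sn'E _ snZ) => t Ht; exact: W4 (Ht n.+1).
  - by apply: (@aesp sp sp' _ _ sp'E _ spZ) => t Ht; exact: W3 (Ht n.+1).
  by rewrite sp'E// sn'E//= mulNr !mulrA divff ?mul1r// gt_eqF.
have bnd c d : mu.-integrable `]c, d] (EFin \o wh).
  apply: measurable_bounded_integrable => //; first exact: muI.
    exact: measurable_funTS.
  exists h; split; first exact: num_real.
  by move=> M ltM t _ /=; rewrite (le_trans (qh _))// ltW.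
have e2 : \int[mu]_(t in `]a, phi]) wh t = \int[mu]_(t in `]a, x]) wh t + \int[mu]_(t in `]x, phi]) wh t.
  have E : `]a, phi]%classic = `]a, x]%classic `|` `]x, phi]%classic :> set R.
    by rewrite -itv_bndbnd_setU// bnd_simp// ltW.
  rewrite E Rintegral_setU//; first by rewrite -E; exact: bnd.
  apply/disj_set2P; rewrite -subset0 => t [] /=; rewrite !in_itv/= => /andP[_ tx] /andP[xt _].
  by move: xt; rewrite ltNge tx.
rewrite -/h -e1 e2 opprD addrA subrr sub0r normrN.
have mJ : measurable (`]x - delta n, x]%classic : set R) by exact: measurable_itv.
have mqa : measurable_fun setT (fun x => `|q x|) by exact: measurableT_comp.
have qah t : `| `|q t| | <= h by rewrite normr_id.
apply: (@le_trans _ _ (\int[mu]_(t in `]x, phi]) `|wh t|)).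
  by apply: le_normr_Rintegral => //; exact: bnd.
(* For [t] in []x, phi]] the value [th t] lies in []x - delta n, x]], since [delta n] is at least
   the total mass of [k]. *)
apply: (@le_trans _ _ (\int[mu]_(t in th @^-1` `]x - delta n, x]%classic) `|q (th t)|)).
  apply: subset_Rintegral_on => //; first exact: mthA.
    move=> t /=; rewrite !in_itv/= => /andP[xt tphi]; rewrite ltNge !thE tphi andbT -ltNge.
    apply: le_lt_trans xt; rewrite addrAC lerBlDr lerD2l.
    have KT : fine (k `]-oo, x - delta n]%classic) <= fine (k setT).
      by rewrite fine_le ?fin_num_measure// le_measure ?inE.
    apply: (le_trans KT); rewrite /delta -/h ler_pdivlMr// mulrC khE//.
    by rewrite /ktot lerDl.
  apply: measurable_bounded_integrable; first exact: mthA.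
  - apply: le_lt_trans (muI (x - delta n) phi); apply: le_measure; rewrite ?inE//; first exact: mthA.
    move=> t /=; rewrite !in_itv/= => /andP[t1 t2].
    by rewrite (lt_le_trans t1 (thle t))/= /phi -thE.
  - by apply: measurable_funTS; exact: (measurableT_comp mqa mth).
  - exists h; split; first exact: num_real.
    by move=> M ltM t _ /=; rewrite normr_id (le_trans (qh _))// ltW.
rewrite (thR _ (fun t => `|q t|) h mJ (muI _ _) mqa qah) -addrA; apply: lerD.
  apply: ae_ge0_le_Rintegral => //.
  - exact: measurable_funTS.
  - by apply: integrableT => //; exact: integrable_normT.
  apply: ae_imply qw => t + tJ.
  have tD : D t.
    move: tJ; rewrite /D /= !in_itv/= => /andP[t1 t2].
    by rewrite (le_lt_trans ax' t1) (le_lt_trans t2 xb).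
  by move=> /(_ tD) ->.
rewrite -khE// -Rintegral_cst//; apply: le_Rintegral => //.
- exact: finite_integrable_bounded qah.
- by apply: (@finite_integrable_bounded _ _ _ _ h) => // t; rewrite gtr0_norm.
Qed.

End target_data.
End recovery.

(** * Convergence of the recovery functions in [L^1] *)

Section upper_bound.
Context {R : realType} (p : R) (psi : R -> R) (p1 : 1 < p)
  (psi_borel : measurable_fun setT psi)
  (psi_gt0 : forall t : R, 0 < psi t)
  (psi_bounded : bounded_fun psi)
  (psi_root_integral :
    (\int[lebesgue_measure]_(t in setT) (psi t `^ p^-1)%:E < +oo)%E)
  (psi_inf : forall K : set R, compact K ->
    (0 < ereal_inf [set (psi t)%:E | t in K])%E)
  (a b : R) (ab : a < b).
Local Notation TR := (measurableTypeR R).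
Local Notation mu := (@lebesgue_measure R).
Local Notation G := (PsiR p psi).
Local Notation rt := (root p psi).
Let D : set R := `]a, b[%classic.
Let mD : measurable D. Proof. exact: measurable_itv. Qed.

Lemma charge_posnegE (nu : {charge set TR -> \bar R}) (A : set R) : measurable A ->
  nu A = (charge_pos nu A - charge_neg nu A)%E.
Proof. by move=> mA; rewrite (jordan_decomp (hahn_proof nu))// /cadd/= cscaleN1. Qed.

Lemma charge_posneg_null (s : {charge set TR -> \bar R}) (S : set R) : measurable S ->
  tot_var s (~` S) = 0%E -> charge_pos s (~` S) = 0%E /\ charge_neg s (~` S) = 0%E.
Proof.
move=> mS; rewrite tot_varE => /eqP.
by rewrite padde_eq0// => /andP[/eqP -> /eqP ->].
Qed.

Lemma restr_null (m m' : {finite_measure set TR -> \bar R}) (S : set R) : measurable S ->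
  (forall A : set R, measurable A -> m' A = m (A `&` D)) -> m (~` S) = 0%E ->
  m' (~` (D `&` S)) = 0%E.
Proof.
move=> mS m'E mS0; have mDS : measurable (~` (D `&` S)) by apply: measurableC; exact: measurableI.
rewrite m'E//; apply/eqP; rewrite eq_le measure_ge0 andbT -[leRHS]mS0.
apply: le_measure; rewrite ?inE//; [exact: measurableI|exact: measurableC|].
by move=> x [nDS Dx] Sx; exact: nDS.
Qed.

Lemma restr_ae (m m' : {finite_measure set TR -> \bar R}) (Z : set R) (P : R -> Prop) :
  (forall A : set R, measurable A -> m' A = m (A `&` D)) ->
  m.-negligible (D `\` Z) -> (forall x, Z x -> P x) -> {ae m', forall x, P x}.
Proof.
move=> m'E [N [mN N0 sN]] ZP; have mCD : measurable (~` D) by exact: measurableC.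
have mND : measurable (N `|` ~` D) by exact: measurableU.
exists (N `|` ~` D); split => //.
  rewrite m'E//; apply/eqP; rewrite eq_le measure_ge0 andbT -[leRHS]N0.
  apply: le_measure; rewrite ?inE//; first exact: measurableI.
  by move=> x [[]].
move=> x nP; have [Dx|nD] := pselect (D x); [left|by right].
by apply: sN; split => // Zx; exact: nP (ZP _ Zx).
Qed.

(** Puts a function of the space in the form required by the construction: [S] is a null set
    carrying the singular part, and membership in the divergence sets becomes a statement on extreme
    values of [v]. *)
Lemma X_space_repr (u : R -> R) : X_space a b p psi u ->
  exists (w0 v g : R -> R) (S : set R) (sp sn : {finite_measure set TR -> \bar R}) (c : R),
  [/\ [/\ mu.-integrable setT (EFin \o w0), measurable S, mu S = 0%E,
        sp (~` (D `&` S)) = 0%E & sn (~` (D `&` S)) = 0%E],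
     [/\ {ae sp, forall x, forall n : nat, G n%:R <= v x},
        {ae sn, forall x, forall n : nat, v x <= G (- n%:R)} &
        is_primitive v g],
     [/\ (\int[mu]_(x in D) (`|g x| `^ p)%:E < +oo)%E,
        {ae mu, forall x, D x -> G (w0 x) = v x} &
        {ae mu, forall x, D x -> u x = c + (\int[mu]_(t in `]a, x]) w0 t +
          (fine (sp `]a, x]%classic) - fine (sn `]a, x]%classic)))}] &
     ((\int[mu]_(x in D) `|w0 x|)%:E + sp D + sn D + \int[mu]_(x in D) (`|g x| `^ p)%:E <=
      tot_var (distr_derivative a b u) D +
      \int[mu]_(x in D) (`|weak_derivative a b (Psi_deriv_ac a b p psi u) x| `^ p)%:E)%E].
Proof.
move=> [[Lu [nu nuE]] W1 Np Nn].
have p1' : 1 <= p := ltW p1.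
set du := distr_derivative a b u.
have duE : is_distr_derivative a b u du := distr_derivativeP nuE.
have iu : mu.-integrable D (EFin \o u) := Lp_space_integrable (lexx _) Lu.
have dec := ac_sing_decomp du.
have [iw _ decE] := dec.
have [S [mS S0 sS _]] := lebesgue_decomp_singular dec.
have [pS nS] := charge_posneg_null mS sS.
have [sp spE] := restr_finite (charge_pos (deriv_sing a b u)) mD.
have [sn snE] := restr_finite (charge_neg (deriv_sing a b u)) mD.
have [v [g [vg Gv wg gp _]]] := W1p_repr ab p1' W1.
have [c uc] := charge_repr ab iu duE.
have Glt : {homo G : x y / x < y} by exact: PsiR_lt.
have cv : continuous v := is_primitive_continuous vg.
exists (deriv_ac a b u), v, g, S, sp, sn, c; split.
- by split => //; [exact: restr_null spE pS|exact: restr_null snE nS].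
- split => //.
  + apply: restr_ae spE Np _ => x Zx n; exact: (Zpos_elim Glt cv iw Gv).
  + apply: restr_ae snE Nn _ => x Zx n; exact: (Zneg_elim Glt cv iw Gv).
- split => //; apply: ae_imply uc => x + xD => /(_ xD) ->.
  have mI : measurable (`]-oo, x]%classic : set R) by exact: measurable_itv.
  have mJ : measurable (`]a, x]%classic : set R) by exact: measurable_itv.
  have JD : `]a, x]%classic `&` D = `]a, x]%classic.
    apply/seteqP; split => [t []//|t tJ]; split => //; move: tJ xD.
    by rewrite /D /= !in_itv/= => /andP[-> /le_lt_trans h] /andP[_ /h ->].
  have ID : `]-oo, x]%classic `&` D = `]a, x]%classic.
    apply/seteqP; split => t /=; rewrite /D /= !in_itv/=; first by move=> [-> /andP[->]].
    move=> /andP[at_ tx]; split => //; rewrite at_/=; move: xD.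
    by rewrite /D /= in_itv/= => /andP[_]; exact: le_lt_trans.
  rewrite -addrA; congr (_ + _).
  set I : set R := `]-oo, x]%classic in mI ID *; set J : set R := `]a, x]%classic in mJ JD ID *.
  have E1 : (du I = (\int[mu]_(t in J) deriv_ac a b u t)%:E + (sp J - sn J))%E.
    have -> : ((\int[mu]_(t in J) deriv_ac a b u t)%:E = \int[mu]_(t in J) (deriv_ac a b u t)%:E)%E.
      by rewrite -EFin_Rintegral//; exact: integrableT mJ iw.
    rewrite (proj1 duE)// ID decE//; congr (_ + _)%E.
    by rewrite (charge_posnegE _ mJ) spE// snE// JD.
  have E2 := charge_posnegE du mI.
  move: E1; rewrite E2.
  rewrite -[charge_pos du _]fineK ?fin_num_measure// -[charge_neg du _]fineK ?fin_num_measure//.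
  rewrite -[sp _]fineK ?fin_num_measure// -[sn _]fineK ?fin_num_measure//.
  by rewrite -!EFinB -EFinD => -[].
- apply: leeD.
    have := tot_var_decomp dec mD; apply: le_trans.
    by rewrite tot_varE spE// snE// setIid -addeA.
  rewrite le_eqVlt; apply/orP; left; apply/eqP.
  have [_ [d _ ud]] := W1; have [_ [mw _ _] _] := weak_derivativeP ud.
  have mg : measurable_fun D g := measurable_funTS (integrableT_measurable (proj1 vg)).
  apply: ae_eq_integral => //.
  + by apply/measurable_EFinP; exact: measurable_normp.
  + by apply/measurable_EFinP; exact: measurable_normp.
  + by apply: ae_imply wg => x + xD => /(_ xD) ->.
Qed.

(** The intervals are closed on the right, so for positive [K] they decrease to the point [x]
    itself, whose mass is assumed to be 0. *)
Lemma finite_measure_co_small (k : {finite_measure set TR -> \bar R}) (x K : R) : 0 <= K ->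
  k [set x] = 0%E -> fine (k `]x - K / n.+1%:R, x]%classic) @[n --> \oo] --> 0.
Proof.
move=> K0 kx.
pose F (n : nat) : set TR := `]x - K / n.+1%:R, x]%classic.
have mF i : measurable (F i) by exact: measurable_itv.
have : (k \o F) n @[n --> \oo] --> k (\bigcap_n F n).
  apply: nonincreasing_cvg_mu => //.
  - exact: finite_measure_lty.
  - exact: bigcapT_measurable.
  - move=> i j ij; apply/subsetPset => z; rewrite /F/= !in_itv/= => /andP[zj ->].
    rewrite andbT; apply: le_lt_trans zj; rewrite lerD2l lerN2 ler_wpM2l//.
    by rewrite lef_pV2 ?posrE// ler_nat.
have -> : k (\bigcap_n F n) = 0%E.
  apply/eqP; rewrite eq_le measure_ge0 andbT -[leRHS]kx.
  apply: le_measure; rewrite ?inE//; first exact: bigcapT_measurable.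
  move=> z zF /=; apply/eqP; rewrite eq_le; apply/andP; split.
    by have := zF 0%N I; rewrite /F/= in_itv/= => /andP[].
  rewrite leNgt; apply/negP => zx.
  have K1 : 0 < K + 1 by rewrite ltr_wpDl.
  have xz : 0 < x - z by rewrite subr_gt0.
  have [n _ /(_ n (leqnn _)) nz] := near_invn (divr_gt0 xz K1).
  have := zF n I; rewrite /F/= in_itv/= => /andP[+ _]; rewrite ltNge => /negP; apply.
  rewrite lerBrDr -lerBrDl (le_trans _ (_ : (K + 1) * n.+1%:R^-1 <= _))//.
    by rewrite ler_pM2r ?invr_gt0// lerDl.
  by rewrite mulrC -ler_pdivlMr// ltW.
by move=> /fine_cvgP[].
Qed.

Lemma upper_bound (u : R -> R) : X_space a b p psi u ->
  exists u_ : nat -> R -> R,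
  [/\ forall k, Lp_space a b 1 (u_ k), cvg_L1 a b u_ u &
    forall k, (F_functional a b p psi (u_ k) <= tot_var (distr_derivative a b u) D +
      \int[mu]_(x in D) (`|weak_derivative a b (Psi_deriv_ac a b p psi u) x| `^ p)%:E)%E].
Proof.
move=> uX; have p1' : 1 <= p := ltW p1.
have Lu : Lp_space a b 1 u by have [[]] := uX.
have iu : mu.-integrable D (EFin \o u) := Lp_space_integrable (lexx _) Lu.
have [w0 [v [g [S [sp [sn [c [[iw mS S0 spS snS] [spZ snZ vg] [gp Gv uE] TV]]]]]]]] := X_space_repr uX.
(* Chosen so that [K / n.+1] is the displacement bound of the construction. *)
pose K := fine (sp setT) + fine (sn setT) + 1.
pose delta (n : nat) := K / n.+1%:R.
have K0 : 0 <= K by rewrite /K !addr_ge0 ?fine_ge0.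
have rec (n : nat) := recovery p1 psi_borel psi_gt0 psi_bounded psi_root_integral psi_inf
  iw mS S0 spS snS spZ snZ vg gp Gv n.
have [wh /choice[gh rec']] := choice rec.
pose u_ n x := c + \int[mu]_(t in `]a, x]) wh n t.
have Fu n : Lp_space a b 1 (u_ n) /\ F_functional a b p psi (u_ n) =
    (\int[mu]_(x in D) `|wh n x|%:E + \int[mu]_(x in D) (psi (wh n x) * `|gh n x| `^ p)%:E)%E.
  by have [h1 h2 _ _ _] := rec' n; exact: (F_functional_intro ab p1' psi_borel h1 h2).
pose m := \int[mu]_(x in D) `|w0 x| + fine (sp D) + fine (sn D).
have whm n : (\int[mu]_(x in D) `|wh n x|%:E <= m%:E)%E.
  have [_ _ h _ _] := rec' n; apply: le_trans h _.
  have -> : (m%:E = (\int[mu]_(x in D) `|w0 x|)%:E + sp D + sn D)%E.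
    by rewrite /m !EFinD; congr (_ + _ + _)%E; rewrite fineK// fin_num_measure.
  exact: lexx.
have mwh n : measurable_fun setT (wh n).
  by have [h _ _ _ _] := rec' n; exact: is_primitive_measurable h.
have iwh n : mu.-integrable D (EFin \o wh n).
  apply/integrableP; split; first by apply/measurable_EFinP; exact: (measurable_funTS (mwh n)).
  exact: le_lt_trans (whm n) (ltry _).
have mJ x : measurable (`]a, x]%classic : set R) by exact: measurable_itv.
have JD x : D x -> `]a, x]%classic `<=` D.
  move=> xD t; move: xD; rewrite /D /= !in_itv/= => /andP[_ xb] /andP[-> tx].
  exact: le_lt_trans tx xb.
have whx n x : D x -> `|\int[mu]_(t in `]a, x]) wh n t| <= m.
  move=> xD; have iJ : mu.-integrable `]a, x] (EFin \o wh n).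
    by apply: integrableS (iwh n); [exact: mD|exact: mJ|exact: JD].
  apply: (@le_trans _ _ (\int[mu]_(t in `]a, x]) `|wh n t|)).
    by apply: le_normr_Rintegral => //; exact: mJ.
  have inD : mu.-integrable D (EFin \o (fun x => `|wh n x|)) by exact: (integrable_norm (iwh n)).
  apply: le_trans (subset_Rintegral_on (mJ x) mD (JD x xD) (fun x => normr_ge0 _) inD) _.
  rewrite -lee_fin; apply: le_trans (whm n).
  by rewrite /Rintegral fineK//; exact: integrable_fin_num.
have [mw mwE] := density_measureR (integrable_normT iw) (fun x => normr_ge0 (w0 x)).
(* Off the null set [S] the measures [sp] and [sn] have no atoms, so the local error tends to 0; the
   integrals of the clamped density converge by dominated convergence. *)
have lim x : D x -> ~ S x -> u_ n x @[n --> \oo] --> c + (\int[mu]_(t in `]a, x]) w0 t +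
    (fine (sp `]a, x]%classic) - fine (sn `]a, x]%classic))).
  move=> xD nSx.
  pose A n := \int[mu]_(t in `]a, x]) clamp (- n.+1%:R) n.+1%:R (w0 t) +
    (fine (sp `]a, x]%classic) - fine (sn `]a, x]%classic)).
  have mw0 : measurable_fun setT w0 := integrableT_measurable iw.
  have cA : A n @[n --> \oo] --> \int[mu]_(t in `]a, x]) w0 t +
      (fine (sp `]a, x]%classic) - fine (sn `]a, x]%classic)).
    apply: cvgD; last exact: cvg_cst.
    have := @cvg_Rintegral R mu `]a, x]%classic (fun n t => clamp (- n.+1%:R) n.+1%:R (w0 t)) w0
      (fun t => `|w0 t|) (mJ x).
    case=> //.
    - move=> n; apply: measurable_funTS; apply: measurable_maxr => //; exact: measurable_minr.
    - exact: measurable_funTS.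
    - move=> t _; apply: cvg_near_cst; exists (Num.truncn `|w0 t|) => // n /= tn.
      rewrite clamp_id// -ler_norml; apply: ltW; apply: (lt_le_trans (truncnS_gt _)).
      by rewrite ler_nat.
    - exact: integrableT (mJ x) (integrable_normT iw).
    - move=> n t _; have hh : - n.+1%:R <= n.+1%:R :> R by rewrite lerNl (le_trans _ (ler0n _ _))// oppr_le0.
      by have := clamp_lipschitz (w0 t) 0 hh; rewrite (@clamp_id _ _ _ 0) ?subr0// oppr_le0 ler0n.
  have null (k : {finite_measure set TR -> \bar R}) : k (~` (D `&` S)) = 0%E -> k [set x] = 0%E.
    move=> kS; apply/eqP; rewrite eq_le measure_ge0 andbT -[leRHS]kS.
    apply: le_measure; rewrite ?inE//; first by apply: measurableC; exact: measurableI.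
    by move=> t -> [].
  have mwx : mw [set x] = 0%E.
    by rewrite mwE// Rintegral_set1.
  have cB : fine (mw `]x - delta n, x]%classic) + fine (sp `]x - delta n, x]%classic) +
      fine (sn `]x - delta n, x]%classic) @[n --> \oo] --> 0.
    rewrite -[X in _ --> X](addr0 0); apply: cvgD; first rewrite -[X in _ --> X](addr0 0).
      by apply: cvgD; apply: finite_measure_co_small => //; exact: null.
    by apply: finite_measure_co_small => //; exact: null.
  have cE : \int[mu]_(t in `]a, x]) wh n t - A n @[n --> \oo] --> 0.
    apply/norm_cvg0P; apply: (squeeze_cvgr _ (cvg_cst 0) cB).
    have [ax xb] : a < x /\ x < b by move: xD; rewrite /D /= in_itv/= => /andP.
    (* Ensures that [a <= x - delta n] for large [n], which the error estimate requires. *)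
    have xa0 : 0 < (x - a) / (K + 1) by rewrite divr_gt0 ?subr_gt0// ltr_wpDl.
    apply: filterS (near_invn xa0) => n nx; rewrite normr_ge0/=.
    have [_ _ _ _ h] := rec' n; rewrite mwE//=; apply: h => //.
    rewrite lerBrDl -lerBrDr (le_trans (_ : _ <= (K + 1) * n.+1%:R^-1))//.
      by rewrite /delta ler_pM2r ?invr_gt0// lerDl.
    by rewrite mulrC -ler_pdivlMr ?ltr_wpDl// ltW.
  apply: cvgD; first exact: cvg_cst.
  have -> : (fun n => \int[mu]_(t in `]a, x]) wh n t) =
      (fun n => (\int[mu]_(t in `]a, x]) wh n t - A n) + A n) by apply/funext => n; rewrite subrK.
  by rewrite -[X in _ --> X]add0r; exact: cvgD cE cA.
exists u_; split.
- by move=> k; exact: (Fu k).1.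
- have mu_ n : measurable_fun D (u_ n).
    by have /integrableP[/measurable_EFinP] := Lp_space_integrable (lexx _) (Fu n).1.
  have muD : (mu D < +oo)%E.
    by rewrite /D lebesgue_measure_itv/=; case: ifP => //; rewrite ltry.
  (* The constant [|c| + m] dominates, because the integrals of [|wh n|] over [D] are at most
     [m]. *)
  have [|||||_ + _] := @dominated_convergence _ _ _ mu D mD (fun n x => (u_ n x)%:E)
      (fun x => (u x)%:E) (fun=> (`|c| + m)%:E).
  + by move=> n; apply/measurable_EFinP; exact: mu_.
  + by have /integrableP[] := iu.
  + have nS : {ae mu, forall x, ~ S x} by exists S; split => // x /= /contrapT.
    apply: ae_imply2 uE nS => x + nSx xD => /(_ xD) ->.
    by apply: cvg_EFin; [exact: nearW|exact: lim].
  + apply: (@measurable_bounded_integrable _ _ _ _ (fun=> `|c| + m)) => //.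
    exists `| `|c| + m|; split; first exact: num_real.
    by move=> M ltM t _ /=; exact: ltW.
  + apply: aeW => x n xD; rewrite /= lee_fin (le_trans (ler_normD _ _))// lerD2l.
    exact: whx.
  by rewrite /cvg_L1.
- move=> k; rewrite (Fu k).2; have [_ _ h1 h2 _] := rec' k.
  by apply: le_trans TV; exact: leeD.
Qed.

End upper_bound.

(** * Almost everywhere convergence and lower limits *)

Section lower_limits.
Context {R : realType}.
Local Notation TR := (measurableTypeR R).
Local Notation mu := (@lebesgue_measure R).

(** The series of the [h n] has integral at most 1, hence is finite almost everywhere, and the terms
    of a convergent series tend to 0. *)
Lemma summable_integral_ae_cvg0 (A : set R) (h : nat -> R -> R) : measurable A ->
  (forall n, measurable_fun A (h n)) -> (forall n x, 0 <= h n x) ->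
  (forall n, (\int[mu]_(x in A) (h n x)%:E <= (1 / (2 ^ n.+1)%:R)%:E)%E) ->
  {ae mu, forall x, A x -> h n x @[n --> \oo] --> 0}.
Proof.
move=> mA mh h0 hI; pose H x := (\sum_(n <oo) (h n x)%:E)%E.
have mhE n : measurable_fun A (fun x => (h n x)%:E) by apply/measurable_EFinP; exact: mh.
have HI : (\int[mu]_(x in A) H x <= 1%:E)%E.
  rewrite integral_nneseries//; last by move=> n x _; rewrite lee_fin.
  apply: le_trans (epsilon_trick0 xpredT ler01); apply: lee_nneseries => [n _ _|n _].
    by apply: integral_ge0 => x _; rewrite lee_fin.
  exact: hI.
have H0 x : (0 <= H x)%E by apply: nneseries_ge0 => n _ _; rewrite lee_fin.
have iH : mu.-integrable A H.
  apply/integrableP; split.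
    have hE0 k x : A x -> xpredT k -> (0 <= (h k x)%:E)%E by rewrite lee_fin.
    exact: (ge0_emeasurable_sum hE0 (fun k _ => mhE k)).
  apply: (@le_lt_trans _ _ 1%:E); last exact: ltry.
  apply: le_trans HI; rewrite le_eqVlt; apply/orP; left; apply/eqP.
  by apply: eq_integral => x _; rewrite gee0_abs.
have fH : {ae mu, forall x, A x -> H x \is a fin_num} by apply: (integrable_ae _ iH); exact: mA.
apply: ae_imply fH => x + xA => /(_ xA) Hx.
apply: (@cvg_series_cvg_0 _ R^o); apply: nondecreasing_is_cvgn.
  by apply: nondecreasing_series => n _ _; exact: h0.
exists (fine (H x)) => _ [n _ <-].
rewrite -lee_fin fineK// /series/= -sumEFin; apply: nneseries_lim_ge => k _ _.
by rewrite lee_fin.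
Qed.

Lemma limn_einf_le (w : nat -> \bar R) (M : \bar R) : (forall k, (w k <= M)%E) ->
  (limn_einf w <= M)%E.
Proof.
move=> wM; rewrite limn_einf_lim; apply: lime_le; first exact: is_cvg_einfs.
apply: nearW => n; apply: le_trans (wM n); apply: ereal_inf_lbound.
by exists n => //=.
Qed.

Lemma limn_einf_lt (w : nat -> \bar R) (M : \bar R) : (limn_einf w < M)%E ->
  forall N : nat, exists2 k, (N <= k)%N & (w k < M)%E.
Proof.
move=> wM N; have : (einfs w N < M)%E.
  apply: le_lt_trans wM; rewrite limn_einf_lim.
  apply: lime_ge; first exact: is_cvg_einfs.
  by exists N => // n /= Nn; exact: nondecreasing_einfs.
by move=> /ereal_inf_lt[_ /= [k Nk <-] wkM]; exists k.
Qed.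

(** Lower bounds are obtained for sequences with energy below a real [C]; this transfers them to the
    lower limit. The value -oo is excluded by testing with [C = -1]. *)
Lemma le_ereal_lt_fin (l V : \bar R) : (0 <= V)%E ->
  (forall C : R, (l < C%:E)%E -> (V <= C%:E)%E) -> (V <= l)%E.
Proof.
move=> V0 h; case: l h => [r| |] h; last 2 first.
- exact: leey.
- by have := le_trans V0 (h (-1) (ltNyr _)); rewrite lee_fin oppr_ge0 ler10.
by apply/lee_addgt0Pr => e e0; rewrite -EFinD; apply: h; rewrite lte_fin ltrDl.
Qed.

End lower_limits.

Section relaxation.
Context {R : realType} (p : R) (psi : R -> R) (p1 : 1 < p)
  (psi_borel : measurable_fun setT psi)
  (psi_gt0 : forall t : R, 0 < psi t)
  (psi_bounded : bounded_fun psi)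
  (psi_root_integral :
    (\int[lebesgue_measure]_(t in setT) (psi t `^ p^-1)%:E < +oo)%E)
  (psi_inf : forall K : set R, compact K ->
    (0 < ereal_inf [set (psi t)%:E | t in K])%E)
  (a b : R) (ab : a < b).
Local Notation mu := (@lebesgue_measure R).
Let D : set R := `]a, b[%classic.
Let mD : measurable D. Proof. exact: measurable_itv. Qed.

Lemma lower_bound_seq (u : R -> R) (u_ : nat -> R -> R) (C : R) :
  Lp_space a b 1 u -> (forall k, Lp_space a b 1 (u_ k)) -> cvg_L1 a b u_ u ->
  (limn_einf (fun k => F_functional a b p psi (u_ k)) < C%:E)%E ->
  X_space a b p psi u /\
  (tot_var (distr_derivative a b u) D +
   \int[mu]_(x in D) (`|weak_derivative a b (Psi_deriv_ac a b p psi u) x| `^ p)%:E <= C%:E)%E.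
Proof.
move=> Lu Lu_ cu FC; have p1' : 1 <= p := ltW p1.
have iu : mu.-integrable D (EFin \o u) := Lp_space_integrable (lexx _) Lu.
have iu_ k : mu.-integrable D (EFin \o u_ k) := Lp_space_integrable (lexx _) (Lu_ k).
(* Each index has energy below [C] and an [L^1] error below a summable sequence. The indices may
   repeat or decrease: the limit argument uses only the energy bound and convergence almost
   everywhere. *)
have sel (n : nat) : exists k, (F_functional a b p psi (u_ k) < C%:E)%E /\
    (\int[mu]_(x in D) `|u_ k x - u x|%:E <= (1 / (2 ^ n.+1)%:R)%:E)%E.
  have e0 : 0 < 1 / (2 ^ n.+1)%:R :> R by rewrite divr_gt0// ltr0n expn_gt0.
  have /fine_cvgP[[N1 _ h1] /cvgr_lt /(_ _ e0)[N2 _ h2]] := cu.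
  have [k Nk Fk] := limn_einf_lt FC (maxn N1 N2); move: Nk; rewrite geq_max => /andP[k1 k2].
  exists k; split => //; have := h2 k k2; rewrite /= -lte_fin fineK; last exact: h1.
  exact: ltW.
have [s sP] := choice sel.
have rep (n : nat) : exists q : R * (R -> R) * (R -> R),
  [/\ is_primitive q.1.2 q.2,
    {ae mu, forall x, D x -> u_ (s n) x = q.1.1 + \int[mu]_(t in `]a, x]) q.1.2 t},
    forall x, ~ D x -> q.2 x = 0 &
    (\int[mu]_(x in D) `|q.1.2 x|%:E +
     \int[mu]_(x in D) (psi (q.1.2 x) * `|q.2 x| `^ p)%:E <= C%:E)%E].
  have [FnC _] := sP n.
  have [c [f [g [h1 h2 h3 h4]]]] :=
    F_functional_repr ab p1' psi_borel (lt_trans FnC (ltry _)).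
  by exists (c, f, g); split => //=; move: FnC; rewrite h4 => /ltW.
have [q qP] := choice rep.
have cv0 : {ae mu, forall x, D x -> `|u_ (s n) x - u x| @[n --> \oo] --> 0}.
  apply: (@summable_integral_ae_cvg0 _ D (fun n x => `|u_ (s n) x - u x|)) => //.
  - move=> n; apply: measurableT_comp => //; apply: measurable_funB.
      by have /integrableP[/measurable_EFinP] := iu_ (s n).
    by have /integrableP[/measurable_EFinP] := iu.
  - by move=> n; exact: (sP n).2.
have qae : {ae mu, forall x, forall n, D x ->
    u_ (s n) x = (q n).1.1 + \int[mu]_(t in `]a, x]) (q n).1.2 t}.
  by apply: ae_foralln => n; have [_ h _ _] := qP n.
apply: (@lower_bound R p psi p1 psi_borel psi_gt0 psi_bounded psi_root_integral psi_inf a b ab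
  (fun n => (q n).1.2) (fun n => (q n).2) (fun n => (q n).1.1) u C).
- by move=> n; have [] := qP n.
- by move=> n; have [] := qP n.
- by move=> n; have [] := qP n.
- exact: iu.
apply: ae_imply2 cv0 qae => x + qx xD => /(_ xD) /norm_cvg0P h.
have -> : (fun n => (q n).1.1 + \int[mu]_(t in `]a, x]) (q n).1.2 t) =
    (fun n => (u_ (s n) x - u x) + u x) by apply/funext => n; rewrite subrK -qx.
by rewrite -[X in _ --> X]add0r; apply: cvgD => //; exact: cvg_cst.
Qed.

Lemma relaxationE (u : R -> R) : Lp_space a b 1 u ->
  relaxation a b (F_functional a b p psi) u =
  if u \in X_space a b p psi then
    (tot_var (distr_derivative a b u) D +
     \int[mu]_(x in D) (`|weak_derivative a b (Psi_deriv_ac a b p psi u) x| `^ p)%:E)%E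
  else +oo%E.
Proof.
move=> Lu; have [uX|uX] := boolP (u \in X_space a b p psi).
  apply/eqP; rewrite eq_le; apply/andP; split.
    have [u_ [Lu_ cu Fu]] := upper_bound p1 psi_borel psi_gt0 psi_bounded psi_root_integral
      psi_inf ab (set_mem uX).
    by apply: le_trans (limn_einf_le Fu); apply: ereal_inf_lbound; exists u_.
  apply: le_ereal_inf_tmp => _ [u_ [Lu_ cu] <-]; apply: le_ereal_lt_fin => [|C FC].
    apply: adde_ge0; first by rewrite tot_varE adde_ge0.
    by apply: integral_ge0 => x _; rewrite lee_fin powR_ge0.
  by have [] := lower_bound_seq Lu Lu_ cu FC.
apply/eqP; rewrite -leye_eq; apply: le_ereal_inf_tmp => _ [u_ [Lu_ cu] <-].
rewrite leNgt; apply/negP => Fy.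
have [C FC] : exists C : R, (limn_einf (fun k => F_functional a b p psi (u_ k)) < C%:E)%E.
  move: Fy; case: (limn_einf _) => [r _|//|_]; last by exists 0; rewrite ltNyr.
  by exists (r + 1); rewrite lte_fin ltrDl.
have [uX' _] := lower_bound_seq Lu Lu_ cu FC.
by move/negP: uX; apply; exact: mem_set.
Qed.

End relaxation.

Theorem theorem3p4 (R : realType) (a b p : R) (psi : R -> R)
  (hab : a < b) (hp : 1 < p)
  (psi_borel : measurable_fun setT psi)
  (psi_gt0 : forall t : R, 0 < psi t)
  (psi_bounded : bounded_fun psi)
  (psi_root_integral :
    (\int[lebesgue_measure]_(t in setT) (psi t `^ p^-1)%:E < +oo)%E)
  (psi_inf : forall K : set R, compact K ->
    (0 < ereal_inf [set (psi t)%:E | t in K])%E)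
  (u : R -> R) (hu : Lp_space a b 1 u) :
  relaxation a b (F_functional a b p psi) u =
  if u \in X_space a b p psi then
    (tot_var (distr_derivative a b u) `]a, b[ +
     \int[lebesgue_measure]_(x in `]a, b[)
       (`|weak_derivative a b (Psi_deriv_ac a b p psi u) x| `^ p)%:E)%E
  else +oo%E.
Proof.
exact: relaxationE.
Qed.
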